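(* (i) If $0\le B<A\le1$, then $R_{\mathscr{S}^*_{\wp,n}}(\mathcal{S}^*_n[A,B])=R_1:=\min\left\{1,\left(\frac{1/e}{A-(1-1/e)B}\right)^{1/n}\right\}$. (ii) If $-1\le B<0\le A\le1$, let $R_1$ be as in (i), $R_2=\min\{1,(e/(A-(e+1)B))^{1/n}\}$ and $r_1=\left(\frac{(e^2-1)/(2e)}{((e^2+2e-1)/(2e))B^2-AB}\right)^{1/(2n)}$. Then $R_{\mathscr{S}^*_{\wp,n}}(\mathcal{S}^*_n[A,B])=R_1$ if $R_1\le r_1$ and $=R_2$ if $R_1>r_1$. In particular, $R_{\mathscr{S}^*_\wp}(\mathcal{S}^* )=1/(2e-1)$. The radii are sharp.
   Context: $\mathbb{D}$ is the unit disk. For $n\ge1$, $\mathcal{A}_n$ is the class of analytic $f$ on $\mathbb{D}$ of the form $f(z)=z+\sum_{k\ge n+1}b_kz^k$, $\mathcal{A}=\mathcal{A}_1$. $f\prec g$ means $f=g\circ\omega$ for analytic $\omega:\mathbb{D}\to\mathbb{D}$, $\omega(0)=0$. $\wp(z)=1+ze^z$, $\mathscr{S}^*_\wp=\{f\in\mathcal{A}:zf'/f\prec\wp\}$, $\mathscr{S}^*_{\wp,n}=\mathcal{A}_n\cap\mathscr{S}^*_\wp$. $\mathcal{S}^*_n[A,B]=\{f\in\mathcal{A}_n: zf'(z)/f(z)\prec(1+Az)/(1+Bz)\}$, and $\mathcal{S}^*$ is the class of starlike functions $\{f\in\mathcal{A}:\operatorname{Re}(zf'/f)>0\}$ ($=\mathcal{S}^*_1[1,-1]$).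 For classes $G_1,G_2$, $R_{G_1}(G_2)$ is the largest $r_0\in(0,1]$ such that $r^{-1}f(rz)\in G_1$ for all $0<r\le r_0$ and all $f\in G_2$; ''sharp'' means it cannot be increased. *)

(* Defs.v *)
From Stdlib Require Import Reals.
From Coquelicot Require Import Coquelicot.
Open Scope C_scope.

Definition inD (z : C) : Prop := (Cmod z < 1)%R.

Definition analytic_D (f : C -> C) : Prop :=
  exists a : nat -> C, forall z, inD z -> is_pseries a z (f z).

Definition Cexp (z : C) : C :=
  (exp (Re z) * cos (Im z), exp (Re z) * sin (Im z))%R.

Definition wp (z : C) : C := 1 + z * Cexp z.

Definition classA (n : nat) (f : C -> C) : Prop :=
  exists a : nat -> C,
    (forall z, inD z -> is_pseries a z (f z)) /\
    a 0%nat = 0 /\ a 1%nat = 1 /\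
    (forall k : nat, (2 <= k <= n)%nat -> a k = 0).

Definition schwarz (w : C -> C) : Prop :=
  analytic_D w /\ w 0 = 0 /\ forall z, inD z -> inD (w z).

(* z f'(z)/f(z) < g  (the quotient extended to z = 0 by its removable
   singularity; at z = 0 both sides equal 1 automatically) *)
Definition zf'f_subord (f g : C -> C) : Prop :=
  exists w, schwarz w /\
    forall z, inD z -> z <> 0 ->
      f z <> 0 /\ exists d : C, is_derive f z d /\ z * d / f z = g (w z).

Definition Swp (n : nat) (f : C -> C) : Prop :=
  classA n f /\ zf'f_subord f wp.

Definition Janowski (A B : R) (z : C) : C :=
  (1 + RtoC A * z) / (1 + RtoC B * z).

Definition SAB (n : nat) (A B : R) (f : C -> C) : Prop :=
  classA n f /\ zf'f_subord f (Janowski A B).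

Definition Sstar (f : C -> C) : Prop := SAB 1 1 (-1) f.

Definition dilate (r : R) (f : C -> C) : C -> C :=
  fun z => f (RtoC r * z) / RtoC r.

Definition good_radius (G1 G2 : (C -> C) -> Prop) (r0 : R) : Prop :=
  (0 < r0 <= 1)%R /\
  forall r : R, (0 < r <= r0)%R -> forall f, G2 f -> G1 (dilate r f).

Definition is_radius (G1 G2 : (C -> C) -> Prop) (R0 : R) : Prop :=
  good_radius G1 G2 R0 /\ forall r0, good_radius G1 G2 r0 -> (r0 <= R0)%R.

Definition e_ : R := exp 1.

Definition Rad1 (n : nat) (A B : R) : R :=
  Rmin 1 (Rpower ((/ e_) / (A - (1 - / e_) * B)) (/ INR n)).

Definition Rad2 (n : nat) (A B : R) : R :=
  Rmin 1 (Rpower (e_ / (A - (e_ + 1) * B)) (/ INR n)).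

Definition rad1 (n : nat) (A B : R) : R :=
  Rpower (((e_ ^ 2 - 1) / (2 * e_)) /
          (((e_ ^ 2 + 2 * e_ - 1) / (2 * e_)) * B ^ 2 - A * B))
         (/ (2 * INR n)).

(* Main.v *)
Require Import Defs.
From Stdlib Require Import Reals Ranalysis5 ClassicalEpsilon Lra Lia.
From Coquelicot Require Import Coquelicot.

(** Write [z f'/f = 1 + q] with [q = (A - B) w / (1 + B w)].  Since [f] has no terms of degree
    [2..n], the Schwarz function satisfies [|w(z)| <= |z|^n], so [q(r z)] ranges over the disk with
    real diameter [(-(A - B) rho / (1 - B rho), (A - B) rho / (1 + B rho))], where [rho = r^n].
    The map [u e^u] is injective on the unit disk, and its image contains every disk that contains [0]
    and has its diameter in [[-1/e, e]]; hence [q(r z)] lifts through [u e^u] to a Schwarz function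
    exactly when both endpoints are within [-1/e] and [e].  These two conditions give [R_1] and [R_2],
    and [r_1] is where the centre of the disk passes [sinh 1], the midpoint of [[-1/e, e]].
    Sharpness holds because the solutions of [z f'/f = (1 +- A z^n)/(1 +- B z^n)] reach [-1/e] or [e],
    values that [u e^u] omits on the open unit disk.

    The lift is analytic because a function with a continuous complex derivative on the disk is a
    power series there; this follows from Cauchy's formula, obtained by contracting the
    circle to the point [z]. *)

Open Scope C_scope.

(** * Complex differentiation *)

(** The lift uses neither the open mapping theorem nor the argument principle; surjectivity of u e^u
    and continuity of its inverse are proved separately. Surjectivity is settled ray by ray: for a
    fixed argument of the target, the modulus of u e^u runs continuously from 0 to its value on the
    unit circle along a curve in the disk. Since a disk whose closure contains 0 is starshaped about
    0, it remains to bound the distance from its centre to the image of the unit circle. This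
    reduces to one real inequality, the case of centre sinh 1 and radius cosh 1, where the disk
    touches both -1/e and e. For the inverse, the obstacle is that the derivative e^u (1 + u)
    vanishes at the boundary point -1; in the coordinate log u a contraction factor depending only
    on the reference point, not on the moving one, gets around it. Differentiability then comes from
    the slopes, as 1 + u has no zero inside the disk. The two endpoint conditions survive decreasing
    rho, so they describe all good radii exactly. The choice between R_1 and R_2 is then arithmetic:
    the right end of the diameter is the negative of the left end plus twice the centre. *)

Lemma continuous_C_iff {U : UniformSpace} (f : U -> C) (x : U) :
  continuous f x <->
  continuous (fun y => Re (f y)) x /\ continuous (fun y => Im (f y)) x.
Proof.
split.
- intros H; split.
  + apply (continuous_comp f Re); [exact H|].
    destruct (f x) as [a b]; apply (continuous_fst (U:=R_UniformSpace) (V:=R_UniformSpace)).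
  + apply (continuous_comp f Im); [exact H|].
    destruct (f x) as [a b]; apply (continuous_snd (U:=R_UniformSpace) (V:=R_UniformSpace)).
- intros [H1 H2] P [eps HP].
  assert (K1 : locally x (fun y => ball (Re (f x)) eps (Re (f y)))) by
    apply (H1 (ball (Re (f x)) eps) (locally_ball (T:=R_UniformSpace) _ eps)).
  assert (K2 : locally x (fun y => ball (Im (f x)) eps (Im (f y)))) by
    apply (H2 (ball (Im (f x)) eps) (locally_ball (T:=R_UniformSpace) _ eps)).
  unfold filtermap; generalize (filter_and _ _ K1 K2).
  apply filter_imp; intros y [Hy1 Hy2]; apply HP; split; assumption.
Qed.

Lemma continuous_Re {U : UniformSpace} (f : U -> C) (x : U) :
  continuous f x -> continuous (fun y => Re (f y)) x.
Proof. intros H; apply continuous_C_iff in H; tauto. Qed.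

Lemma continuous_Im {U : UniformSpace} (f : U -> C) (x : U) :
  continuous f x -> continuous (fun y => Im (f y)) x.
Proof. intros H; apply continuous_C_iff in H; tauto. Qed.

Lemma continuous_Cplus {U : UniformSpace} (f g : U -> C) (x : U) :
  continuous f x -> continuous g x -> continuous (fun y => f y + g y) x.
Proof.
intros Hf Hg; apply continuous_C_iff; split.
- apply (continuous_ext (fun y => plus (Re (f y)) (Re (g y)))); [reflexivity|].
  apply (continuous_plus (V:=R_NormedModule)); apply continuous_Re; assumption.
- apply (continuous_ext (fun y => plus (Im (f y)) (Im (g y)))); [reflexivity|].
  apply (continuous_plus (V:=R_NormedModule)); apply continuous_Im; assumption.
Qed.

Lemma continuous_Cmult {U : UniformSpace} (f g : U -> C) (x : U) :
  continuous f x -> continuous g x -> continuous (fun y => f y * g y) x.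
Proof.
intros Hf Hg; apply continuous_C_iff; split.
- apply (continuous_ext
    (fun y => minus (mult (Re (f y)) (Re (g y))) (mult (Im (f y)) (Im (g y))))); [reflexivity|].
  apply (continuous_minus (V:=R_NormedModule)); apply (continuous_mult (K:=R_AbsRing));
   (apply continuous_Re || apply continuous_Im); assumption.
- apply (continuous_ext
    (fun y => plus (mult (Re (f y)) (Im (g y))) (mult (Im (f y)) (Re (g y))))); [reflexivity|].
  apply (continuous_plus (V:=R_NormedModule)); apply (continuous_mult (K:=R_AbsRing));
   (apply continuous_Re || apply continuous_Im); assumption.
Qed.

Lemma continuous_Cext {U : UniformSpace} (f g : U -> C) (x : U) :
  (forall y, f y = g y) -> continuous f x -> continuous g x.
Proof. apply continuous_ext. Qed.

Lemma continuous_Copp {U : UniformSpace} (f : U -> C) (x : U) :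
  continuous f x -> continuous (fun y => - f y) x.
Proof.
intros Hf; apply (continuous_Cext (fun y => - (1) * f y)).
{ intros y; ring. }
apply continuous_Cmult; [apply continuous_const|exact Hf].
Qed.

Lemma continuous_Cminus {U : UniformSpace} (f g : U -> C) (x : U) :
  continuous f x -> continuous g x -> continuous (fun y => f y - g y) x.
Proof. intros Hf Hg; apply continuous_Cplus; [|apply continuous_Copp]; assumption. Qed.

Lemma Re2Im2_neq_0 (z : C) : z <> 0 -> (Re z ^ 2 + Im z ^ 2 <> 0)%R.
Proof.
intros Hz H; apply Hz. destruct z as [a b]; simpl in H.
assert (a = 0 /\ b = 0)%R as [-> ->] by nra. reflexivity.
Qed.

Lemma continuous_Cinv {U : UniformSpace} (f : U -> C) (x : U) :
  continuous f x -> f x <> 0 -> continuous (fun y => / f y) x.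
Proof.
intros Hf Hx.
assert (HN : continuous (fun y => / (Re (f y) ^ 2 + Im (f y) ^ 2))%R x).
{ apply (continuous_comp (fun y => (Re (f y) ^ 2 + Im (f y) ^ 2))%R Rinv).
  - apply (continuous_ext (fun y => plus (mult (Re (f y)) (Re (f y))) (mult (Im (f y)) (Im (f y))))).
    { intros y; unfold plus, mult; simpl; ring. }
    apply (continuous_plus (V:=R_NormedModule)); apply (continuous_mult (K:=R_AbsRing));
     (apply continuous_Re || apply continuous_Im); assumption.
  - apply continuity_pt_filterlim, continuity_pt_inv.
    + apply continuity_pt_id.
    + apply Re2Im2_neq_0, Hx. }
apply continuous_C_iff; split.
- apply (continuous_ext (fun y => mult (Re (f y)) (/ (Re (f y) ^ 2 + Im (f y) ^ 2))%R)); [reflexivity|].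
  apply (continuous_mult (K:=R_AbsRing)); [apply continuous_Re|]; assumption.
- apply (continuous_ext (fun y => mult (opp (Im (f y))) (/ (Re (f y) ^ 2 + Im (f y) ^ 2))%R)); [reflexivity|].
  apply (continuous_mult (K:=R_AbsRing)); [|assumption].
  apply (continuous_opp (V:=R_NormedModule)), continuous_Im, Hf.
Qed.

Lemma continuous_Cpow {U : UniformSpace} (f : U -> C) (x : U) (n : nat) :
  continuous f x -> continuous (fun y => f y ^ n) x.
Proof.
intros Hf; induction n as [|n IH].
- apply (continuous_const (U:=U) (V:=C_UniformSpace)).
- apply (continuous_Cext (fun y => f y * f y ^ n)); [reflexivity|].
  apply continuous_Cmult; assumption.
Qed.

Lemma ball_Cmod (x y : C) (eps : posreal) :
  (Cmod (y - x) < eps)%R -> ball (x : C_UniformSpace) eps y.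
Proof. apply C_NormedModule_mixin_compat1. Qed.

(** Balls of [C_UniformSpace] are squares; their half diagonal costs a factor sqrt 2, rounded up to
    2. *)
Lemma Cmod_ball (x y : C) (eps : posreal) :
  ball (x : C_UniformSpace) eps y -> (Cmod (y - x) < 2 * eps)%R.
Proof.
intros H; apply C_NormedModule_mixin_compat2 in H.
apply Rlt_le_trans with (1 := H), Rmult_le_compat_r.
- apply Rlt_le, cond_pos.
- generalize (sqrt_sqrt 2) (sqrt_pos 2); nra.
Qed.

Lemma locally_Cmod (x : C) (P : C -> Prop) :
  locally (x : C_UniformSpace) P <->
  exists d, (0 < d)%R /\ forall y, (Cmod (y - x) < d)%R -> P y.
Proof.
split.
- intros [d Hd]; exists d; split; [apply cond_pos|].
  intros y Hy; apply Hd, ball_Cmod, Hy.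
- intros [d [Hd H]]. 
  assert (Hd2 : (0 < d / 2)%R) by lra.
  exists (mkposreal _ Hd2); intros y Hy; apply H.
  apply Cmod_ball in Hy; simpl in Hy; lra.
Qed.

Lemma continuous_Cmod_iff {U : UniformSpace} (f : U -> C) (x : U) :
  continuous f x <->
  forall eps, (0 < eps)%R -> locally x (fun y => (Cmod (f y - f x) < eps)%R).
Proof.
split.
- intros H eps He. apply (H (fun y => (Cmod (y - f x) < eps)%R)).
  apply locally_Cmod. exists eps; auto.
- intros H P HP. apply locally_Cmod in HP. destruct HP as [d [Hd HP]].
  unfold filtermap. generalize (H d Hd). apply filter_imp; auto.
Qed.

(* Caratheodory's form of complex differentiability. *)
Definition cder (f : C -> C) (z d : C) : Prop :=
  exists phi : C -> C, continuous phi z /\ phi z = d /\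
    forall y, f y - f z = phi y * (y - z).

Lemma Cminus_self (z : C) : z - z = 0. Proof. ring. Qed.

Lemma cder_is_derive (f : C -> C) (z d : C) : cder f z d <-> is_derive f z d.
Proof.
split.
- intros [phi [Hc [Hd Hphi]]]; split.
  { apply is_linear_scal_l. }
  intros x Hx. apply (is_filter_lim_locally_unique (K:=C_AbsRing) (V:=AbsRing_NormedModule C_AbsRing)) in Hx. subst x.
  intros eps. apply (proj1 (locally_C _ _)).
  generalize (proj1 (continuous_Cmod_iff phi z) Hc eps (cond_pos eps)).
  apply filter_imp; intros y Hy.
  change (Cmod ((f y - f z) - (y - z) * d) <= eps * Cmod (y - z))%R.
  rewrite Hphi, <- Hd.
  replace (phi y * (y - z) - (y - z) * phi z) with ((phi y - phi z) * (y - z)) by ring.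
  rewrite Cmod_mult. apply Rmult_le_compat_r; [apply Cmod_ge_0|lra].
- intros [_ H].
  specialize (H z (fun P HP => HP)).
  (* The difference quotient is completed by [d] at [z]; its continuity there is
     differentiability. *)
  exists (fun y => if Ceq_dec y z then d else (f y - f z) / (y - z)).
  split; [|split].
  + apply continuous_Cmod_iff. intros eps He.
    assert (He2 : (0 < eps / 2)%R) by lra.
    generalize (proj2 (locally_C _ _) (H (mkposreal _ He2))).
    apply filter_imp. intros y Hy.
    change (Cmod ((f y - f z) - (y - z) * d) <= eps / 2 * Cmod (y - z))%R in Hy.
    destruct (Ceq_dec z z) as [_|]; [|congruence].
    destruct (Ceq_dec y z) as [->|Hyz].
    { rewrite Cminus_self, Cmod_0; exact He. }
    assert (Hyz' : y - z <> 0) by (apply Cminus_eq_contra, Hyz).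
    replace ((f y - f z) / (y - z) - d) with (((f y - f z) - (y - z) * d) / (y - z)) by (field; exact Hyz').
    rewrite Cmod_div by exact Hyz'.
    apply Rle_lt_trans with (eps / 2)%R; [|lra].
    apply Rle_div_l; [|exact Hy].
    apply Cmod_gt_0, Hyz'.
  + destruct (Ceq_dec z z); congruence.
  + intros y. destruct (Ceq_dec y z) as [->|Hyz]; [ring|].
    field. apply Cminus_eq_contra, Hyz.
Qed.

Lemma cder_unique (f : C -> C) (z d e : C) : cder f z d -> cder f z e -> d = e.
Proof.
intros H1 H2; apply cder_is_derive in H1, H2.
rewrite <- (is_C_derive_unique _ _ _ H1). apply is_C_derive_unique, H2.
Qed.

Lemma cder_continuous (f : C -> C) (z d : C) : cder f z d -> continuous f z.
Proof.
intros [phi [Hc [_ H]]].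
apply (continuous_Cext (fun y => f z + phi y * (y - z))).
{ intros y; rewrite <- H; ring. }
apply continuous_Cplus; [apply continuous_const|].
apply continuous_Cmult; [exact Hc|].
apply continuous_Cminus; [apply continuous_id|apply continuous_const].
Qed.

Lemma cder_const (c z : C) : cder (fun _ => c) z 0.
Proof. exists (fun _ => 0); split; [apply continuous_const|split; [reflexivity|intros; ring]]. Qed.

Lemma cder_id (z : C) : cder (fun y => y) z 1.
Proof. exists (fun _ => 1); split; [apply continuous_const|split; [reflexivity|intros; ring]]. Qed.

Lemma cder_ext (f g : C -> C) (z d : C) :
  (forall y, f y = g y) -> cder f z d -> cder g z d.
Proof. intros E [phi H]; exists phi; split; [|split]; try apply H. intros y; rewrite <- !E; apply H. Qed.

Lemma cder_ext_loc (f g : C -> C) (z d : C) :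
  locally (z : C_UniformSpace) (fun y => f y = g y) -> cder f z d -> cder g z d.
Proof.
intros E H; apply cder_is_derive in H; apply cder_is_derive.
apply (is_derive_ext_loc f); [apply locally_C, E|exact H].
Qed.

Lemma cder_plus (f g : C -> C) (z d e : C) :
  cder f z d -> cder g z e -> cder (fun y => f y + g y) z (d + e).
Proof.
intros [p [Hp [Hd Hf]]] [q [Hq [He Hg]]].
exists (fun y => p y + q y); split; [apply continuous_Cplus; assumption|split].
- congruence.
- intros y. replace (f y + g y - (f z + g z)) with ((f y - f z) + (g y - g z)) by ring.
  rewrite Hf, Hg; ring.
Qed.

Lemma cder_mult (f g : C -> C) (z d e : C) :
  cder f z d -> cder g z e -> cder (fun y => f y * g y) z (d * g z + f z * e).
Proof.
intros Hf0 Hg0. assert (Hc := cder_continuous _ _ _ Hg0).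
destruct Hf0 as [p [Hp [Hd Hf]]]; destruct Hg0 as [q [Hq [He Hg]]].
exists (fun y => p y * g y + f z * q y); split; [|split].
- apply continuous_Cplus; apply continuous_Cmult; try assumption. apply continuous_const.
- congruence.
- intros y. replace (f y * g y - (f z * g z)) with ((f y - f z) * g y + f z * (g y - g z)) by ring.
  rewrite Hf, Hg; ring.
Qed.

Lemma cder_scal (c : C) (f : C -> C) (z d : C) :
  cder f z d -> cder (fun y => c * f y) z (c * d).
Proof.
intros H. replace (c * d) with (0 * f z + c * d) by ring.
apply (cder_mult (fun _ => c)); [apply cder_const|exact H].
Qed.

Lemma cder_minus (f g : C -> C) (z d e : C) :
  cder f z d -> cder g z e -> cder (fun y => f y - g y) z (d - e).
Proof.
intros Hf Hg. replace (d - e) with (d + (-(1)) * e) by ring.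
apply (cder_ext (fun y => f y + (-(1)) * g y)); [intros; ring|].
apply cder_plus; [|apply cder_scal]; assumption.
Qed.

Lemma cder_comp (f g : C -> C) (z d e : C) :
  cder f (g z) d -> cder g z e -> cder (fun y => f (g y)) z (d * e).
Proof.
intros [p [Hp [Hd Hf]]] Hg0. assert (Hc := cder_continuous _ _ _ Hg0).
destruct Hg0 as [q [Hq [He Hg]]].
exists (fun y => p (g y) * q y); split; [|split].
- apply continuous_Cmult; [|assumption]. apply (continuous_comp g p); assumption.
- congruence.
- intros y; rewrite Hf, Hg; ring.
Qed.

(* The slope of the inverse is the inverse of the slope of [F], so continuity of
   the local right inverse [w] suffices. *)
Lemma cder_implicit (F w q : C -> C) (z a d : C) :
  cder F (w z) a -> a <> 0 -> continuous w z -> cder q z d ->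
  locally (z : C_UniformSpace) (fun y => F (w y) = q y) -> cder w z (d / a).
Proof.
intros [p [Hp [Ha HF]]] Ha0 Hw [s [Hs [Hd Hq]]] Hloc.
assert (Hz : F (w z) = q z) by (apply (locally_singleton _ _ Hloc)).
assert (Hpw : continuous (fun y => p (w y)) z) by (apply (continuous_comp w p); assumption).
assert (Hne : locally (z : C_UniformSpace) (fun y => p (w y) <> 0)).
{ assert (H0 : (0 < Cmod a)%R) by (apply Cmod_gt_0, Ha0).
  generalize (proj1 (continuous_Cmod_iff _ _) Hpw _ H0).
  apply filter_imp. intros y Hy E. rewrite E, Ha in Hy.
  replace (0 - a) with (- a) in Hy by ring. rewrite Cmod_opp in Hy. lra. }
apply (cder_ext_loc (fun y => w z + s y / p (w y) * (y - z))).
{ generalize (filter_and _ _ Hloc Hne). apply filter_imp. intros y [E Hy].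
  assert (E2 : p (w y) * (w y - w z) = s y * (y - z)).
  { rewrite <- HF, <- Hq, E, Hz. reflexivity. }
  replace (s y / p (w y) * (y - z)) with (s y * (y - z) / p (w y)) by (unfold Cdiv; ring).
  rewrite <- E2. field. exact Hy. }
exists (fun y => s y / p (w y)); split; [|split].
- apply continuous_Cmult; [exact Hs|]. apply continuous_Cinv; [exact Hpw|]. rewrite Ha; exact Ha0.
- congruence.
- intros y. ring.
Qed.

Lemma cder_inv (f : C -> C) (z d : C) :
  cder f z d -> f z <> 0 -> cder (fun y => / f y) z (- d / (f z * f z)).
Proof.
intros Hf0 Hz. assert (Hc := cder_continuous _ _ _ Hf0).
destruct Hf0 as [p [Hp [Hd Hf]]].
assert (Hne : locally (z : C_UniformSpace) (fun y => f y <> 0)).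
{ assert (H0 : (0 < Cmod (f z))%R) by (apply Cmod_gt_0, Hz).
  generalize (proj1 (continuous_Cmod_iff _ _) Hc _ H0).
  apply filter_imp. intros y Hy E. rewrite E in Hy.
  replace (0 - f z) with (- f z) in Hy by ring. rewrite Cmod_opp in Hy. lra. }
apply (cder_ext_loc (fun y => / f z + (- p y / (f z * f y)) * (y - z))).
{ revert Hne. apply filter_imp; intros y Hy.
  replace (- p y / (f z * f y) * (y - z)) with (- (p y * (y - z)) / (f z * f y)) by (unfold Cdiv; ring).
  rewrite <- Hf. field. split; assumption. }
exists (fun y => - p y / (f z * f y)); split; [|split].
- apply continuous_Cmult; [apply continuous_Copp, Hp|]. apply continuous_Cinv; [|apply Cmult_neq_0; exact Hz].
  apply continuous_Cmult; [apply continuous_const|exact Hc].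
- congruence.
- intros y; ring.
Qed.

Lemma cder_pow (n : nat) (z : C) : cder (fun y => y ^ S n) z (INR (S n) * z ^ n).
Proof.
induction n as [|n IH].
- replace (INR 1 * z ^ 0) with (RtoC 1) by (simpl; ring).
  apply (cder_ext (fun y => y)); [intros; simpl; ring|]. apply cder_id.
- replace (INR (S (S n)) * z ^ S n) with (1 * z ^ S n + z * (INR (S n) * z ^ n)).
  + apply (cder_mult (fun y => y)); [apply cder_id|exact IH].
  + rewrite (S_INR (S n)), RtoC_plus. simpl Cpow. ring.
Qed.

Lemma cder_bound (f : C -> C) (z d : C) : cder f z d ->
  exists M dl, (0 < dl)%R /\ (0 < M)%R /\
    forall y, (Cmod (y - z) < dl -> Cmod (f y - f z) <= M * Cmod (y - z))%R.
Proof.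
intros [p [Hp [Hd Hf]]].
destruct (proj1 (locally_Cmod _ _) (proj1 (continuous_Cmod_iff _ _) Hp 1%R Rlt_0_1)) as [dl [Hdl H]].
exists (Cmod d + 1)%R, dl. split; [exact Hdl|]. split; [generalize (Cmod_ge_0 d); lra|].
intros y Hy. rewrite Hf, Cmod_mult. apply Rmult_le_compat_r; [apply Cmod_ge_0|].
specialize (H y Hy). rewrite Hd in H.
replace (p y) with ((p y - d) + d) by ring. generalize (Cmod_triangle (p y - d) d). lra.
Qed.

(** Continuity of [f'] is included because Cauchy's formula is obtained below by differentiating
    under the integral sign; Goursat's argument is thereby avoided. *)
Definition C1_on_D (f f' : C -> C) : Prop :=
  forall z, inD z -> cder f z (f' z) /\ continuous f' z.

Lemma inD_locally (z : C) : inD z -> locally (z : C_UniformSpace) inD.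
Proof.
intros Hz. apply locally_Cmod. exists (1 - Cmod z)%R; split; [unfold inD in Hz; lra|].
intros y Hy. unfold inD. replace y with ((y - z) + z) by ring.
generalize (Cmod_triangle (y - z) z); lra.
Qed.

(** * Cauchy's formula *)

(** The counterpart of [cder] for curves: with slopes on both sides, the chain rule for a complex
    function along a curve is a product of slopes. *)
Definition rder (g : R -> C) (t : R) (d : C) : Prop :=
  exists psi : R -> C, continuous psi t /\ psi t = d /\
    forall s, g s - g t = psi s * RtoC (s - t).

Definition slope (h : R -> R) (t l s : R) : R :=
  if Req_EM_T s t then l else ((h s - h t) / (s - t))%R.

Lemma slope_eq (h : R -> R) (t l s : R) : (h s - h t = slope h t l s * (s - t))%R.
Proof. unfold slope. destruct (Req_EM_T s t) as [->|H]; [ring|]. field; lra. Qed.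

Lemma slope_continuous (h : R -> R) (t l : R) : is_derive h t l -> continuous (slope h t l) t.
Proof.
intros H. apply is_derive_Reals in H.
apply continuity_pt_filterlim. intros eps He.
destruct (H eps He) as [d Hd]. exists d; split; [apply cond_pos|].
intros s [_ Hs]. unfold R_dist in *. simpl in *. unfold R_dist in *. unfold slope at 2.
destruct (Req_EM_T t t) as [_|]; [|congruence].
unfold slope. destruct (Req_EM_T s t) as [->|Hst].
- rewrite Rminus_diag, Rabs_R0; exact He.
- specialize (Hd (s - t)%R). replace (t + (s - t))%R with s in Hd by ring.
  apply Hd; [lra|exact Hs].
Qed.

Lemma rder_intro (g : R -> C) (t : R) (d : C) :
  is_derive (fun s => Re (g s)) t (Re d) -> is_derive (fun s => Im (g s)) t (Im d) -> rder g t d.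
Proof.
intros H1 H2.
exists (fun s => (slope (fun s => Re (g s)) t (Re d) s, slope (fun s => Im (g s)) t (Im d) s)).
split; [|split].
- apply continuous_C_iff; split; simpl; apply slope_continuous; assumption.
- unfold slope. destruct (Req_EM_T t t) as [_|]; [|congruence]. destruct d; reflexivity.
- intros s. generalize (slope_eq (fun s => Re (g s)) t (Re d) s) (slope_eq (fun s => Im (g s)) t (Im d) s).
  intros E1 E2.
  apply injective_projections; simpl;
   [change (fst (g s)) with (Re (g s)); change (fst (g t)) with (Re (g t))
   |change (snd (g s)) with (Im (g s)); change (snd (g t)) with (Im (g t))]; lra.
Qed.

Lemma rder_Re (g : R -> C) (t : R) (d : C) : rder g t d -> is_derive (fun s => Re (g s)) t (Re d).
Proof.
intros [psi [Hc [Hd H]]]. apply is_derive_Reals. intros eps He.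
apply continuous_Re in Hc.
destruct (proj1 (continuity_pt_locally (fun s => Re (psi s)) t) (proj2 (continuity_pt_filterlim _ _) Hc) (mkposreal _ He)) as [dl Hdl].
exists dl. intros h Hh Hlt.
assert (E : Re (g (t + h)%R - g t) = (Re (psi (t + h)%R) * h)%R).
{ rewrite H. replace (t + h - t)%R with h by ring. rewrite re_scal_r. reflexivity. }
change (Re (g (t + h)%R - g t)) with (Re (g (t + h)%R) + - Re (g t))%R in E.
replace ((Re (g (t + h)%R) - Re (g t)) / h)%R with (Re (psi (t + h)%R)).
- rewrite <- Hd. apply (Hdl (t + h)%R).
  change (Rabs (t + h - t) < dl)%R. replace (t + h - t)%R with h by ring. exact Hlt.
- unfold Rminus. rewrite E. field. exact Hh.
Qed.

Lemma rder_comp (f : C -> C) (g : R -> C) (t : R) (d e : C) :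
  cder f (g t) d -> rder g t e -> rder (fun s => f (g s)) t (d * e).
Proof.
intros [p [Hp [Hd Hf]]] [q [Hq [He Hg]]].
assert (Hc : continuous g t).
{ apply (continuous_Cext (fun s => g t + q s * RtoC (s - t))).
  { intros s; rewrite <- Hg; ring. }
  apply continuous_Cplus; [apply continuous_const|]. apply continuous_Cmult; [exact Hq|].
  apply continuous_C_iff; split; simpl; [|apply continuous_const].
  apply (continuous_minus (V:=R_NormedModule)); [apply continuous_id|apply continuous_const]. }
exists (fun s => p (g s) * q s); split; [|split].
- apply continuous_Cmult; [|exact Hq]. apply (continuous_comp g p); assumption.
- congruence.
- intros s; rewrite Hf, Hg; ring.
Qed.

Definition cis (t : R) : C := (cos t, sin t).

Lemma Cmod_cis (t : R) : Cmod (cis t) = 1%R.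
Proof.
unfold Cmod, cis; simpl. transitivity (sqrt 1); [f_equal|apply sqrt_1].
generalize (sin2_cos2 t). unfold Rsqr. lra.
Qed.

Lemma rder_cis (t : R) : rder cis t (Ci * cis t).
Proof.
apply rder_intro; unfold cis; simpl; auto_derive; trivial; ring.
Qed.

Lemma continuous_cis (t : R) : continuous cis t.
Proof.
apply continuous_C_iff; split; simpl; apply continuity_pt_filterlim.
- apply continuity_cos.
- apply continuity_sin.
Qed.

Lemma cis_2PI : cis (2 * PI) = cis 0.
Proof. unfold cis. rewrite cos_2PI, sin_2PI, cos_0, sin_0. reflexivity. Qed.

Lemma continuous_RtoC {U : UniformSpace} (f : U -> R) (x : U) :
  continuous f x -> continuous (fun y => RtoC (f y)) x.
Proof. intros H. apply continuous_C_iff; split; simpl; [exact H|apply continuous_const]. Qed.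

Lemma ex_RInt_Re (g : R -> C) (a b : R) :
  (forall t, continuous g t) -> ex_RInt (fun t => Re (g t)) a b.
Proof. intros H. apply (ex_RInt_continuous (V:=R_CompleteNormedModule)). intros t _. apply continuous_Re, H. Qed.

Lemma RInt_Re_closed (g g' : R -> C) :
  (forall t, rder g t (g' t)) -> (forall t, continuous g' t) -> g (2 * PI)%R = g 0%R ->
  RInt (fun t => Re (g' t)) 0 (2 * PI) = 0%R.
Proof.
intros H Hc E.
apply is_RInt_unique.
replace 0%R with (minus (Re (g (2 * PI)%R)) (Re (g 0%R))) at 2.
- apply (is_RInt_derive (V:=R_CompleteNormedModule) (fun t => Re (g t))).
  + intros t _. apply rder_Re, H.
  + intros t _. apply continuous_Re, Hc.
- rewrite E. unfold minus, plus, opp; simpl; ring.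
Qed.

Section Homotopy.
Variables (f f' : C -> C) (r : R) (z : C).
Hypothesis Hf : C1_on_D f f'.
Hypothesis Hr : (0 < r < 1)%R.
Hypothesis Hz : (Cmod z < r)%R.

Let zeta (t : R) : C := RtoC r * cis t.
(** On the circle, [K t] dt is the Cauchy kernel d zeta / (i (zeta - z)). *)
Let K (t : R) : C := zeta t / (zeta t - z).
Let path (s t : R) : C := z + RtoC s * (zeta t - z).

Lemma Cmod_circle (t : R) : Cmod (RtoC r * cis t) = r.
Proof. rewrite Cmod_mult, Cmod_cis, Cmod_R, Rabs_pos_eq; lra. Qed.

Lemma circle_minus_neq_0 (t : R) : RtoC r * cis t - z <> 0.
Proof.
intros E. apply Ceq_minus in E. generalize (Cmod_circle t). rewrite E. lra.
Qed.

Lemma continuous_circle (t : R) : continuous zeta t.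
Proof. apply continuous_Cmult; [apply continuous_const|apply continuous_cis]. Qed.

Lemma continuous_kernel (t : R) : continuous K t.
Proof.
apply continuous_Cmult; [apply continuous_circle|].
apply continuous_Cinv; [|apply circle_minus_neq_0].
apply continuous_Cminus; [apply continuous_circle|apply continuous_const].
Qed.

(** The parameter overshoots [0, 1] so that derivatives in [s] are two-sided at 0 and 1. With a
    margin of (1 - r) / 2 on each side, |1 - s| + |s| < 2 - r, and the modulus stays below r (2 - r)
    = 1 - (1 - r)^2 < 1. *)
Lemma path_inD (s t : R) : (- ((1 - r) / 2) < s < 1 + (1 - r) / 2)%R -> inD (path s t).
Proof.
intros Hs. unfold inD, path.
replace (z + RtoC s * (zeta t - z)) with (RtoC (1 - s) * z + RtoC s * zeta t) by (rewrite RtoC_minus; ring).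
apply Rle_lt_trans with (1 := Cmod_triangle _ _).
rewrite !Cmod_mult, !Cmod_R. fold (Cmod (zeta t)).
assert (E : Cmod (zeta t) = r) by apply Cmod_circle.
rewrite E.
assert (Rabs (1 - s) + Rabs s < 1 + (1 - r))%R.
{ unfold Rabs. destruct (Rcase_abs (1 - s)), (Rcase_abs s); lra. }
assert (Rabs (1 - s) * Cmod z <= Rabs (1 - s) * r)%R.
{ apply Rmult_le_compat_l; [apply Rabs_pos|lra]. }
nra.
Qed.

Lemma rder_path (s t : R) : rder (path s) t (RtoC s * (RtoC r * (Ci * cis t))).
Proof.
unfold path, zeta.
replace (RtoC s * (RtoC r * (Ci * cis t))) with (RtoC s * RtoC r * (Ci * cis t)) by ring.
apply (rder_comp (fun u => z + RtoC s * (RtoC r * u - z)) cis); [|apply rder_cis].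
replace (RtoC s * RtoC r) with (0 + RtoC s * (RtoC r * 1 - 0)) by ring.
apply cder_plus; [apply cder_const|]. apply cder_scal, cder_minus; [|apply cder_const].
apply cder_scal, cder_id.
Qed.

Lemma rder_path_s (s t : R) : rder (fun s => path s t) s (zeta t - z).
Proof.
exists (fun _ => zeta t - z). split; [apply continuous_const|split; [reflexivity|]].
intros u. unfold path. rewrite RtoC_minus. ring.
Qed.

Lemma continuous_path_2d (s t : R) :
  continuous (fun p : R * R => path (fst p) (snd p)) (s, t).
Proof.
unfold path. apply continuous_Cplus; [apply continuous_const|].
apply continuous_Cmult.
- apply (continuous_RtoC (U:=prod_UniformSpace R_UniformSpace R_UniformSpace) fst).
  apply continuous_fst.
- apply continuous_Cminus; [|apply continuous_const].
  apply (continuous_comp (U:=prod_UniformSpace R_UniformSpace R_UniformSpace) snd zeta).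
  + apply continuous_snd.
  + apply continuous_circle.
Qed.

(** For s <> 0 the integrand is the t-derivative of -i f(path) / s along a closed curve. At s = 0
    this primitive is undefined, but the integrand is a constant times [zeta], with primitive -i
    f'(z) [zeta]. *)
Lemma RInt_path_derivative (s : R) : (- ((1 - r) / 2) < s < 1 + (1 - r) / 2)%R ->
  RInt (fun t => Re (f' (path s t) * zeta t)) 0 (2 * PI) = 0%R.
Proof.
intros Hs.
assert (Hcp : forall t, continuous (path s) t).
{ intros t. apply (continuous_comp_2 (fun _ => s) (fun t : R => t) path).
  - apply continuous_const.
  - apply continuous_id.
  - apply continuous_path_2d. }
assert (Hc : forall t, continuous (fun t => f' (path s t) * zeta t) t).
{ intros t. apply continuous_Cmult; [|apply continuous_circle].
  apply (continuous_comp (path s) f'); [apply Hcp|]. apply Hf, path_inD, Hs. }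
destruct (Req_dec s 0) as [->|Hs0].
- apply (RInt_Re_closed (fun t => f' z * (- Ci) * RtoC r * cis t)); [|exact Hc|].
  + intros t. replace (f' (path 0 t) * zeta t) with (f' z * (- Ci) * RtoC r * 1 * (Ci * cis t)).
    * apply (rder_comp (fun u => f' z * (- Ci) * RtoC r * u) cis); [|apply rder_cis].
      apply cder_scal, cder_id.
    * replace (path 0 t) with z by (unfold path; ring). unfold zeta.
      replace (f' z * (- Ci) * RtoC r * 1 * (Ci * cis t)) with (- (Ci * Ci) * (f' z * RtoC r * cis t)) by ring.
      replace (Ci * Ci) with (- (1)) by (unfold Ci; apply injective_projections; simpl; ring). ring.
  + rewrite cis_2PI; reflexivity.
- assert (Hs1 : RtoC s <> 0) by (intros E; apply RtoC_inj in E; auto).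
  apply (RInt_Re_closed (fun t => (- Ci / RtoC s) * f (path s t))); [|exact Hc|].
  + intros t.
    replace (f' (path s t) * zeta t) with
      ((- Ci / RtoC s) * f' (path s t) * (RtoC s * (RtoC r * (Ci * cis t)))).
    * apply (rder_comp (fun u => (- Ci / RtoC s) * f u) (path s)); [|apply rder_path].
      apply cder_scal, Hf, path_inD, Hs.
    * unfold zeta.
      replace (- Ci / RtoC s * f' (path s t) * (RtoC s * (RtoC r * (Ci * cis t))))
        with (- (Ci * Ci) * (f' (path s t) * (RtoC r * cis t))) by (field; exact Hs1).
      replace (Ci * Ci) with (- (1)) by (unfold Ci; apply injective_projections; simpl; ring). ring.
  + unfold path, zeta. rewrite cis_2PI; reflexivity.
Qed.

Lemma rder_integrand (s t : R) : (- ((1 - r) / 2) < s < 1 + (1 - r) / 2)%R ->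
  is_derive (fun s => Re (f (path s t) * K t)) s (Re (f' (path s t) * zeta t)).
Proof.
intros Hs. apply (rder_Re (fun s => f (path s t) * K t)).
replace (f' (path s t) * zeta t) with (K t * f' (path s t) * (zeta t - z)).
- apply (rder_comp (fun u => f u * K t) (fun s => path s t)); [|apply rder_path_s].
  replace (K t * f' (path s t)) with (f' (path s t) * K t + f (path s t) * 0) by ring.
  apply cder_mult; [|apply cder_const]. apply Hf, path_inD, Hs.
- unfold K. field. apply circle_minus_neq_0.
Qed.

Lemma locally_path_param (s : R) : (- ((1 - r) / 2) < s < 1 + (1 - r) / 2)%R ->
  locally s (fun s => - ((1 - r) / 2) < s < 1 + (1 - r) / 2)%R.
Proof.
intros Hs.
apply (locally_interval _ s (Finite (- ((1 - r) / 2))) (Finite (1 + (1 - r) / 2))); simpl; try lra.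
intros; split; assumption.
Qed.

(** The s-derivative of the integral over [path s] is the integral of f'(path) [zeta], because the
    factor [zeta t - z] cancels the denominator of [K]; it vanishes by [RInt_path_derivative]. Hence
    the circle (s = 1) may be contracted to the point [z] (s = 0). Real parts suffice, since the
    imaginary part of a function is the real part of its product with -i. *)
Lemma homotopy_Re :
  RInt (fun t => Re (f (zeta t) * K t)) 0 (2 * PI) = RInt (fun t => Re (f z * K t)) 0 (2 * PI).
Proof.
set (I := fun s => RInt (fun t => Re (f (path s t) * K t)) 0 (2 * PI)).
assert (HI : forall s, (- ((1 - r) / 2) < s < 1 + (1 - r) / 2)%R -> is_derive I s 0%R).
{ intros s Hs.
  replace 0%R with (RInt (fun t => Derive (fun u => Re (f (path u t) * K t)) s) 0 (2 * PI)).
  - apply is_derive_RInt_param.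
    + generalize (locally_path_param s Hs). apply filter_imp. intros u Hu t _.
      eexists. apply rder_integrand, Hu.
    + intros t _. 
      apply (continuity_2d_pt_ext_loc (fun u v => Re (f' (path u v) * zeta v))).
      { destruct (locally_path_param s Hs) as [d Hd]. exists d. intros u v Hu _.
        symmetry. apply is_derive_unique, rder_integrand, Hd, Hu. }
      apply continuity_2d_pt_filterlim.
      apply (continuous_Re (U:=prod_UniformSpace R_UniformSpace R_UniformSpace)
        (fun p => f' (path (fst p) (snd p)) * zeta (snd p)) (s, t)).
      apply continuous_Cmult.
      * apply (continuous_comp (U:=prod_UniformSpace R_UniformSpace R_UniformSpace)
          (fun p => path (fst p) (snd p)) f'); [apply continuous_path_2d|].
        apply Hf, path_inD, Hs.
      * apply (continuous_comp (U:=prod_UniformSpace R_UniformSpace R_UniformSpace) snd zeta).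
        -- apply continuous_snd.
        -- apply continuous_circle.
    + generalize (locally_path_param s Hs). apply filter_imp. intros u Hu.
      apply ex_RInt_Re. intros t. apply continuous_Cmult; [|apply continuous_kernel].
      apply (continuous_comp (path u) f).
      * apply (continuous_comp_2 (fun _ => u) (fun t : R => t) path).
        -- apply continuous_const.
        -- apply continuous_id.
        -- apply continuous_path_2d.
      * apply (cder_continuous f _ (f' (path u t))), Hf, path_inD, Hu.
  - transitivity (RInt (fun t => Re (f' (path s t) * zeta t)) 0 (2 * PI)); [|apply RInt_path_derivative, Hs].
    apply RInt_ext. intros t _.
    apply is_derive_unique, rder_integrand, Hs. }
assert (E : I 0%R = I 1%R).
{ apply (eq_is_derive I 0%R 1%R); [|lra]. intros s Hs. apply HI. lra. }
unfold I in E.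
transitivity (RInt (fun t => Re (f (path 1 t) * K t)) 0 (2 * PI)).
- apply RInt_ext. intros t _. do 3 f_equal. unfold path; ring.
- rewrite <- E. apply RInt_ext. intros t _. do 3 f_equal. unfold path; ring.
Qed.

End Homotopy.

(** * Complex integrals over one period *)

Definition CInt (g : R -> C) : C :=
  (RInt (fun t => Re (g t)) 0 (2 * PI), RInt (fun t => Im (g t)) 0 (2 * PI)).

Lemma Im_as_Re (w : C) : Im w = Re (- Ci * w).
Proof. destruct w; simpl; ring. Qed.

Lemma ex_RInt_Im (g : R -> C) (a b : R) :
  (forall t, continuous g t) -> ex_RInt (fun t => Im (g t)) a b.
Proof. intros H. apply (ex_RInt_continuous (V:=R_CompleteNormedModule)). intros t _. apply continuous_Im, H. Qed.

Lemma CInt_ext (g h : R -> C) : (forall t, g t = h t) -> CInt g = CInt h.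
Proof. intros H; unfold CInt; f_equal; apply RInt_ext; intros; rewrite H; reflexivity. Qed.

Lemma CInt_plus (g h : R -> C) : (forall t, continuous g t) -> (forall t, continuous h t) ->
  CInt (fun t => g t + h t) = CInt g + CInt h.
Proof.
intros Hg Hh; unfold CInt; apply injective_projections; simpl.
- apply (RInt_plus (V:=R_CompleteNormedModule) (fun t => Re (g t)) (fun t => Re (h t))); apply ex_RInt_Re; assumption.
- apply (RInt_plus (V:=R_CompleteNormedModule) (fun t => Im (g t)) (fun t => Im (h t))); apply ex_RInt_Im; assumption.
Qed.

Lemma CInt_scal (c : C) (g : R -> C) : (forall t, continuous g t) ->
  CInt (fun t => c * g t) = c * CInt g.
Proof.
intros Hg. assert (H1 := fun a b => ex_RInt_Re g a b Hg). assert (H2 := fun a b => ex_RInt_Im g a b Hg).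
unfold CInt; apply injective_projections; simpl.
- rewrite <- (RInt_scal (V:=R_CompleteNormedModule) (fun t => Re (g t))), <- (RInt_scal (V:=R_CompleteNormedModule) (fun t => Im (g t))) by auto.
  apply (RInt_minus (V:=R_CompleteNormedModule) (fun t => scal (fst c) (Re (g t))) (fun t => scal (snd c) (Im (g t)))); apply (ex_RInt_scal (V:=R_NormedModule)); auto.
- rewrite <- (RInt_scal (V:=R_CompleteNormedModule) (fun t => Re (g t))), <- (RInt_scal (V:=R_CompleteNormedModule) (fun t => Im (g t))) by auto.
  apply (RInt_plus (V:=R_CompleteNormedModule) (fun t => scal (fst c) (Im (g t))) (fun t => scal (snd c) (Re (g t)))); apply (ex_RInt_scal (V:=R_NormedModule)); auto.
Qed.

Lemma CInt_const (c : C) : CInt (fun _ => c) = c * RtoC (2 * PI).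
Proof.
unfold CInt. rewrite !RInt_const. destruct c as [x y].
apply injective_projections; simpl; unfold scal; simpl; unfold mult; simpl; ring.
Qed.

Lemma CInt_closed (g g' : R -> C) :
  (forall t, rder g t (g' t)) -> (forall t, continuous g' t) -> g (2 * PI)%R = g 0%R ->
  CInt g' = 0.
Proof.
intros H Hc E. unfold CInt. apply injective_projections; simpl.
- apply (RInt_Re_closed g g'); assumption.
- transitivity (RInt (fun t => Re (- Ci * g' t)) 0 (2 * PI)); [|apply (RInt_Re_closed (fun t => - Ci * g t))].
  + apply RInt_ext. intros t _. apply Im_as_Re.
  + intros t. replace (- Ci * g' t) with (- Ci * 1 * g' t) by ring.
    apply (rder_comp (fun u => - Ci * u)); [|apply H]. apply cder_scal, cder_id.
  + intros t. apply continuous_Cmult; [apply continuous_const|apply Hc].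
  + congruence.
Qed.

Lemma im_le_Cmod (c : C) : (Rabs (Im c) <= Cmod c)%R.
Proof. apply Rle_trans with (2 := Rmax_Cmod c). apply Rmax_r. Qed.

Lemma Cmod_le_ReIm (c : C) : (Cmod c <= Rabs (Re c) + Rabs (Im c))%R.
Proof.
replace c with (RtoC (Re c) + Ci * RtoC (Im c)) at 1.
- apply Rle_trans with (1 := Cmod_triangle _ _). rewrite Cmod_mult, Cmod_Ci, !Cmod_R. lra.
- destruct c; apply injective_projections; simpl; ring.
Qed.

Lemma RInt_bound (h : R -> R) (M : R) : (forall t, continuous h t) ->
  (forall t, (0 <= t <= 2 * PI -> Rabs (h t) <= M)%R) -> (Rabs (RInt h 0 (2 * PI)) <= 2 * PI * M)%R.
Proof.
intros Hc Hb.
assert (HP := PI_RGT_0).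
replace (2 * PI * M)%R with ((2 * PI - 0) * M)%R by ring.
apply abs_RInt_le_const; [lra| |exact Hb].
apply (ex_RInt_continuous (V:=R_CompleteNormedModule)). intros t _; apply Hc.
Qed.

(** Bounding the two components separately gives 4 PI in place of the sharp 2 PI. The lost factor is
    harmless: convergence estimates absorb it, and the maximum principle removes it by taking
    roots. *)
Lemma CInt_bound (g : R -> C) (M : R) : (forall t, continuous g t) ->
  (forall t, (0 <= t <= 2 * PI -> Cmod (g t) <= M)%R) -> (Cmod (CInt g) <= 4 * PI * M)%R.
Proof.
intros Hc Hb. apply Rle_trans with (1 := Cmod_le_ReIm _). simpl.
assert (Rabs (RInt (fun t => Re (g t)) 0 (2 * PI)) <= 2 * PI * M)%R.
{ apply RInt_bound; [intros; apply continuous_Re, Hc|]. intros t Ht.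
  apply Rle_trans with (1 := re_le_Cmod _), Hb, Ht. }
assert (Rabs (RInt (fun t => Im (g t)) 0 (2 * PI)) <= 2 * PI * M)%R.
{ apply RInt_bound; [intros; apply continuous_Im, Hc|]. intros t Ht.
  apply Rle_trans with (1 := im_le_Cmod _), Hb, Ht. }
lra.
Qed.

Lemma circle_bounded (g : R -> C) : (forall t, continuous g t) ->
  exists M, (0 < M)%R /\ forall t, (0 <= t <= 2 * PI -> Cmod (g t) <= M)%R.
Proof.
intros Hc.
destruct (bounded_continuity (V:=R_NormedModule) (fun t => Re (g t)) 0 (2 * PI)) as [M1 H1].
{ intros t _. apply continuous_Re, Hc. }
destruct (bounded_continuity (V:=R_NormedModule) (fun t => Im (g t)) 0 (2 * PI)) as [M2 H2].
{ intros t _. apply continuous_Im, Hc. }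
assert (HP := PI_RGT_0).
exists (M1 + M2)%R. split.
- specialize (H1 0%R). specialize (H2 0%R).
  generalize (norm_ge_0 (V:=R_NormedModule) (Re (g 0%R))) (norm_ge_0 (V:=R_NormedModule) (Im (g 0%R))). 
  intros. assert (0 <= 0 <= 2 * PI)%R by lra. specialize (H1 H3). specialize (H2 H3). lra.
- intros t Ht. apply Rle_trans with (1 := Cmod_le_ReIm _).
  apply Rlt_le, Rplus_lt_compat; [apply H1, Ht|apply H2, Ht].
Qed.

Lemma pow_n_Cpow (z : C) (k : nat) : pow_n z k = z ^ k.
Proof. induction k as [|k IH]; [reflexivity|]. simpl. rewrite IH. reflexivity. Qed.

Definition psum (a : nat -> C) (z : C) (N : nat) : C :=
  sum_n (G:=C_AbelianMonoid) (fun k => z ^ k * a k) N.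

Lemma psum_0 a z : psum a z 0 = a 0%nat.
Proof. unfold psum. rewrite sum_O. simpl. ring. Qed.

Lemma psum_S a z N : psum a z (S N) = psum a z N + z ^ S N * a (S N).
Proof. unfold psum. rewrite sum_Sn. reflexivity. Qed.

Lemma is_pseries_psum (a : nat -> C) (z l : C) :
  is_pseries a z l <->
  forall eps, (0 < eps)%R -> exists N, forall n, (N <= n)%nat -> (Cmod (psum a z n - l) < eps)%R.
Proof.
assert (E : forall n, sum_n (fun k : nat => scal (pow_n z k) (a k)) n = psum a z n).
{ intros n. unfold psum. apply (sum_n_ext (G:=C_AbelianMonoid)). intros k. rewrite pow_n_Cpow. reflexivity. }
split.
- intros H eps He.
  destruct (H (fun y => (Cmod (y - l) < eps)%R)) as [N HN].
  { apply locally_Cmod. exists eps; auto. }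
  exists N. intros n Hn. rewrite <- E. apply HN, Hn.
- intros H P HP. apply locally_Cmod in HP. destruct HP as [d [Hd HP]].
  destruct (H d Hd) as [N HN]. exists N. intros n Hn. apply HP.
  change (Cmod (sum_n (fun k : nat => scal (pow_n z k) (a k)) n - l) < d)%R.
  rewrite E. apply HN, Hn.
Qed.

Lemma geom_small (M q eps : R) : (0 <= q < 1 -> 0 < M -> 0 < eps ->
  exists N, forall n, (N <= n)%nat -> M * q ^ n < eps)%R.
Proof.
intros Hq HM He.
destruct (pow_lt_1_zero q ltac:(rewrite Rabs_pos_eq; lra) (eps / M)) as [N HN].
{ apply Rdiv_lt_0_compat; assumption. }
exists N. intros n Hn. specialize (HN n Hn).
rewrite Rabs_pos_eq in HN by (apply pow_le; lra).
apply Rlt_div_r in HN; [lra|exact HM].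
Qed.

Lemma is_pseries_geom_intro (a : nat -> C) (z l : C) (M q : R) :
  (0 <= q < 1)%R -> (0 < M)%R -> (forall N, Cmod (psum a z N - l) <= M * q ^ N)%R -> is_pseries a z l.
Proof.
intros Hq HM H. apply is_pseries_psum. intros eps He.
destruct (geom_small M q eps Hq HM He) as [N HN].
exists N. intros n Hn. apply Rle_lt_trans with (1 := H n), HN, Hn.
Qed.

Lemma is_pseries_C_unique (a : nat -> C) (z l l' : C) :
  is_pseries a z l -> is_pseries a z l' -> l = l'.
Proof. apply (filterlim_locally_unique (V:=C_NormedModule)). Qed.

Section Circle.
Variables (r : R) (z : C).
Hypothesis Hr : (0 < r < 1)%R.
Hypothesis Hz : (Cmod z < r)%R.

Let zeta (t : R) : C := RtoC r * cis t.
Let K (t : R) : C := zeta t / (zeta t - z).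

Lemma circle_neq_0 (t : R) : RtoC r * cis t <> 0.
Proof. apply Cmod_gt_0. rewrite Cmod_circle; lra. Qed.

Lemma continuous_inv_circle (t : R) : continuous (fun t => / zeta t) t.
Proof. apply continuous_Cinv; [apply continuous_circle|apply circle_neq_0]. Qed.

Lemma kernel_bound (t : R) : (Cmod (K t) <= r / (r - Cmod z))%R.
Proof.
unfold K. rewrite Cmod_div by (apply (circle_minus_neq_0 r z Hr Hz)).
unfold zeta. rewrite Cmod_circle by exact Hr.
apply Rmult_le_compat_l; [lra|]. apply Rinv_le_contravar; [lra|].
replace r with (Cmod (RtoC r * cis t)) at 1 by (apply Cmod_circle, Hr).
replace (RtoC r * cis t) with ((RtoC r * cis t - z) + z) at 1 by ring.
generalize (Cmod_triangle (RtoC r * cis t - z) z). lra.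
Qed.

(** Iteration of K = 1 + (z / zeta) K, which is the geometric series of the kernel with its exact
    remainder; no interchange of limit and integral is involved. *)
Lemma kernel_remainder (g : R -> C) (N : nat) : (forall t, continuous g t) ->
  CInt (fun t => g t * K t) - psum (fun k => CInt (fun t => g t * (/ zeta t) ^ k)) z N =
  CInt (fun t => g t * (z * / zeta t) ^ S N * K t).
Proof.
intros Hg.
assert (HK := continuous_kernel r z Hr Hz). fold zeta in HK. fold K in HK.
assert (Hi := continuous_inv_circle).
assert (Hk : forall k t, continuous (fun t => g t * (/ zeta t) ^ k) t).
{ intros; apply continuous_Cmult; [apply Hg|apply continuous_Cpow, Hi]. }
assert (Hrem : forall k t, continuous (fun t => g t * (z * / zeta t) ^ k * K t) t).
{ intros; apply continuous_Cmult; [apply continuous_Cmult|apply HK]; [apply Hg|apply continuous_Cpow].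
  apply continuous_Cmult; [apply continuous_const|apply Hi]. }
assert (Hstep : forall k, CInt (fun t => g t * (z * / zeta t) ^ k * K t) =
  z ^ k * CInt (fun t => g t * (/ zeta t) ^ k) + CInt (fun t => g t * (z * / zeta t) ^ S k * K t)).
{ intros k. rewrite <- CInt_scal by apply Hk. rewrite <- CInt_plus.
  - apply CInt_ext. intros t. rewrite Cpow_S, !Cpow_mult_l. unfold K.
    field. split; [apply (circle_minus_neq_0 r z Hr Hz)|apply circle_neq_0].
  - intros t. apply continuous_Cmult; [apply continuous_const|apply Hk].
  - intros t. apply Hrem. }
induction N as [|N IH].
- rewrite psum_0. 
  rewrite <- (CInt_ext (fun t => g t * (z * / zeta t) ^ 0 * K t)) by (intros; simpl; ring).
  rewrite Hstep. simpl Cpow. ring.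
- rewrite psum_S. rewrite Hstep in IH.
  match goal with |- ?a - (?b + ?c) = _ => replace (a - (b + c)) with ((a - b) - c) by ring end.
  rewrite IH. ring.
Qed.

(** The remainder is of order (|z| / r)^(N + 1). Continuity of [g] is enough, so the lemma serves
    both for g = 1, which gives the integral of the kernel, and for the values of a differentiable
    function. *)
Lemma circle_pseries (g : R -> C) : (forall t, continuous g t) ->
  is_pseries (fun k => CInt (fun t => g t * (/ zeta t) ^ k)) z (CInt (fun t => g t * K t)).
Proof.
intros Hg.
destruct (circle_bounded g Hg) as [M [HM HgM]].
assert (HP := PI_RGT_0). assert (H0 := Cmod_ge_0 z).
assert (Hkb : (0 < r / (r - Cmod z))%R) by (apply Rdiv_lt_0_compat; lra).
assert (Hq : (0 <= Cmod z / r < 1)%R).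
{ split; [apply Rdiv_le_0_compat; lra|]. apply Rlt_div_l; lra. }
apply (is_pseries_geom_intro _ _ _ (4 * PI * (M * (r / (r - Cmod z)))) (Cmod z / r) Hq).
{ apply Rmult_lt_0_compat; [lra|apply Rmult_lt_0_compat; assumption]. }
intros N.
replace (psum (fun k => CInt (fun t => g t * (/ zeta t) ^ k)) z N - CInt (fun t => g t * K t))
 with (- (CInt (fun t => g t * K t) - psum (fun k => CInt (fun t => g t * (/ zeta t) ^ k)) z N)) by ring.
rewrite Cmod_opp, kernel_remainder by exact Hg.
rewrite Rmult_assoc.
apply CInt_bound.
- intros t. apply continuous_Cmult; [|apply (continuous_kernel r z Hr Hz)].
  apply continuous_Cmult; [apply Hg|]. apply continuous_Cpow, continuous_Cmult; [apply continuous_const|].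
  apply continuous_inv_circle.
- intros t Ht. rewrite !Cmod_mult, Cmod_pow, Cmod_mult, Cmod_inv by apply circle_neq_0.
  unfold zeta. rewrite (Cmod_circle r Hr t).
  replace (M * (r / (r - Cmod z)) * (Cmod z / r) ^ N)%R with (M * (Cmod z / r) ^ N * (r / (r - Cmod z)))%R by ring.
  assert (Hp : (0 <= (Cmod z * / r) ^ S N <= (Cmod z / r) ^ N)%R).
  { fold (Cmod z / r)%R. split; [apply pow_le; lra|]. simpl. 
    rewrite <- (Rmult_1_l ((Cmod z / r) ^ N)) at 2. apply Rmult_le_compat_r; [apply pow_le|]; lra. }
  apply Rmult_le_compat; [|apply Cmod_ge_0| |apply kernel_bound].
  + apply Rmult_le_pos; [apply Cmod_ge_0|apply Hp].
  + apply Rmult_le_compat; [apply Cmod_ge_0|apply Hp|apply HgM, Ht|apply Hp].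
Qed.

Lemma CInt_circle_pow (k : nat) : CInt (fun t => 1 * (/ zeta t) ^ S k) = 0.
Proof.
assert (HS : RtoC (INR (S k)) <> 0).
{ intros E. apply RtoC_inj in E. apply (not_0_INR (S k)); [lia|exact E]. }
apply (CInt_closed (fun t => / (- Ci * INR (S k)) * (/ zeta t) ^ S k)).
- intros t.
  replace (1 * (/ zeta t) ^ S k) with
   (/ (- Ci * INR (S k)) * (INR (S k) * (/ zeta t) ^ k * (- RtoC r / (zeta t * zeta t))) * (Ci * cis t)).
  + apply (rder_comp (fun u => / (- Ci * INR (S k)) * (/ (RtoC r * u)) ^ S k) cis); [|apply rder_cis].
    apply cder_scal. apply (cder_comp (fun u => u ^ S k) (fun u => / (RtoC r * u))).
    * apply cder_pow.
    * apply cder_inv; [|apply circle_neq_0].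
      replace (RtoC r) with (RtoC r * 1) at 2 by ring. apply cder_scal, cder_id.
  + rewrite Cpow_S. unfold zeta. field.
    assert (H := circle_neq_0 t).
    repeat split; try exact HS; try (intros E; apply H; rewrite E; ring).
    intros E; apply Ci_nz. replace Ci with (- - Ci) by ring. rewrite E. ring.
- intros t. apply continuous_Cmult; [apply continuous_const|]. apply continuous_Cpow, continuous_inv_circle.
- unfold zeta. rewrite cis_2PI. reflexivity.
Qed.

(** The winding number, read off from the expansion with g = 1: all coefficients of positive index
    are integrals of derivatives of closed curves and vanish. *)
Lemma CInt_kernel : CInt K = RtoC (2 * PI).
Proof.
apply (is_pseries_C_unique (fun k => CInt (fun t => 1 * (/ zeta t) ^ k)) z).
- rewrite <- (CInt_ext (fun t => 1 * K t)) by (intros; ring).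
  apply circle_pseries. intros; apply continuous_const.
- apply is_pseries_psum. intros eps He. exists 0%nat. intros n _.
  replace (psum _ z n) with (RtoC (2 * PI)); [rewrite Cminus_self, Cmod_0; exact He|].
  induction n as [|n IH].
  + rewrite psum_0. rewrite <- (CInt_ext (fun t => 1)) by (intros; simpl; ring).
    rewrite CInt_const. ring.
  + rewrite psum_S, <- IH, CInt_circle_pow. ring.
Qed.

Lemma cauchy_formula (f f' : C -> C) : C1_on_D f f' ->
  CInt (fun t => f (zeta t) * K t) = f z * RtoC (2 * PI).
Proof.
intros Hf. rewrite <- CInt_kernel, <- CInt_scal by (apply (continuous_kernel r z Hr Hz)).
unfold CInt; f_equal.
- apply (homotopy_Re f f' r z Hf Hr Hz).
- transitivity (RInt (fun t => Re (- Ci * f (zeta t) * K t)) 0 (2 * PI)).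
  { apply RInt_ext; intros t _. rewrite Im_as_Re. f_equal; ring. }
  transitivity (RInt (fun t => Re (- Ci * f z * K t)) 0 (2 * PI)).
  2: { apply RInt_ext; intros t _. rewrite Im_as_Re. f_equal; ring. }
  apply (homotopy_Re (fun u => - Ci * f u) (fun u => - Ci * f' u) r z); try assumption.
  intros u Hu. destruct (Hf u Hu) as [H1 H2]. split.
  + apply cder_scal, H1.
  + apply continuous_Cmult; [apply continuous_const|exact H2].
Qed.

Lemma circle_inD (t : R) : inD (zeta t).
Proof. unfold inD, zeta. rewrite Cmod_circle; lra. Qed.

Lemma continuous_on_circle (f f' : C -> C) : C1_on_D f f' -> forall t, continuous (fun t => f (zeta t)) t.
Proof.
intros Hf t. apply (continuous_comp zeta f); [apply continuous_circle|].
apply (cder_continuous f _ (f' (zeta t))), Hf, circle_inD.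
Qed.

(** The coefficients depend on [r] but not on [z], so this is one power series for the whole disk of
    radius [r]. *)
Lemma cauchy_pseries (f f' : C -> C) : C1_on_D f f' ->
  is_pseries (fun k => CInt (fun t => / RtoC (2 * PI) * f (zeta t) * (/ zeta t) ^ k)) z (f z).
Proof.
intros Hf. assert (Hc := continuous_on_circle f f' Hf).
assert (HP := PI_RGT_0).
assert (H2 : RtoC (2 * PI) <> 0) by (intros E; apply RtoC_inj in E; lra).
replace (f z) with (CInt (fun t => / RtoC (2 * PI) * f (zeta t) * K t)).
- apply circle_pseries. intros t. apply continuous_Cmult; [apply continuous_const|apply Hc].
- rewrite (CInt_ext _ (fun t => / RtoC (2 * PI) * (f (zeta t) * K t))) by (intros; ring).
  rewrite CInt_scal, (cauchy_formula f f' Hf).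
  + field. exact H2.
  + intros t. apply continuous_Cmult; [apply Hc|apply (continuous_kernel r z Hr Hz)].
Qed.

Lemma cauchy_estimate (f f' : C -> C) (M : R) : C1_on_D f f' ->
  (forall t, Cmod (f (zeta t)) <= M)%R -> (Cmod (f z) <= 2 * (r / (r - Cmod z)) * M)%R.
Proof.
intros Hf HM. assert (Hc := continuous_on_circle f f' Hf).
assert (HP := PI_RGT_0). assert (H0 := Cmod_ge_0 z).
assert (Hb : (Cmod (f z * RtoC (2 * PI)) <= 4 * PI * (M * (r / (r - Cmod z))))%R).
{ rewrite <- (cauchy_formula f f' Hf). apply CInt_bound.
  - intros t. apply continuous_Cmult; [apply Hc|apply (continuous_kernel r z Hr Hz)].
  - intros t _. rewrite Cmod_mult. apply Rmult_le_compat; try apply Cmod_ge_0; [apply HM|apply kernel_bound]. }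
rewrite Cmod_mult, Cmod_R, Rabs_pos_eq in Hb by lra. nra.
Qed.

End Circle.

(** * Power series *)

Definition is_pseries_on (rho : R) (a : nat -> C) (f : C -> C) : Prop :=
  forall z, (Cmod z < rho)%R -> is_pseries a z (f z).

Lemma pow_eventually_ge (x B : R) : (1 < x)%R -> exists N, (B < x ^ N)%R.
Proof.
intros Hx. destruct (Pow_x_infinity x ltac:(rewrite Rabs_pos_eq; lra) (B + 1)) as [N HN].
exists N. specialize (HN N (le_n _)). rewrite Rabs_pos_eq in HN by (apply pow_le; lra). lra.
Qed.

Lemma pseries_coef_bound (a : nat -> C) (z l : C) : is_pseries a z l ->
  exists M, (0 < M)%R /\ forall n, (Cmod (a n) * Cmod z ^ n <= M)%R.
Proof.
intros H. destruct (proj1 (is_pseries_psum a z l) H 1%R Rlt_0_1) as [N HN].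
assert (Hb : exists B, (0 < B)%R /\ forall n, (n <= N)%nat -> (Cmod (a n) * Cmod z ^ n <= B)%R).
{ clear HN. induction N as [|N [B [HB IH]]].
  - exists (Cmod (a 0%nat) + 1)%R. split; [generalize (Cmod_ge_0 (a 0%nat)); lra|].
    intros n Hn. replace n with 0%nat by lia. simpl. lra.
  - exists (B + Cmod (a (S N)) * Cmod z ^ S N)%R.
    assert (0 <= Cmod (a (S N)) * Cmod z ^ S N)%R by (apply Rmult_le_pos; [|apply pow_le]; apply Cmod_ge_0).
    split; [lra|]. intros n Hn. destruct (Nat.eq_dec n (S N)) as [->|Hne]; [lra|].
    specialize (IH n ltac:(lia)). lra. }
destruct Hb as [B [HB Hb]].
exists (B + 2)%R. split; [lra|]. intros n.
destruct (Nat.le_gt_cases n N) as [Hn|Hn]; [specialize (Hb n Hn); lra|].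
destruct n as [|n]; [lia|].
assert (H1 := HN n ltac:(lia)). assert (H2 := HN (S n) ltac:(lia)). rewrite psum_S in H2.
replace (Cmod (a (S n)) * Cmod z ^ S n)%R with (Cmod (z ^ S n * a (S n))) by (rewrite Cmod_mult, Cmod_pow; ring).
replace (z ^ S n * a (S n)) with ((psum a z n + z ^ S n * a (S n) - l) + - (psum a z n - l)) by ring.
apply Rle_trans with (1 := Cmod_triangle _ _). rewrite Cmod_opp. lra.
Qed.

Lemma pseries_coef_geom (rho R1 : R) (a : nat -> C) (f : C -> C) :
  is_pseries_on rho a f -> (0 < R1 < rho)%R ->
  exists M q, (0 < M)%R /\ (0 <= q < 1)%R /\ forall n, (Cmod (a n) * R1 ^ n <= M * q ^ n)%R.
Proof.
intros H HR.
(* At an intermediate radius the terms of the convergent series are bounded; passing down to [R1]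
   gains the ratio R1 / r2 < 1. *)
set (r2 := ((R1 + rho) / 2)%R).
assert (Hr2 : (R1 < r2 < rho)%R) by (unfold r2; lra).
destruct (pseries_coef_bound a (RtoC r2) (f (RtoC r2))) as [M [HM Hb]].
{ apply H. rewrite Cmod_R, Rabs_pos_eq; lra. }
rewrite Cmod_R, Rabs_pos_eq in Hb by lra.
exists M, (R1 / r2)%R. split; [exact HM|split].
- split; [apply Rdiv_le_0_compat; lra|apply Rlt_div_l; lra].
- intros n. replace (R1 ^ n)%R with (r2 ^ n * (R1 / r2) ^ n)%R.
  + rewrite <- Rmult_assoc. apply Rmult_le_compat_r; [|apply Hb]. apply pow_le, Rdiv_le_0_compat; lra.
  + rewrite <- Rpow_mult_distr. f_equal. field. lra.
Qed.

Lemma sum_geom_bound (q : R) (N : nat) : (0 <= q < 1)%R -> (sum_f_R0 (fun k => q ^ k) N <= / (1 - q))%R.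
Proof.
intros Hq. rewrite tech3 by lra. unfold Rdiv. rewrite <- (Rmult_1_l (/ (1 - q))) at 2.
apply Rmult_le_compat_r; [apply Rlt_le, Rinv_0_lt_compat; lra|].
generalize (pow_le q (S N) (proj1 Hq)). lra.
Qed.

Definition csum (u : nat -> C) (N : nat) : C := sum_n (G:=C_AbelianMonoid) u N.

Lemma csum_0 u : csum u 0 = u 0%nat.
Proof. apply (sum_O (G:=C_AbelianMonoid)). Qed.

Lemma csum_S u N : csum u (S N) = csum u N + u (S N).
Proof. apply (sum_Sn (G:=C_AbelianMonoid)). Qed.

Lemma csum_geom_bound (u : nat -> C) (B q : R) (N : nat) : (0 <= q < 1)%R -> (0 <= B)%R ->
  (forall k, Cmod (u k) <= B * q ^ k)%R -> (Cmod (csum u N) <= B * / (1 - q))%R.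
Proof.
intros Hq HB H. apply Rle_trans with (B * sum_f_R0 (fun k => q ^ k) N)%R.
- induction N as [|N IH].
  + rewrite csum_0. apply H.
  + rewrite csum_S. simpl sum_f_R0. rewrite Rmult_plus_distr_l.
    apply Rle_trans with (1 := Cmod_triangle _ _). apply Rplus_le_compat; [exact IH|apply H].
- apply Rmult_le_compat_l; [exact HB|apply sum_geom_bound, Hq].
Qed.

Lemma ex_pseries_geom (a : nat -> C) (z : C) (B q : R) : (0 <= q < 1)%R ->
  (forall k, Cmod (z ^ k * a k) <= B * q ^ k)%R -> exists l, is_pseries a z l.
Proof.
intros Hq H. 
assert (He : ex_series (V:=C_CompleteNormedModule) (fun k => scal (pow_n z k) (a k))).
{ apply (ex_series_le (V:=C_CompleteNormedModule) _ (fun k => B * q ^ k)%R).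
  - intros k. rewrite pow_n_Cpow. apply (H k).
  - exists (B * / (1 - q))%R. apply (is_series_scal (V:=R_NormedModule) B), is_series_geom.
    rewrite Rabs_pos_eq; lra. }
destruct He as [l Hl]. exists l. exact Hl.
Qed.

(** * Termwise differentiation *)

Definition dcoef (a : nat -> C) (k : nat) : C := RtoC (INR (S k)) * a (S k).

Section PowerDifference.
Variables (z y : C) (sg : R).
Hypothesis Hsg : (0 < sg)%R.
Hypothesis Hy : (Cmod (y - z) <= sg)%R.

Let Q : R := (Cmod z + sg)%R.

Lemma Cmod_y_le : (Cmod y <= Cmod z + sg)%R.
Proof. replace y with ((y - z) + z) by ring. generalize (Cmod_triangle (y - z) z). lra. Qed.

(** The induction closes because |z| + sg = Q. In this form each order of smallness costs a factor
    |y - z| / sg instead of a polynomial factor in k, so the bound can be summed against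
    geometrically decaying coefficients; [pow_diff2_bound] is the second-order version. *)
Lemma pow_diff_bound (k : nat) : (Cmod (y ^ k - z ^ k) <= Cmod (y - z) / sg * Q ^ k)%R.
Proof.
assert (Hz := Cmod_ge_0 z). assert (Hh := Cmod_ge_0 (y - z)).
assert (Hhs : (0 <= Cmod (y - z) / sg)%R) by (apply Rdiv_le_0_compat; lra).
induction k as [|k IH].
- simpl. rewrite Cminus_self, Cmod_0. lra.
- replace (y ^ S k - z ^ S k) with (z * (y ^ k - z ^ k) + (y - z) * y ^ k) by (rewrite !Cpow_S; ring).
  apply Rle_trans with (1 := Cmod_triangle _ _). rewrite !Cmod_mult, Cmod_pow.
  apply Rle_trans with (Cmod z * (Cmod (y - z) / sg * Q ^ k) + Cmod (y - z) * Q ^ k)%R.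
  + apply Rplus_le_compat; [apply Rmult_le_compat_l; assumption|].
    apply Rmult_le_compat_l; [exact Hh|]. apply pow_incr. split; [apply Cmod_ge_0|apply Cmod_y_le].
  + right. unfold Q. simpl. field. lra.
Qed.

Lemma pow_diff2_bound (k : nat) :
  (Cmod (y ^ S k - z ^ S k - RtoC (INR (S k)) * z ^ k * (y - z)) <= (Cmod (y - z) / sg) ^ 2 * Q ^ S k)%R.
Proof.
assert (Hz := Cmod_ge_0 z). assert (Hh := Cmod_ge_0 (y - z)).
assert (Hhs : (0 <= Cmod (y - z) / sg)%R) by (apply Rdiv_le_0_compat; lra).
induction k as [|k IH].
- replace (y ^ 1 - z ^ 1 - RtoC (INR 1) * z ^ 0 * (y - z)) with (RtoC 0) by (simpl; ring).
  rewrite Cmod_0. apply Rmult_le_pos; [apply pow_le, Hhs|]. apply pow_le. unfold Q; lra.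
- replace (y ^ S (S k) - z ^ S (S k) - RtoC (INR (S (S k))) * z ^ S k * (y - z))
  with (z * (y ^ S k - z ^ S k - RtoC (INR (S k)) * z ^ k * (y - z)) + (y - z) * (y ^ S k - z ^ S k)).
  2: { rewrite (S_INR (S k)), RtoC_plus, !Cpow_S. ring. }
  apply Rle_trans with (1 := Cmod_triangle _ _). rewrite !Cmod_mult.
  apply Rle_trans with (Cmod z * ((Cmod (y - z) / sg) ^ 2 * Q ^ S k) + Cmod (y - z) * (Cmod (y - z) / sg * Q ^ S k))%R.
  + apply Rplus_le_compat; apply Rmult_le_compat_l; try assumption. apply pow_diff_bound.
  + right. rewrite <- (tech_pow_Rmult Q (S k)). unfold Q at 3. field. lra.
Qed.

End PowerDifference.

Lemma INR_pow_bound (x sg : R) (k : nat) : (0 <= x)%R -> (0 < sg)%R -> (INR (S k) * x ^ k * sg <= (x + sg) ^ S k)%R.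
Proof.
intros Hx Hs. induction k as [|k IH].
- simpl. lra.
- rewrite S_INR. simpl pow at 1.
  assert (H : (x ^ S k <= (x + sg) ^ S k)%R) by (apply pow_incr; lra).
  rewrite <- (tech_pow_Rmult (x + sg) (S k)). simpl pow in H at 1. nra.
Qed.

Lemma psum_diff (a : nat -> C) (y z : C) (N : nat) :
  psum a y (S N) - psum a z (S N) - psum (dcoef a) z N * (y - z) =
  csum (fun k => a (S k) * (y ^ S k - z ^ S k - RtoC (INR (S k)) * z ^ k * (y - z))) N.
Proof.
induction N as [|N IH].
- rewrite !psum_S, !psum_0, csum_0. unfold dcoef. simpl. ring.
- rewrite csum_S, <- IH. rewrite (psum_S a y (S N)), (psum_S a z (S N)), (psum_S (dcoef a) z N).
  unfold dcoef. ring.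
Qed.

Lemma cder_of_quadratic (f : C -> C) (z d : C) (C0 dl : R) : (0 < dl)%R ->
  (forall y, (Cmod (y - z) < dl)%R -> (Cmod (f y - f z - d * (y - z)) <= C0 * Cmod (y - z) ^ 2)%R) ->
  cder f z d.
Proof.
intros Hdl H.
exists (fun y => if Ceq_dec y z then d else (f y - f z) / (y - z)).
split; [|split].
- apply continuous_Cmod_iff. intros eps He.
  apply locally_Cmod. exists (Rmin dl (eps / (Rabs C0 + 1)))%R.
  assert (HC := Rabs_pos C0).
  split; [apply Rmin_pos; [exact Hdl|apply Rdiv_lt_0_compat; lra]|].
  intros y Hy. 
  assert (Hy1 : (Cmod (y - z) < dl)%R) by (apply Rlt_le_trans with (1 := Hy), Rmin_l).
  assert (Hy2 : (Cmod (y - z) < eps / (Rabs C0 + 1))%R) by (apply Rlt_le_trans with (1 := Hy), Rmin_r).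
  destruct (Ceq_dec z z) as [_|]; [|congruence].
  destruct (Ceq_dec y z) as [->|Hyz].
  { rewrite Cminus_self, Cmod_0; exact He. }
  assert (Hyz' : y - z <> 0) by (apply Cminus_eq_contra, Hyz).
  assert (Hpos := proj1 (Cmod_gt_0 _) Hyz').
  replace ((f y - f z) / (y - z) - d) with (((f y - f z) - d * (y - z)) / (y - z)) by (field; exact Hyz').
  rewrite Cmod_div by exact Hyz'. apply Rlt_div_l; [exact Hpos|].
  apply Rle_lt_trans with (1 := H y Hy1).
  apply Rlt_div_r in Hy2; [|lra].
  assert (C0 <= Rabs C0)%R by apply Rle_abs.
  replace (C0 * Cmod (y - z) ^ 2)%R with ((C0 * Cmod (y - z)) * Cmod (y - z))%R by ring.
  apply Rmult_lt_compat_r; [exact Hpos|].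
  nra.
- destruct (Ceq_dec z z); congruence.
- intros y. destruct (Ceq_dec y z) as [->|Hyz]; [ring|].
  field. apply Cminus_eq_contra, Hyz.
Qed.

Lemma pseries_cder (rho : R) (a : nat -> C) (f : C -> C) (z : C) :
  is_pseries_on rho a f -> (Cmod z < rho)%R ->
  exists d, is_pseries (dcoef a) z d /\ cder f z d.
Proof.
intros Hf Hz. assert (Hz0 := Cmod_ge_0 z).
(* Half of the gap to [rho]: points within [sg] of [z] have modulus at most |z| + sg < rho, a radius
   at which the coefficients still decay geometrically. *)
set (sg := ((rho - Cmod z) / 2)%R).
assert (Hsg : (0 < sg)%R) by (unfold sg; lra).
assert (HR : (0 < Cmod z + sg < rho)%R) by (unfold sg; lra).
destruct (pseries_coef_geom rho _ a f Hf HR) as [M [q [HM [Hq Hc]]]].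
destruct (ex_pseries_geom (dcoef a) z (M / sg) q Hq) as [d Hd].
{ intros k. unfold dcoef. rewrite !Cmod_mult, Cmod_pow, Cmod_R, Rabs_pos_eq by apply pos_INR.
  specialize (Hc (S k)). generalize (INR_pow_bound (Cmod z) sg k Hz0 Hsg). intros Hi.
  assert (Ha := Cmod_ge_0 (a (S k))).
  assert (Hqk : (q ^ S k <= q ^ k)%R).
  { simpl. rewrite <- (Rmult_1_l (q ^ k)) at 2. apply Rmult_le_compat_r; [apply pow_le|]; lra. }
  replace (Cmod z ^ k * (INR (S k) * Cmod (a (S k))))%R with
    (Cmod (a (S k)) * (INR (S k) * Cmod z ^ k * sg) / sg)%R by (field; lra).
  replace (M / sg * q ^ k)%R with (M * q ^ k / sg)%R by (field; lra).
  apply Rmult_le_compat_r; [apply Rlt_le, Rinv_0_lt_compat; lra|].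
  apply Rle_trans with (Cmod (a (S k)) * (Cmod z + sg) ^ S k)%R; [apply Rmult_le_compat_l; assumption|].
  apply Rle_trans with (1 := Hc). apply Rmult_le_compat_l; lra. }
exists d; split; [exact Hd|].
apply (cder_of_quadratic f z d (M * / (1 - q) / sg ^ 2) sg Hsg).
intros y Hy.
assert (Hyr : (Cmod y < rho)%R).
{ apply Rle_lt_trans with (1 := Cmod_y_le z y sg (Rlt_le _ _ Hy)). lra. }
(* The quadratic bound [B] holds for all partial sums. If the limits exceeded it by [eps], three
   approximations, each contributing at most eps / 4, would give a contradiction. *)
apply Rnot_lt_le. intros Hlt.
set (B := (M * / (1 - q) / sg ^ 2 * Cmod (y - z) ^ 2)%R) in *.
set (eps := (Cmod (f y - f z - d * (y - z)) - B)%R) in *.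
assert (He : (0 < eps / 4)%R) by (unfold eps; lra).
assert (He2 : (0 < eps / 4 / (sg + 1))%R) by (apply Rdiv_lt_0_compat; lra).
destruct (proj1 (is_pseries_psum _ _ _) (Hf y Hyr) _ He) as [N1 H1].
destruct (proj1 (is_pseries_psum _ _ _) (Hf z Hz) _ He) as [N2 H2].
destruct (proj1 (is_pseries_psum _ _ _) Hd _ He2) as [N3 H3].
set (N := (N1 + N2 + N3)%nat).
specialize (H1 (S N) ltac:(lia)). specialize (H2 (S N) ltac:(lia)). specialize (H3 N ltac:(lia)).
assert (HB : (Cmod (psum a y (S N) - psum a z (S N) - psum (dcoef a) z N * (y - z)) <= B)%R).
{ rewrite psum_diff. unfold B.
  replace (M * / (1 - q) / sg ^ 2 * Cmod (y - z) ^ 2)%R with ((Cmod (y - z) / sg) ^ 2 * M * / (1 - q))%R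
    by (field; lra).
  apply csum_geom_bound; [exact Hq| |].
  { apply Rmult_le_pos; [apply pow2_ge_0|lra]. }
  intros k. rewrite Cmod_mult. 
  apply Rle_trans with (Cmod (a (S k)) * ((Cmod (y - z) / sg) ^ 2 * (Cmod z + sg) ^ S k))%R.
  { apply Rmult_le_compat_l; [apply Cmod_ge_0|]. apply pow_diff2_bound; lra. }
  replace (Cmod (a (S k)) * ((Cmod (y - z) / sg) ^ 2 * (Cmod z + sg) ^ S k))%R
    with ((Cmod (y - z) / sg) ^ 2 * (Cmod (a (S k)) * (Cmod z + sg) ^ S k))%R by ring.
  rewrite Rmult_assoc. apply Rmult_le_compat_l; [apply pow2_ge_0|].
  apply Rle_trans with (1 := Hc (S k)). apply Rmult_le_compat_l; [lra|].
  simpl. rewrite <- (Rmult_1_l (q ^ k)) at 2. apply Rmult_le_compat_r; [apply pow_le|]; lra. }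
assert (HT : (Cmod (f y - f z - d * (y - z)) <=
  B + Cmod (psum a y (S N) - f y) + Cmod (psum a z (S N) - f z) + Cmod (psum (dcoef a) z N - d) * Cmod (y - z))%R).
{ replace (f y - f z - d * (y - z)) with
   ((psum a y (S N) - psum a z (S N) - psum (dcoef a) z N * (y - z)) + - (psum a y (S N) - f y) +
    (psum a z (S N) - f z) + (psum (dcoef a) z N - d) * (y - z)) by ring.
  rewrite <- Cmod_mult.
  apply Rle_trans with (1 := Cmod_triangle _ _). apply Rplus_le_compat_r.
  apply Rle_trans with (1 := Cmod_triangle _ _). apply Rplus_le_compat_r.
  apply Rle_trans with (1 := Cmod_triangle _ _). rewrite Cmod_opp. lra. }
assert (H4 : (Cmod (psum (dcoef a) z N - d) * Cmod (y - z) <= eps / 4)%R).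
{ apply Rlt_div_r in H3; [|lra].
  generalize (Cmod_ge_0 (psum (dcoef a) z N - d)) (Cmod_ge_0 (y - z)). intros. nra. }
unfold eps in *. lra.
Qed.

Lemma pseries_C1 (a : nat -> C) (f : C -> C) : is_pseries_on 1 a f ->
  exists f', is_pseries_on 1 (dcoef a) f' /\ C1_on_D f f'.
Proof.
intros Hf.
assert (Hd : is_pseries_on 1 (dcoef a) (C_derive f)).
{ intros z Hz. destruct (pseries_cder 1 a f z Hf Hz) as [d [H1 H2]].
  apply cder_is_derive in H2. rewrite (is_C_derive_unique _ _ _ H2). exact H1. }
exists (C_derive f); split; [exact Hd|].
intros z Hz. destruct (pseries_cder 1 a f z Hf Hz) as [d [H1 H2]]. split.
- rewrite (is_C_derive_unique f z d); [exact H2|]. apply cder_is_derive, H2.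
- destruct (pseries_cder 1 _ _ z Hd Hz) as [e [_ He]]. apply (cder_continuous _ _ _ He).
Qed.

(** * Coefficients and order of vanishing at 0 *)

Lemma pseries_at_0 (a : nat -> C) (l : C) : is_pseries a (RtoC 0) l -> l = a 0%nat.
Proof.
intros H. apply (is_pseries_C_unique a 0); [exact H|].
apply (is_pseries_0 (K:=C_AbsRing) (V:=C_NormedModule) a).
Qed.

Lemma pseries_shift (rho : R) (a : nat -> C) (f : C -> C) : is_pseries_on rho a f -> a 0%nat = 0 ->
  exists h, is_pseries_on rho (fun k => a (S k)) h /\ forall z, (Cmod z < rho)%R -> f z = z * h z.
Proof.
intros Hf H0.
(* The value [a 1] fills the removable singularity of f(z) / z. *)
exists (fun z => if Ceq_dec z 0 then a 1%nat else f z / z). split.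
- intros z Hz. destruct (Ceq_dec z 0) as [->|Hne].
  + apply (is_pseries_0 (K:=C_AbsRing) (V:=C_NormedModule) (fun k => a (S k))).
  + replace (f z / z) with (/ z * (f z + - a 0%nat)) by (rewrite H0; unfold Cdiv; ring).
    apply (is_pseries_decr_1 (K:=C_AbsRing) (V:=C_NormedModule) a z (/ z) (f z)); [apply Cinv_l, Hne|apply Hf, Hz].
- intros z Hz. destruct (Ceq_dec z 0) as [->|Hne].
  + rewrite (pseries_at_0 _ _ (Hf 0 Hz)), H0. ring.
  + field. exact Hne.
Qed.

Lemma pseries_factor (n : nat) : forall (rho : R) (a : nat -> C) (f : C -> C), is_pseries_on rho a f ->
  (forall k, (k < n)%nat -> a k = 0) ->
  exists h, is_pseries_on rho (fun k => a (n + k)%nat) h /\ forall z, (Cmod z < rho)%R -> f z = z ^ n * h z.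
Proof.
induction n as [|n IH]; intros rho a f Hf Ha.
- exists f; split; [exact Hf|]. intros; simpl; ring.
- destruct (pseries_shift rho a f Hf (Ha 0%nat ltac:(lia))) as [h [Hh E]].
  destruct (IH rho _ h Hh) as [h2 [Hh2 E2]].
  { intros k Hk. apply Ha. lia. }
  exists h2; split; [exact Hh2|].
  intros z Hz. rewrite E, E2, Cpow_S by exact Hz. ring.
Qed.

(** Letting z tend to 0 gives [a 0 = 0]; then f(z) / z satisfies the same hypothesis with n - 1. The
    growth bound is asked only for z <> 0, as the equation for z f'/f gives no information at 0. *)
Lemma pseries_order (n : nat) : forall (rho : R) (a : nat -> C) (f : C -> C) (C0 dl : R), (0 < rho)%R -> (0 < dl)%R ->
  is_pseries_on rho a f ->
  (forall z : C, z <> 0 -> (Cmod z < dl)%R -> (Cmod (f z) <= C0 * Cmod z ^ n)%R) ->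
  forall k, (k < n)%nat -> a k = 0.
Proof.
induction n as [|n IH]; intros rho a f C0 dl Hrho Hdl Hf HO k Hk; [lia|].
assert (H00 : (Cmod 0 < rho)%R) by (rewrite Cmod_0; exact Hrho).
assert (Ha0 : a 0%nat = 0).
{ rewrite <- (pseries_at_0 _ _ (Hf 0 H00)).
  destruct (pseries_cder rho a f 0 Hf H00) as [d [_ Hd]].
  destruct (cder_bound f 0 d Hd) as [M [d2 [Hd2 [HM Hb]]]].
  apply Cmod_eq_0. apply Rle_antisym; [|apply Cmod_ge_0].
  apply Rnot_lt_le. intros Hpos.
  (* A real test point inside both neighbourhoods, so small that (M + |C0|) t < |f(0)| / 2, whereas
     the growth bound and the Lipschitz bound at 0 together give |f(0)| <= (M + |C0|) t. *)
  set (t := Rmin (Rmin (dl / 2) (d2 / 2)) (Rmin (1/2) (Cmod (f 0) / (2 * (M + Rabs C0 + 1))))).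
  assert (HC := Rabs_pos C0).
  assert (Ht : (0 < t)%R).
  { unfold t. repeat apply Rmin_pos; try lra. apply Rdiv_lt_0_compat; lra. }
  assert (Ht1 : (t <= dl / 2)%R) by (unfold t; eapply Rle_trans; [apply Rmin_l|apply Rmin_l]).
  assert (Ht2 : (t <= d2 / 2)%R) by (unfold t; eapply Rle_trans; [apply Rmin_l|apply Rmin_r]).
  assert (Ht3 : (t <= 1 / 2)%R) by (unfold t; eapply Rle_trans; [apply Rmin_r|apply Rmin_l]).
  assert (Ht4 : (t <= Cmod (f 0) / (2 * (M + Rabs C0 + 1)))%R) by (unfold t; eapply Rle_trans; [apply Rmin_r|apply Rmin_r]).
  assert (Htn : Cmod (RtoC t) = t) by (rewrite Cmod_R, Rabs_pos_eq; lra).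
  assert (B1 := HO (RtoC t)). rewrite Htn in B1.
  specialize (B1 ltac:(intros E; apply RtoC_inj in E; lra) ltac:(lra)).
  assert (B2 := Hb (RtoC t)). replace (RtoC t - 0) with (RtoC t) in B2 by ring. rewrite Htn in B2.
  specialize (B2 ltac:(lra)).
  assert (Hp : (0 <= t ^ n <= 1)%R).
  { split; [apply pow_le; lra|]. rewrite <- (pow1 n). apply pow_incr; lra. }
  assert (B3 : (C0 * t ^ S n <= Rabs C0 * t)%R).
  { simpl. generalize (Rle_abs C0). intros. 
    apply Rle_trans with (Rabs C0 * (t * t ^ n))%R; [apply Rmult_le_compat_r; [apply Rmult_le_pos; lra|assumption]|].
    apply Rmult_le_compat_l; nra. }
  assert (B4 : (Cmod (f 0) <= Cmod (f (RtoC t)) + Cmod (f (RtoC t) - f 0))%R).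
  { replace (f 0) with (f (RtoC t) + - (f (RtoC t) - f 0)) at 1 by ring.
    apply Rle_trans with (1 := Cmod_triangle _ _). rewrite Cmod_opp; lra. }
  apply Rle_div_r in Ht4; [|lra]. nra. }
destruct k as [|k]; [exact Ha0|].
destruct (pseries_shift rho a f Hf Ha0) as [h [Hh E]].
apply (IH rho (fun k => a (S k)) h C0 (Rmin dl rho) Hrho); [apply Rmin_pos; assumption|exact Hh| |lia].
intros z Hz Hlt.
assert (Hz1 : (Cmod z < dl)%R) by (apply Rlt_le_trans with (1 := Hlt), Rmin_l).
assert (Hz2 : (Cmod z < rho)%R) by (apply Rlt_le_trans with (1 := Hlt), Rmin_r).
specialize (HO z Hz Hz1). rewrite E, Cmod_mult in HO by exact Hz2. simpl in HO.
assert (Hp := proj1 (Cmod_gt_0 _) Hz).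
apply (Rmult_le_reg_l (Cmod z)); [exact Hp|]. nra.
Qed.

Lemma pseries_unique (rho : R) (a b : nat -> C) (f : C -> C) : (0 < rho)%R ->
  is_pseries_on rho a f -> is_pseries_on rho b f -> forall k, a k = b k.
Proof.
intros Hrho Ha Hb k. apply Ceq_minus.
apply (pseries_order (S k) rho (fun k => a k - b k) (fun z => f z - f z) 0 1 Hrho Rlt_0_1); [| |lia].
- intros z Hz. apply (is_pseries_minus (K:=C_AbsRing) (V:=C_NormedModule) a b z (f z) (f z)); auto.
- intros z _ _. rewrite Cminus_self, Cmod_0. lra.
Qed.

(** Each circle of radius r < 1 yields a series valid only for |z| < r. Uniqueness on the disk of
    radius 1/2 identifies all series with r > 1/2, and for a given [z] a radius between max(|z|,
    1/2) and 1 is taken. *)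
Theorem C1_analytic (f f' : C -> C) : C1_on_D f f' -> analytic_D f.
Proof.
intros Hf.
set (A := fun r => fun k => CInt (fun t => / RtoC (2 * PI) * f (RtoC r * cis t) * (/ (RtoC r * cis t)) ^ k)).
assert (HA : forall r, (0 < r < 1)%R -> is_pseries_on r (A r) f).
{ intros r Hr z Hz. apply (cauchy_pseries r z Hr Hz f f' Hf). }
exists (A (1/2)%R). intros z Hz. unfold inD in Hz.
set (r := ((1 + Rmax (Cmod z) (1/2)) / 2)%R).
assert (Hm : (Rmax (Cmod z) (1/2) < 1)%R) by (apply Rmax_lub_lt; lra).
assert (H1 := Rmax_l (Cmod z) (1/2)). assert (H2 := Rmax_r (Cmod z) (1/2)).
assert (Hr : (0 < r < 1)%R) by (unfold r; lra).
apply (is_pseries_ext (A r)).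
- apply (pseries_unique (1/2) _ _ f ltac:(lra)); [|apply HA; lra].
  intros u Hu. apply HA; [exact Hr|]. unfold r; lra.
- apply HA; [exact Hr|]. unfold r; lra.
Qed.

Lemma maximum_principle (f f' : C -> C) (r M : R) (z : C) : C1_on_D f f' -> (0 < r < 1)%R -> (Cmod z < r)%R ->
  (0 < M)%R -> (forall u, Cmod u = r -> (Cmod (f u) <= M)%R) -> (Cmod (f z) <= M)%R.
Proof.
intros Hf Hr Hz HM Hb.
(* Applied to f^N the Cauchy bound gives |f(z)|^N <= B M^N; the constant disappears in the N-th root. *)
apply Rnot_lt_le. intros Hlt.
set (B := (2 * (r / (r - Cmod z)))%R).
assert (Hx : (1 < Cmod (f z) / M)%R) by (apply Rlt_div_r; lra).
destruct (pow_eventually_ge _ B Hx) as [N HN].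
assert (HP : (Cmod (f z ^ S N) <= B * M ^ S N)%R).
{ apply (cauchy_estimate r z Hr Hz (fun u => f u ^ S N) (fun u => RtoC (INR (S N)) * f u ^ N * f' u)).
  - intros u Hu. destruct (Hf u Hu) as [H1 H2]. split.
    + apply (cder_comp (fun u => u ^ S N)); [apply cder_pow|exact H1].
    + apply continuous_Cmult; [|exact H2]. apply continuous_Cmult; [apply continuous_const|].
      apply continuous_Cpow, (cder_continuous _ _ _ H1).
  - intros t. rewrite Cmod_pow. apply pow_incr. split; [apply Cmod_ge_0|]. apply Hb, Cmod_circle, Hr. }
rewrite Cmod_pow in HP.
assert (HMN : (0 < M ^ S N)%R) by (apply pow_lt, HM).
assert (E : ((Cmod (f z) / M) ^ S N * M ^ S N = Cmod (f z) ^ S N)%R).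
{ rewrite <- Rpow_mult_distr. f_equal. field. lra. }
assert (HS : ((Cmod (f z) / M) ^ N <= (Cmod (f z) / M) ^ S N)%R) by (apply Rle_pow; [lra|lia]).
nra.
Qed.

(** Schwarz's lemma for a zero of order n: the maximum principle for h = w / z^n on |u| = r gives
    |h(z)| r^n <= 1 for every r in (|z|, 1), and r tends to 1. *)
Lemma schwarz_order (n : nat) (a : nat -> C) (w : C -> C) : is_pseries_on 1 a w ->
  (forall k, (k < n)%nat -> a k = 0) -> (forall z, inD z -> (Cmod (w z) <= 1)%R) ->
  forall z, inD z -> (Cmod (w z) <= Cmod z ^ n)%R.
Proof.
intros Hw Ha Hb z Hz.
destruct (pseries_factor n 1 a w Hw Ha) as [h [Hh E]].
destruct (pseries_C1 _ h Hh) as [h' [_ Hh']].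
rewrite E, Cmod_mult, Cmod_pow by exact Hz.
rewrite <- (Rmult_1_r (Cmod z ^ n)) at 2.
apply Rmult_le_compat_l; [apply pow_le, Cmod_ge_0|].
assert (Hr : forall r, (Cmod z < r < 1)%R -> (Cmod (h z) * r ^ n <= 1)%R).
{ intros r Hr. assert (H0 := Cmod_ge_0 z).
  assert (Hp : (0 < r ^ n)%R) by (apply pow_lt; lra).
  apply Rle_div_r; [exact Hp|]. 
  apply (maximum_principle h h' r (1 / r ^ n) z Hh'); try lra.
  - apply Rdiv_lt_0_compat; lra.
  - intros u Hu. apply Rle_div_r; [exact Hp|].
    rewrite <- Hu, <- Cmod_pow, <- Cmod_mult, Cmult_comm, <- E by lra. apply Hb. unfold inD; lra. }
apply Rnot_lt_le. intros Hlt.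
destruct n as [|n].
{ specialize (Hr ((Cmod z + 1) / 2)%R). unfold inD in Hz. simpl in Hr. lra. }
set (N := INR (S n)). assert (HN : (1 <= N)%R) by (unfold N; rewrite S_INR; generalize (pos_INR n); lra).
unfold inD in Hz. assert (H0 := Cmod_ge_0 z).
(* The radius 1 - x turns the limit r -> 1 into one choice: by Bernoulli (1 - x)^n >= 1 - N x, and
   this [x] gives |h| (1 - N x) >= (|h| + 1) / 2 > 1. *)
set (x := Rmin ((1 - Cmod z) / 2) ((Cmod (h z) - 1) / (2 * N * Cmod (h z)))).
assert (Hx : (0 < x)%R).
{ unfold x. apply Rmin_pos; [lra|]. apply Rdiv_lt_0_compat; [lra|]. nra. }
assert (Hx1 : (x <= (1 - Cmod z) / 2)%R) by apply Rmin_l.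
assert (Hx2 : (x <= (Cmod (h z) - 1) / (2 * N * Cmod (h z)))%R) by apply Rmin_r.
apply Rle_div_r in Hx2; [|nra].
specialize (Hr (1 - x)%R ltac:(lra)).
assert (HB : forall m, (1 - INR m * x <= (1 - x) ^ m)%R).
{ induction m as [|m IH]; [simpl; lra|]. rewrite S_INR. simpl. generalize (pos_INR m). intros. nra. }
specialize (HB (S n)). fold N in HB.
assert (Cmod (h z) * (1 - N * x) <= 1)%R.
{ apply Rle_trans with (2 := Hr). apply Rmult_le_compat_l; lra. }
nra.
Qed.

(** * The map u e^u *)

Lemma exp_le (x y : R) : (x <= y)%R -> (exp x <= exp y)%R.
Proof. intros [H| ->]; [apply Rlt_le, exp_increasing, H|apply Rle_refl]. Qed.

Lemma Cexp_plus (a b : C) : Cexp (a + b) = Cexp a * Cexp b.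
Proof.
destruct a as [x y], b as [x' y']. unfold Cexp; apply injective_projections; simpl;
 rewrite exp_plus, ?cos_plus, ?sin_plus; ring.
Qed.

Lemma Cexp_0 : Cexp 0 = 1.
Proof. unfold Cexp; simpl. rewrite exp_0, cos_0, sin_0. apply injective_projections; simpl; ring. Qed.

Lemma Cexp_cis (z : C) : Cexp z = RtoC (exp (Re z)) * cis (Im z).
Proof. unfold Cexp, cis; apply injective_projections; simpl; ring. Qed.

Lemma Cmod_Cexp (z : C) : Cmod (Cexp z) = exp (Re z).
Proof. rewrite Cexp_cis, Cmod_mult, Cmod_cis, Cmod_R, Rabs_pos_eq by apply Rlt_le, exp_pos. ring. Qed.

Lemma Cexp_neq_0 (z : C) : Cexp z <> 0.
Proof. apply Cmod_gt_0. rewrite Cmod_Cexp. apply exp_pos. Qed.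

Lemma Cminus_0_r (z : C) : z - 0 = z. Proof. ring. Qed.

Lemma cder_eps (f : C -> C) (z d : C) :
  (forall eps, (0 < eps)%R ->
     locally (z : C_UniformSpace) (fun y => (Cmod (f y - f z - d * (y - z)) <= eps * Cmod (y - z))%R)) ->
  cder f z d.
Proof.
intros H. apply cder_is_derive. split; [apply is_linear_scal_l|].
intros x Hx. apply (is_filter_lim_locally_unique (K:=C_AbsRing) (V:=AbsRing_NormedModule C_AbsRing)) in Hx. subst x.
intros eps. apply (proj1 (locally_C _ _)).
generalize (H eps (cond_pos eps)). apply filter_imp. intros y Hy.
rewrite Cmult_comm in Hy. exact Hy.
Qed.

(** The first-order error is written as [al] Re z + [be] Im z, where the slopes of exp, cos and sin
    make [al] and [be] continuous with value 0 at the origin. Other points follow from the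
    functional equation in [cder_Cexp]. *)
Lemma cder_Cexp_0 : cder Cexp 0 1.
Proof.
set (s1 := slope exp 0 1). set (c1 := slope cos 0 0). set (s2 := slope sin 0 1).
assert (H1 : continuous s1 0%R) by (apply slope_continuous; auto_derive; trivial; rewrite exp_0; ring).
assert (H2 : continuous c1 0%R) by (apply slope_continuous; auto_derive; trivial; rewrite sin_0; ring).
assert (H3 : continuous s2 0%R) by (apply slope_continuous; auto_derive; trivial; rewrite cos_0; ring).
assert (Z : forall h l, slope h 0 l 0 = l).
{ intros. unfold slope. destruct (Req_EM_T 0 0); [reflexivity|congruence]. }
set (al := fun z : C => RtoC (s1 (Re z) * cos (Im z) - 1)).
set (be := fun z : C => ((c1 (Im z), (exp (Re z) * s2 (Im z) - 1)%R)) : C).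
assert (E : forall z, Cexp z - Cexp 0 - 1 * (z - 0) = al z * RtoC (Re z) + be z * RtoC (Im z)).
{ intros [x y]. rewrite Cexp_0. unfold al, be, Cexp. 
  generalize (slope_eq exp 0 1 x) (slope_eq cos 0 0 y) (slope_eq sin 0 1 y).
  fold s1 c1 s2. rewrite exp_0, cos_0, sin_0. simpl. intros E1 E2 E3.
  apply injective_projections; simpl.
  - replace (exp x) with (1 + s1 x * x)%R by lra.
    replace (cos y) with (1 + c1 y * y)%R at 1 by lra.
    replace (c1 y * y)%R with (cos y - 1)%R by lra. ring_simplify.
    replace (c1 y * y)%R with (cos y - 1)%R by lra. ring.
  - replace (sin y) with (s2 y * y)%R by lra. ring. }
assert (HRe : continuous (Re : C -> R) (RtoC 0 : C_UniformSpace)) by (apply (continuous_Re (fun y : C => y)), continuous_id).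
assert (HIm : continuous (Im : C -> R) (RtoC 0 : C_UniformSpace)) by (apply (continuous_Im (fun y : C => y)), continuous_id).
assert (Hal : continuous al (RtoC 0 : C_UniformSpace)).
{ apply continuous_RtoC. apply (continuous_minus (V:=R_NormedModule)); [|apply continuous_const].
  apply (continuous_mult (K:=R_AbsRing)).
  - apply (continuous_comp Re s1); [exact HRe|exact H1].
  - apply (continuous_comp Im cos); [exact HIm|]. apply continuity_pt_filterlim, continuity_cos. }
assert (Hbe : continuous be (RtoC 0 : C_UniformSpace)).
{ apply continuous_C_iff; split; simpl.
  - apply (continuous_comp Im c1); [exact HIm|exact H2].
  - apply (continuous_minus (V:=R_NormedModule)); [|apply continuous_const].
    apply (continuous_mult (K:=R_AbsRing)).
    + apply (continuous_comp Re exp); [exact HRe|]. apply continuity_pt_filterlim, derivable_continuous, derivable_exp.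
    + apply (continuous_comp Im s2); [exact HIm|exact H3]. }
apply cder_eps. intros eps He.
assert (He2 : (0 < eps / 2)%R) by lra.
generalize (filter_and _ _ (proj1 (continuous_Cmod_iff _ _) Hal _ He2) (proj1 (continuous_Cmod_iff _ _) Hbe _ He2)).
apply filter_imp. intros z [Ha Hb]. rewrite E.
assert (A0 : al 0 = 0).
{ unfold al, s1; simpl. rewrite Z, cos_0. f_equal. ring. }
assert (B0 : be 0 = 0).
{ unfold be, c1, s2; simpl. rewrite !Z, exp_0. apply injective_projections; simpl; ring. }
rewrite A0 in Ha. rewrite B0 in Hb.
rewrite Cminus_0_r in Ha, Hb. rewrite Cminus_0_r.
apply Rle_trans with (1 := Cmod_triangle _ _). rewrite !Cmod_mult, !Cmod_R.
generalize (re_le_Cmod z) (im_le_Cmod z) (Cmod_ge_0 (al z)) (Cmod_ge_0 (be z)) (Rabs_pos (Re z)) (Rabs_pos (Im z)) (Cmod_ge_0 z).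
intros. nra.
Qed.

Lemma cder_Cexp (z : C) : cder Cexp z (Cexp z).
Proof.
apply (cder_ext (fun y => Cexp z * Cexp (y - z))).
{ intros y. rewrite <- Cexp_plus. f_equal; ring. }
cut (cder (fun y => Cexp z * Cexp (y - z)) z (Cexp z * (1 * (1 - 0)))).
{ replace (Cexp z * (1 * (1 - 0))) with (Cexp z) by ring. trivial. }
apply cder_scal, (cder_comp Cexp (fun y => y - z)).
- rewrite Cminus_self. apply cder_Cexp_0.
- apply cder_minus; [apply cder_id|apply cder_const].
Qed.

Lemma cos_quadratic (y : R) : (1 - y ^ 2 / 2 <= cos y)%R.
Proof.
assert (H : (Rabs (sin (y / 2)) <= Rabs (y / 2))%R).
{ destruct (Rle_lt_dec 0 (y / 2)) as [Hp|Hn].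
  - destruct (Req_dec (y / 2) 0) as [->|Hne]; [rewrite sin_0, Rabs_R0; lra|].
    apply Rabs_le. rewrite (Rabs_pos_eq (y / 2)) by lra. 
    generalize (sin_lt_x (y / 2) ltac:(lra)). generalize (SIN_bound (y / 2)).
    intros. split; [|lra].
    destruct (Rle_lt_dec (y / 2) PI); [|generalize PI2_3_2; unfold PI2 in *; lra].
    generalize (sin_ge_0 (y / 2) Hp r). lra.
  - rewrite <- Rabs_Ropp, <- sin_neg. rewrite <- (Rabs_Ropp (y / 2)).
    set (x := (- (y / 2))%R). assert (0 < x)%R by (unfold x; lra).
    apply Rabs_le. rewrite (Rabs_pos_eq x) by lra.
    generalize (sin_lt_x x ltac:(lra)). generalize (SIN_bound x).
    intros. split; [|lra].
    destruct (Rle_lt_dec x PI); [|generalize PI2_3_2; unfold PI2 in *; lra].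
    generalize (sin_ge_0 x ltac:(lra) r). lra. }
replace y with (2 * (y / 2))%R at 2 by field. rewrite cos_2a_sin.
apply Rsqr_le_abs_1 in H. unfold Rsqr in H. lra.
Qed.

(** With a = x + i y, |e^a - 1|^2 = (e^x - 1)^2 + 2 e^x (1 - cos y). The two terms are at most x^2
    M^2 and y^2 M^2, the second because e^x <= M <= M^2. *)
Lemma Cexp_minus_1_bound (a : C) : (Cmod (Cexp a - 1) <= Cmod a * Rmax 1 (exp (Re a)))%R.
Proof.
set (M := Rmax 1 (exp (Re a))).
assert (HM1 : (1 <= M)%R) by apply Rmax_l. assert (HM2 : (exp (Re a) <= M)%R) by apply Rmax_r.
apply Rsqr_incr_0_var; [|apply Rmult_le_pos; [apply Cmod_ge_0|lra]].
rewrite !Rsqr_pow2, Rpow_mult_distr, !Cmod2_alt.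
destruct a as [x y]; simpl Re in *; simpl Im. unfold Cexp. simpl. fold (Re (x, y)). simpl.
assert (Hx : (Rabs (exp x - 1) <= Rabs x * M)%R).
{ destruct (Rle_lt_dec 0 x) as [Hp|Hn].
  - assert (H1 := exp_ineq1_le x). assert (H2 := exp_ineq1_le (- x)%R).
    rewrite !Rabs_pos_eq by lra.
    assert (E : (exp x * exp (- x) = 1)%R) by (rewrite <- exp_plus, Rplus_opp_r; apply exp_0).
    assert (H3 := exp_pos x). nra.
  - assert (H1 := exp_ineq1_le x). 
    assert (exp x < 1)%R by (rewrite <- exp_0; apply exp_increasing; lra).
    rewrite !Rabs_left by lra. nra. }
assert (Hx2 : ((exp x - 1) ^ 2 <= x ^ 2 * M ^ 2)%R).
{ rewrite <- (pow2_abs (exp x - 1)), <- (pow2_abs x), <- Rpow_mult_distr.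
  apply pow_incr. split; [apply Rabs_pos|exact Hx]. }
assert (Hc := cos_quadratic y). assert (Hp := exp_pos x).
assert (Hs := sin2_cos2 y). unfold Rsqr in Hs.
assert (Hy : (exp x * y ^ 2 <= y ^ 2 * M ^ 2)%R).
{ replace (y ^ 2 * M ^ 2)%R with (M ^ 2 * y ^ 2)%R by ring. apply Rmult_le_compat_r; [apply pow2_ge_0|nra]. }
assert (Hcc : (exp x * (2 - 2 * cos y) <= exp x * y ^ 2)%R) by (apply Rmult_le_compat_l; lra).
replace ((exp x * cos y + - (1)) * ((exp x * cos y + - (1)) * 1) + (exp x * sin y + - 0) * ((exp x * sin y + - 0) * 1))%R
 with ((exp x - 1) ^ 2 + exp x * (2 - 2 * cos y) + exp x * exp x * (sin y * sin y + cos y * cos y - 1))%R by ring.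
rewrite Hs. lra.
Qed.

Lemma clog_near_1 (eta : R) : (0 < eta)%R ->
  exists dl, (0 < dl)%R /\ forall v : C, (Cmod (v - 1) < dl)%R ->
    exists la, Cexp la = v /\ (Cmod la < eta)%R.
Proof.
intros He.
(* The principal logarithm in the right half plane; the condition |v - 1| < 1 below keeps Re v
   positive. *)
set (L := fun v : C => (ln (Cmod v), atan (Im v / Re v)) : C).
assert (HL0 : L 1 = 0).
{ unfold L. rewrite Cmod_1, ln_1. simpl. replace (0 / 1)%R with 0%R by field. rewrite atan_0. reflexivity. }
assert (HRe : continuous (Re : C -> R) (RtoC 1 : C_UniformSpace)) by (apply (continuous_Re (fun y : C => y)), continuous_id).
assert (HIm : continuous (Im : C -> R) (RtoC 1 : C_UniformSpace)) by (apply (continuous_Im (fun y : C => y)), continuous_id).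
assert (HL : continuous L (RtoC 1 : C_UniformSpace)).
{ apply continuous_C_iff; split; simpl.
  - apply (continuous_comp Cmod ln).
    + apply (filterlim_norm (K:=C_AbsRing) (V:=C_NormedModule) (RtoC 1)).
    + apply continuity_pt_filterlim. rewrite Cmod_1. apply derivable_continuous_pt.
      exists (/ 1)%R. apply derivable_pt_lim_ln; lra.
  - apply (continuous_comp (fun v : C => Im v / Re v)%R atan).
    + apply (continuous_mult (K:=R_AbsRing)); [exact HIm|].
      apply (continuous_comp Re Rinv); [exact HRe|]. apply continuity_pt_filterlim.
      apply continuity_pt_inv; [apply continuity_pt_id|]. simpl. lra.
    + apply continuity_pt_filterlim. apply derivable_continuous_pt, derivable_pt_atan. }
destruct (proj1 (locally_Cmod _ _) (proj1 (continuous_Cmod_iff _ _) HL eta He)) as [dl [Hdl H]].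
exists (Rmin dl 1). split; [apply Rmin_pos; lra|].
intros v Hv. exists (L v).
assert (H1 : (Cmod (v - 1) < dl)%R) by (apply Rlt_le_trans with (1 := Hv), Rmin_l).
assert (H2 : (Cmod (v - 1) < 1)%R) by (apply Rlt_le_trans with (1 := Hv), Rmin_r).
specialize (H v H1). rewrite HL0 in H. replace (L v - 0) with (L v) in H by ring.
split; [|exact H].
assert (Hx : (0 < Re v)%R).
{ generalize (re_le_Cmod (v - 1)). change (Re (v - 1)) with (Re v - 1)%R. intros H3.
  assert (H4 := Rle_abs (- (Re v - 1))). rewrite Rabs_Ropp in H4. lra. }
destruct v as [x y]. simpl Re in Hx. unfold L, Cexp. simpl Re; simpl Im.
assert (Hs : (0 < 1 + (y / x)²)%R) by (generalize (Rle_0_sqr (y / x)); lra).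
assert (Hm : Cmod (x, y) = (x * sqrt (1 + (y / x)²))%R).
{ transitivity (sqrt (x * x) * sqrt (1 + (y / x)²))%R.
  - rewrite <- sqrt_mult; [|nra|lra]. unfold Cmod; simpl. f_equal. unfold Rsqr. field. lra.
  - rewrite sqrt_square by lra. reflexivity. }
assert (Hq := sqrt_lt_R0 _ Hs).
rewrite exp_ln by (rewrite Hm; apply Rmult_lt_0_compat; assumption).
rewrite cos_atan, sin_atan, Hm. apply injective_projections; simpl; field; repeat split; lra.
Qed.

Lemma polar (u : C) : exists th, (- PI <= th <= PI)%R /\ u = RtoC (Cmod u) * cis th.
Proof.
destruct (Ceq_dec u 0) as [->|Hu].
{ exists 0%R. generalize PI_RGT_0. split; [lra|]. rewrite Cmod_0. ring. }
assert (Hm := proj1 (Cmod_gt_0 u) Hu).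
set (m := Cmod u) in *.
assert (E : (m ^ 2 = Re u ^ 2 + Im u ^ 2)%R) by apply Cmod2_alt.
set (c := (Re u / m)%R).
assert (Hc : (-1 <= c <= 1)%R).
{ generalize (re_le_Cmod u). fold m. intros H. apply Rabs_le_between in H. unfold c. split.
  - apply Rle_div_r; lra.
  - apply Rle_div_l; lra. }
assert (Hb := acos_bound c).
assert (Hs : sin (acos c) = (Rabs (Im u) / m)%R).
{ rewrite sin_acos by exact Hc.
  replace (1 - c²)%R with ((Rabs (Im u) / m)²)%R.
  - apply sqrt_Rsqr. apply Rdiv_le_0_compat; [apply Rabs_pos|exact Hm].
  - rewrite !Rsqr_pow2. unfold Rdiv. rewrite Rpow_mult_distr, pow2_abs. 
    replace (Im u ^ 2)%R with (m ^ 2 - Re u ^ 2)%R by lra. unfold c. field. lra. }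
destruct (Rle_lt_dec 0 (Im u)) as [Hp|Hn].
- exists (acos c). split; [lra|]. unfold cis. rewrite cos_acos, Hs, Rabs_pos_eq by assumption.
  destruct u as [x y]; apply injective_projections; unfold c; simpl; field; lra.
- exists (- acos c)%R. split; [lra|]. unfold cis. rewrite cos_neg, sin_neg, cos_acos, Hs, Rabs_left by assumption.
  destruct u as [x y]; apply injective_projections; unfold c; simpl; field; lra.
Qed.

Lemma clog_exists (u : C) : u <> 0 -> exists s, Cexp s = u.
Proof.
intros Hu. destruct (polar u) as [th [_ E]].
exists (ln (Cmod u), th). rewrite Cexp_cis. simpl. rewrite exp_ln by (apply Cmod_gt_0, Hu). symmetry; exact E.
Qed.

(** * Continuity of the inverse of u e^u *)

Definition zexpz (u : C) : C := u * Cexp u.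

Lemma cder_zexpz (u : C) : cder zexpz u (Cexp u * (1 + u)).
Proof.
replace (Cexp u * (1 + u)) with (1 * Cexp u + u * Cexp u) by ring.
apply (cder_mult (fun y => y)); [apply cder_id|apply cder_Cexp].
Qed.

Lemma Cmod_zexpz (u : C) : Cmod (zexpz u) = (Cmod u * exp (Re u))%R.
Proof. unfold zexpz. rewrite Cmod_mult, Cmod_Cexp. reflexivity. Qed.

(* In the coordinate s = log u the map u e^u becomes s + e^s on the convex half plane
   Re s < 0, where e^s is a contraction relative to the fixed point s0. *)
Lemma Cexp_contraction (s s0 : C) : (Re s <= 0)%R -> (Re s0 <= 0)%R ->
  (Cmod (Cexp s - Cexp s0) <= (1 + exp (Re s0 / 2)) / 2 * Cmod (s - s0))%R.
Proof.
intros Hs Hs0.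
(* The segment is split at its midpoint [m]. On the half towards [s] the derivative e^s is bounded
   by 1 only, but on the half towards [s0] by exp(Re s0 / 2), since Re m <= Re s0 / 2; the constant
   is the mean of the two bounds and does not depend on [s]. *)
set (h := (s - s0) / 2).
set (m := s0 + h).
assert (Es : s = m + h) by (unfold m, h; field).
assert (Es0 : s0 = m + - h) by (unfold m; ring).
assert (Hh : Cmod (s - s0) = (2 * Cmod h)%R).
{ unfold h. rewrite Cmod_div by (intros E; apply RtoC_inj in E; lra). rewrite Cmod_R, (Rabs_pos_eq 2) by lra. field. }
assert (Rs : Re s = (Re m + Re h)%R) by (rewrite Es at 1; apply re_plus).
assert (Rs0 : Re s0 = (Re m - Re h)%R) by (rewrite Es0 at 1; rewrite re_plus, re_opp; ring).
assert (EE : Cexp s - Cexp s0 = Cexp m * (Cexp h - 1) + - (Cexp m * (Cexp (- h) - 1))).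
{ transitivity (Cexp (m + h) - Cexp (m + - h)); [rewrite <- Es, <- Es0; reflexivity|].
  rewrite !Cexp_plus; ring. }
rewrite EE.
apply Rle_trans with (1 := Cmod_triangle _ _). rewrite Cmod_opp, !Cmod_mult, !Cmod_Cexp.
assert (B1 := Cexp_minus_1_bound h). assert (B2 := Cexp_minus_1_bound (- h)). rewrite Cmod_opp, re_opp in B2.
assert (Hm := exp_pos (Re m)). assert (H0 := Cmod_ge_0 h).
assert (A1 : (exp (Re m) * Rmax 1 (exp (Re h)) <= 1)%R).
{ rewrite <- RmaxRmult by lra. rewrite Rmult_1_r, <- exp_plus.
  apply Rmax_lub; rewrite <- exp_0; apply exp_le; lra. }
assert (A2 : (exp (Re m) * Rmax 1 (exp (- Re h)) <= exp (Re s0 / 2))%R).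
{ rewrite <- RmaxRmult by lra. rewrite Rmult_1_r, <- exp_plus. apply Rmax_lub; apply exp_le; lra. }
rewrite Hh.
assert (C1 : (exp (Re m) * Cmod (Cexp h - 1) <= Cmod h * 1)%R).
{ apply Rle_trans with (exp (Re m) * (Cmod h * Rmax 1 (exp (Re h))))%R; [apply Rmult_le_compat_l; lra|].
  replace (exp (Re m) * (Cmod h * Rmax 1 (exp (Re h))))%R with (Cmod h * (exp (Re m) * Rmax 1 (exp (Re h))))%R by ring.
  apply Rmult_le_compat_l; assumption. }
assert (C2 : (exp (Re m) * Cmod (Cexp (- h) - 1) <= Cmod h * exp (Re s0 / 2))%R).
{ apply Rle_trans with (exp (Re m) * (Cmod h * Rmax 1 (exp (- Re h))))%R; [apply Rmult_le_compat_l; lra|].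
  replace (exp (Re m) * (Cmod h * Rmax 1 (exp (- Re h))))%R with (Cmod h * (exp (Re m) * Rmax 1 (exp (- Re h))))%R by ring.
  apply Rmult_le_compat_l; assumption. }
lra.
Qed.

(** Here [u] ranges over the whole disk, so injectivity is included. Away from u0 = 0 let s and s0
    be logarithms of u and u0. Then s + e^s and s0 + e^s0 are logarithms of the two values, and the
    contraction turns closeness of these into closeness of s and s0. At u0 = 0, which has no
    logarithm, |u e^u| >= |u| / e suffices. *)
Lemma zexpz_inverse_continuous (u0 : C) (eps : R) : inD u0 -> (0 < eps)%R ->
  exists dl, (0 < dl)%R /\ forall u, inD u -> (Cmod (zexpz u - zexpz u0) < dl)%R -> (Cmod (u - u0) < eps)%R.
Proof.
intros Hu0 He. unfold inD in Hu0.
destruct (Ceq_dec u0 0) as [->|Hne].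
- exists (eps * exp (- 1))%R. split; [apply Rmult_lt_0_compat; [exact He|apply exp_pos]|].
  intros u Hu H. unfold inD in Hu.
  replace (zexpz u - zexpz 0) with (zexpz u) in H by (unfold zexpz; ring).
  replace (u - 0) with u by ring. rewrite Cmod_zexpz in H.
  assert (Hx := re_le_Cmod u). apply Rabs_le_between in Hx.
  assert (exp (- 1) <= exp (Re u))%R by (apply exp_le; lra).
  assert (H2 := exp_pos (- 1)). assert (H3 := Cmod_ge_0 u). nra.
- destruct (clog_exists u0 Hne) as [s0 Hs0].
  assert (Hm0 := proj1 (Cmod_gt_0 _) Hne).
  assert (Hr0 : (Re s0 < 0)%R).
  { apply exp_lt_inv. rewrite <- Cmod_Cexp, Hs0, exp_0. exact Hu0. }
  set (ka := ((1 + exp (Re s0 / 2)) / 2)%R).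
  assert (Hka : (ka < 1)%R).
  { unfold ka. assert (exp (Re s0 / 2) < 1)%R by (rewrite <- exp_0; apply exp_increasing; lra). lra. }
  (* The factor 1 - ka is lost to the contraction. The bound 1 on |ta| gives |e^ta - 1| <= 3 |ta|
     because e <= 3, and eps / 3 pays for that 3. *)
  assert (Heta : (0 < (1 - ka) * Rmin 1 (eps / 3))%R).
  { apply Rmult_lt_0_compat; [lra|]. apply Rmin_pos; lra. }
  destruct (clog_near_1 _ Heta) as [dl [Hdl Hlog]].
  assert (Hv0 : zexpz u0 <> 0) by (apply Cmult_neq_0; [exact Hne|apply Cexp_neq_0]).
  assert (Hmv := proj1 (Cmod_gt_0 _) Hv0).
  exists (dl * Cmod (zexpz u0))%R. split; [apply Rmult_lt_0_compat; assumption|].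
  intros u Hu H.
  destruct (Hlog (zexpz u / zexpz u0)) as [la [Hla Hlam]].
  { replace (zexpz u / zexpz u0 - 1) with ((zexpz u - zexpz u0) / zexpz u0) by (field; exact Hv0).
    rewrite Cmod_div by exact Hv0. apply Rlt_div_l; [exact Hmv|exact H]. }
  assert (Ev : zexpz u = zexpz u0 * Cexp la) by (rewrite Hla; field; exact Hv0).
  assert (Hun : u <> 0).
  { intros E. apply (Cmult_neq_0 _ _ Hv0 (Cexp_neq_0 la)). rewrite <- Ev, E. unfold zexpz; ring. }
  destruct (clog_exists u Hun) as [s Hs].
  (* [mu] is the ambiguity of the logarithm, a period of exp. Adding it to [s0] gives another
     logarithm [s0'] of [u0], with the same real part, for which s - s0' = la - (e^s - e^s0') holds
     exactly. *)
  set (mu := (s + Cexp s) - (s0 + Cexp s0) - la).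
  assert (Hmu : Cexp mu = 1).
  { assert (E1 : Cexp (s + Cexp s) = Cexp (s0 + Cexp s0) * Cexp la).
    { rewrite !Cexp_plus, Hs, Hs0. exact Ev. }
    replace (s + Cexp s) with (mu + ((s0 + Cexp s0) + la)) in E1 by (unfold mu; ring).
    rewrite Cexp_plus, (Cexp_plus (s0 + Cexp s0)) in E1.
    set (W := Cexp (s0 + Cexp s0) * Cexp la) in *.
    assert (HW : W <> 0) by (apply Cmult_neq_0; apply Cexp_neq_0).
    replace (Cexp mu) with (Cexp mu * W / W) by (field; exact HW). rewrite E1. field; exact HW. }
  set (s0' := s0 + mu).
  assert (Hs0' : Cexp s0' = u0) by (unfold s0'; rewrite Cexp_plus, Hmu, Hs0; ring).
  assert (ER : Re s0' = Re s0).
  { apply exp_inv. rewrite <- !Cmod_Cexp. congruence. }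
  assert (Hrs : (Re s < 0)%R).
  { apply exp_lt_inv. rewrite <- Cmod_Cexp, Hs, exp_0. exact Hu. }
  assert (HC := Cexp_contraction s s0' ltac:(lra) ltac:(lra)). rewrite ER in HC. fold ka in HC.
  assert (Eq : s - s0' = la + - (Cexp s - Cexp s0')).
  { rewrite Hs, Hs0'. unfold s0', mu. rewrite Hs, Hs0. ring. }
  assert (HT : (Cmod (s - s0') <= Cmod la + Cmod (Cexp s - Cexp s0'))%R).
  { rewrite Eq at 1. apply Rle_trans with (1 := Cmod_triangle _ _). rewrite Cmod_opp. lra. }
  set (ta := s - s0') in *.
  assert (Hta : (Cmod ta < Rmin 1 (eps / 3))%R).
  { apply (Rmult_lt_reg_l (1 - ka)); [lra|]. lra. }
  assert (Ht1 : (Cmod ta < 1)%R) by (apply Rlt_le_trans with (1 := Hta), Rmin_l).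
  assert (Ht2 : (Cmod ta < eps / 3)%R) by (apply Rlt_le_trans with (1 := Hta), Rmin_r).
  assert (Eu : u - u0 = u0 * (Cexp ta - 1)).
  { rewrite <- Hs, <- Hs0'. replace s with (s0' + ta) at 1 by (unfold ta; ring). rewrite Cexp_plus; ring. }
  rewrite Eu, Cmod_mult.
  assert (HB := Cexp_minus_1_bound ta).
  assert (HM : (Rmax 1 (exp (Re ta)) <= 3)%R).
  { apply Rmax_lub; [lra|]. apply Rle_trans with (2 := exp_le_3). apply exp_le.
    assert (Hx := re_le_Cmod ta). apply Rabs_le_between in Hx. lra. }
  assert (H1 := Cmod_ge_0 ta). assert (H2 := Cmod_ge_0 (Cexp ta - 1)).
  nra.
Qed.

(** * The image of u e^u *)

Lemma exp_mul_neg (x : R) : (exp x * exp (- x) = 1)%R.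
Proof. rewrite <- exp_plus, Rplus_opp_r. apply exp_0. Qed.

(** The constant is (5/4)^4 = 2.4414..., rounded down. It must exceed 1 + sqrt 2, which is what e -
    1/e >= 2 amounts to. *)
Lemma exp_1_gt : (2.44 < exp 1)%R.
Proof.
replace 1%R with (1/4 + 1/4 + (1/4 + 1/4))%R by field. rewrite !exp_plus.
assert (H := exp_ineq1 (1/4) ltac:(lra)).
assert (2.44 < (5/4 * (5/4)) * (5/4 * (5/4)))%R by lra.
assert (5/4 * (5/4) <= exp (1/4) * exp (1/4))%R by nra. nra.
Qed.

Lemma two_sinh_1_ge_2 : (2 <= exp 1 - exp (- (1)))%R.
Proof. assert (H1 := exp_1_gt). assert (H2 := exp_mul_neg 1). assert (H3 := exp_pos (- 1)).
assert (exp (- (1)) * 2.44 < exp (- (1)) * exp 1)%R by (apply Rmult_lt_compat_l; assumption). lra. Qed.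

(** The bounds (1 + c) e^(-c) <= 1 and c e^(-c) <= 1/e are added with weights 1 - c and c; the left
    sides sum to e^(-c) because (1 - c)(1 + c) + c^2 = 1. *)
Lemma exp_neg_chord (c : R) : (0 <= c <= 1)%R -> (exp (- c) <= 1 - c + c * exp (- (1)))%R.
Proof.
intros Hc.
assert (H1 := exp_ineq1_le c). assert (H2 := exp_ineq1_le (c - 1)%R).
assert (H3 := exp_mul_neg c). assert (H4 := exp_pos (- c)).
assert (E : (exp (c - 1) * exp (- c) = exp (- (1)))%R) by (rewrite <- exp_plus; f_equal; ring).
assert (K1 : (exp (- c) * (1 + c) <= 1)%R) by nra.
assert (K2 : (exp (- c) * c <= exp (- (1)))%R) by nra.
assert (K3 : ((1 - c) * (exp (- c) * (1 + c)) <= (1 - c) * 1)%R) by (apply Rmult_le_compat_l; lra).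
assert (K4 : (c * (exp (- c) * c) <= c * exp (- (1)))%R) by (apply Rmult_le_compat_l; lra).
nra.
Qed.

Lemma cosh_increasing (a b : R) : (0 <= a <= b)%R -> (exp a + exp (- a) <= exp b + exp (- b))%R.
Proof.
intros H. assert (H1 := exp_le a b ltac:(lra)). assert (Ha := exp_mul_neg a). assert (Hb := exp_mul_neg b).
assert (Ha1 : (1 <= exp a)%R) by (rewrite <- exp_0; apply exp_le; lra).
assert (Hb1 : (1 <= exp b)%R) by lra.
assert (E : (exp b + exp (- b) - (exp a + exp (- a)) = (exp b - exp a) * (1 - exp (- a) * exp (- b)))%R).
{ replace ((exp b - exp a) * (1 - exp (- a) * exp (- b)))%R
   with (exp b - exp a - exp (- a) * (exp b * exp (- b)) + exp (- b) * (exp a * exp (- a)))%R by ring.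
  rewrite Ha, Hb. ring. }
assert (H2 : (exp (- a) <= 1)%R) by (rewrite <- exp_0; apply exp_le; lra).
assert (H3 : (exp (- b) <= 1)%R) by (rewrite <- exp_0; apply exp_le; lra).
generalize (exp_pos (- a)) (exp_pos (- b)). intros.
assert (0 <= (exp b - exp a) * (1 - exp (- a) * exp (- b)))%R by (apply Rmult_le_pos; nra). lra.
Qed.

(** Convexity of sinh on [0, 1]: the mean value theorem on both sides of [c], with increasing
    derivative. *)
Lemma sinh_chord (c : R) : (0 <= c <= 1)%R -> (exp c - exp (- c) <= c * (exp 1 - exp (- (1))))%R.
Proof.
intros Hc.
destruct (Req_dec c 0) as [->|H0]; [rewrite Ropp_0, exp_0; lra|].
destruct (Req_dec c 1) as [->|H1]; [lra|].
set (f := (fun x => exp x - exp (- x))%R). set (f' := (fun x => exp x + exp (- x))%R).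
assert (Hd : forall x, derivable_pt_lim f x (f' x)).
{ intros x. apply is_derive_Reals. unfold f, f'. auto_derive; trivial. ring. }
destruct (MVT_cor2 f f' 0 c ltac:(lra) ltac:(intros; apply Hd)) as [x1 [E1 I1]].
destruct (MVT_cor2 f f' c 1 ltac:(lra) ltac:(intros; apply Hd)) as [x2 [E2 I2]].
assert (Hf : (f' x1 <= f' x2)%R) by (apply cosh_increasing; lra).
assert (F0 : f 0%R = 0%R) by (unfold f; rewrite Ropp_0; ring).
change (f c <= c * f 1)%R. rewrite F0 in E1.
assert (f c * (1 - c) <= c * (f 1 - f c))%R; [|nra].
rewrite !Rminus_0_r in E1. rewrite E2, E1.
replace (f' x1 * c * (1 - c))%R with (c * (1 - c) * f' x1)%R by ring.
replace (c * (f' x2 * (1 - c)))%R with (c * (1 - c) * f' x2)%R by ring.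
apply Rmult_le_compat_l; nra.
Qed.

Lemma sin_ge_half (s : R) : (0 <= s <= 1)%R -> (s / 2 <= sin s)%R.
Proof.
intros Hs. destruct (Req_dec s 0) as [->|H0]; [rewrite sin_0; lra|].
destruct (MVT_cor2 sin cos 0 s ltac:(lra) ltac:(intros; apply derivable_pt_lim_sin)) as [x [E I]].
rewrite sin_0 in E. assert (H := cos_quadratic x).
assert (1 / 2 <= cos x)%R by nra. nra.
Qed.

(** After multiplication by exp(cos t) this says that e^(cos t) [cis (t + sin t)], the image of
    [cis t] under u e^u, has distance at least cosh 1 from sinh 1. For t > PI/2 the substitution u =
    PI - t and the chord bound on sinh suffice. *)
Lemma sinh_cos_ineq (t : R) : (0 <= t <= PI)%R ->
  ((exp 1 - exp (- (1))) * cos (t + sin t) <= exp (cos t) - exp (- cos t))%R.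
Proof.
intros Ht. assert (HD := two_sinh_1_ge_2). set (D := (exp 1 - exp (- (1)))%R) in *.
assert (HP := PI_RGT_0).
destruct (Rle_lt_dec t (PI / 2)) as [Hl|Hr].
- assert (Hc : (0 <= cos t <= 1)%R) by (split; [apply cos_ge_0; lra|apply COS_bound]).
  assert (Hs : (0 <= sin t <= 1)%R) by (split; [apply sin_ge_0; lra|apply SIN_bound]).
  assert (H1 := exp_neg_chord (cos t) Hc).
  assert (H2 : (exp 1 * cos t <= exp (cos t))%R).
  { replace (cos t) with (1 + (cos t - 1))%R at 2 by ring. rewrite exp_plus.
    apply Rmult_le_compat_l; [apply Rlt_le, exp_pos|]. generalize (exp_ineq1_le (cos t - 1)). lra. }
  rewrite cos_plus.
  assert (H3 := sin_ge_half (sin t) Hs). assert (H4 := sin2_cos2 t). unfold Rsqr in H4.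
  assert (H5 : (cos t * cos (sin t) <= cos t)%R).
  { rewrite <- (Rmult_1_r (cos t)) at 2. apply Rmult_le_compat_l; [lra|apply COS_bound]. }
  assert (H6 : ((1 - cos t) / 2 <= sin t * sin (sin t))%R).
  { apply Rle_trans with (sin t * (sin t / 2))%R; [nra|]. apply Rmult_le_compat_l; lra. }
  (* The right side of the goal is at least D cos t - (1 - cos t), by e^c >= e c and the chord bound
     for e^(-c), c = cos t. The defect (1 - cos t) / 2 gained from the sine term covers this exactly
     when D >= 2. *)
  apply Rle_trans with (D * (cos t - (1 - cos t) / 2))%R; [apply Rmult_le_compat_l; lra|].
  unfold D in *. nra.
- set (u := (PI - t)%R). assert (Eu : t = (PI - u)%R) by (unfold u; ring).
  rewrite Eu. replace (cos (PI - u)) with (- cos u)%R by (rewrite cos_minus, cos_PI, sin_PI; ring).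
  replace (sin (PI - u)) with (sin u) by (rewrite sin_minus, cos_PI, sin_PI; ring).
  replace (cos (PI - u + sin u)) with (- cos (u - sin u))%R.
  2: { replace (PI - u + sin u)%R with (PI - (u - sin u))%R by ring. rewrite (cos_minus PI), cos_PI, sin_PI; ring. }
  rewrite Ropp_involutive.
  assert (Hu : (0 <= u <= PI / 2)%R) by (unfold u; lra).
  assert (Hc : (0 <= cos u <= 1)%R) by (split; [apply cos_ge_0; lra|apply COS_bound]).
  assert (H1 := sinh_chord (cos u) Hc). fold D in H1.
  assert (Hs : (0 <= sin u)%R) by (apply sin_ge_0; lra).
  assert (Hsu : (sin u <= u)%R).
  { destruct (Req_dec u 0) as [->|]; [rewrite sin_0; lra|]. apply Rlt_le, sin_lt_x; lra. }
  assert (H2 : (cos u <= cos (u - sin u))%R) by (apply cos_decr_1; lra).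
  nra.
Qed.

(** The boundary curve: the value of u e^u at u = [cis t]. *)
Definition bdry (t : R) : C := RtoC (exp (cos t)) * cis (t + sin t).

Lemma Cmod_polar_minus (x th b : R) :
  (Cmod (RtoC x * cis th - RtoC b) ^ 2 = x ^ 2 - 2 * b * (x * cos th) + b ^ 2)%R.
Proof.
rewrite Cmod2_alt. assert (H := sin2_cos2 th). unfold Rsqr in H.
replace (x ^ 2)%R with (x * x * (sin th * sin th + cos th * cos th))%R by (rewrite H; ring). simpl. ring.
Qed.

(* Both squared-distance inequalities are affine in the centre [b] and coincide with
   [sinh_cos_ineq] at [b = sinh 1]; they are trivial at the other end of their range. *)
Lemma bdry_far (t b m : R) : (0 <= t <= PI)%R -> (0 <= m)%R -> (m <= b + exp (- (1)))%R -> (m <= exp 1 - b)%R ->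
  (m <= Cmod (bdry t - RtoC b))%R.
Proof.
intros Ht Hm H1 H2.
apply Rsqr_incr_0_var; [|apply Cmod_ge_0]. rewrite !Rsqr_pow2. unfold bdry. rewrite Cmod_polar_minus.
assert (HI := sinh_cos_ineq t Ht). assert (HE := exp_mul_neg 1).
assert (HX := exp_mul_neg (cos t)).
assert (HX1 : (exp (- (1)) <= exp (cos t) <= exp 1)%R) by (split; apply exp_le; apply COS_bound).
assert (HK := COS_bound (t + sin t)).
assert (HD := two_sinh_1_ge_2).
set (k := cos (t + sin t)) in *. set (X := exp (cos t)) in *. set (E := exp 1) in *. set (Ei := exp (- (1))) in *.
assert (HXp : (0 < X)%R) by apply exp_pos. assert (HEp : (0 < E)%R) by apply exp_pos. assert (HEip : (0 < Ei)%R) by apply exp_pos.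
assert (HV : ((E - Ei) * (X * k) <= X ^ 2 - 1)%R).
{ replace (X ^ 2 - 1)%R with (X * (X - exp (- cos t)))%R by (rewrite <- HX; ring).
  replace ((E - Ei) * (X * k))%R with (X * ((E - Ei) * k))%R by ring. apply Rmult_le_compat_l; lra. }
destruct (Rle_lt_dec b ((E - Ei) / 2)) as [Hb|Hb].
- apply Rle_trans with ((b + Ei) ^ 2)%R; [apply pow_incr; lra|].
  set (V := fun b => (X ^ 2 - 2 * b * (X * k) - 2 * b * Ei - Ei ^ 2)%R).
  assert (V0 : (0 <= V (- Ei))%R).
  { assert (H : (0 <= Ei * X * (1 + k))%R) by (repeat apply Rmult_le_pos; lra).
    replace (V (- Ei)%R) with ((X - Ei) ^ 2 + 2 * (Ei * X * (1 + k)))%R by (unfold V; ring).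
    generalize (pow2_ge_0 (X - Ei)). lra. }
  assert (V1 : (0 <= V ((E - Ei) / 2))%R) by
   (unfold V; generalize HE HV; clear; intros HE HV; nra).
  assert (Hc : (V b * ((E - Ei) / 2 + Ei) = (b + Ei) * V ((E - Ei) / 2) + ((E - Ei) / 2 - b) * V (- Ei))%R) by (unfold V; field).
  assert (0 <= V b)%R; [|unfold V in *; lra].
  apply (Rmult_le_reg_r ((E - Ei) / 2 + Ei)); [lra|]. rewrite Hc, Rmult_0_l.
  apply Rplus_le_le_0_compat; apply Rmult_le_pos; lra.
- apply Rle_trans with ((E - b) ^ 2)%R; [apply pow_incr; lra|].
  assert (X * k <= E)%R by nra.
  (* This product is exactly what the squared-distance excess at centre [b] gains over the excess at
     sinh 1. *)
  assert (0 <= (2 * b - (E - Ei)) * (E - X * k))%R by (apply Rmult_le_pos; lra).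
  nra.
Qed.

Lemma zexpz_polar (r th : R) :
  zexpz (RtoC r * cis th) = RtoC (r * exp (r * cos th)) * cis (th + r * sin th).
Proof.
unfold zexpz, Cexp, cis. rewrite cos_plus, sin_plus.
replace (Re (RtoC r * (cos th, sin th))) with (r * cos th)%R by (simpl; ring).
replace (Im (RtoC r * (cos th, sin th))) with (r * sin th)%R by (simpl; ring).
apply injective_projections; simpl; ring.
Qed.

Lemma continuity_pt_of_derive (f : R -> R) (x : R) : ex_derive f x -> continuity_pt f x.
Proof. intros H. apply continuity_pt_filterlim, (ex_derive_continuous f x H). Qed.

Lemma x_plus_sin_lt (a b : R) : (0 <= a < b)%R -> (b <= PI)%R -> (a + sin a < b + sin b)%R.
Proof.
intros Ha Hb.
destruct (MVT_cor2 sin cos a b ltac:(lra) ltac:(intros; apply derivable_pt_lim_sin)) as [x [E I]].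
assert (-1 < cos x)%R by (rewrite <- cos_PI; apply cos_decreasing_1; lra). nra.
Qed.

(** The point psi [cis p] is sent to argument p + psi sin p, so psi(p) = (al - p) / sin p keeps the
    image on the ray of argument [al]. From p = phi1 to p = al, psi goes from 1 to 0, and the
    intermediate value theorem applies to the modulus. Strict monotonicity of p + sin p gives psi <
    1. *)
Lemma zexpz_onto_sector (x al : R) (phi1 : R) : (0 < al < PI)%R -> (0 < phi1 < PI)%R ->
  (phi1 + sin phi1 = al)%R -> (0 < x < exp (cos phi1))%R ->
  exists u, inD u /\ zexpz u = RtoC x * cis al.
Proof.
intros Hal Hphi E Hx.
assert (Hlt : (phi1 < al)%R) by (generalize (sin_gt_0 phi1); lra).
set (psi := fun p => ((al - p) / sin p)%R).
destruct (IVT_interv (fun p => x - psi p * exp (psi p * cos p))%R phi1 al) as [p [Hp Ep]].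
- intros p Hp. assert (Hs := sin_gt_0 p ltac:(lra) ltac:(lra)).
  apply continuity_pt_of_derive. unfold psi. auto_derive. repeat split; lra.
- exact Hlt.
- assert (Hs := sin_gt_0 phi1 ltac:(lra) ltac:(lra)).
  replace (psi phi1) with 1%R by (unfold psi; field_simplify_eq; lra). rewrite !Rmult_1_l. lra.
- unfold psi. replace ((al - al) / sin al)%R with 0%R by (unfold Rdiv; ring). lra.
- assert (Hs := sin_gt_0 p ltac:(lra) ltac:(lra)).
  assert (Hs1 := sin_gt_0 phi1 ltac:(lra) ltac:(lra)).
  assert (Hpne : p <> phi1).
  { intros ->. replace (psi phi1) with 1%R in Ep by (unfold psi; field_simplify_eq; lra). rewrite !Rmult_1_l in Ep. lra. }
  assert (Hmon := x_plus_sin_lt phi1 p ltac:(lra) ltac:(lra)).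
  assert (Hpsi : (0 <= psi p < 1)%R).
  { unfold psi. split; [apply Rdiv_le_0_compat; lra|]. apply Rlt_div_l; lra. }
  exists (RtoC (psi p) * cis p). split.
  + unfold inD. rewrite Cmod_mult, Cmod_cis, Cmod_R, Rabs_pos_eq; lra.
  + rewrite zexpz_polar. f_equal; f_equal; [lra|]. unfold psi. field. lra.
Qed.

Lemma Cconj_cis (t : R) : Cconj (cis t) = cis (- t).
Proof. unfold cis, Cconj; simpl. rewrite cos_neg, sin_neg. reflexivity. Qed.

Lemma zexpz_conj (u : C) : zexpz (Cconj u) = Cconj (zexpz u).
Proof.
unfold zexpz. rewrite Cmult_conj. f_equal. unfold Cexp; apply injective_projections; simpl; rewrite ?cos_neg, ?sin_neg;
 unfold Re, Im; ring.
Qed.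

(** The hypothesis |b| <= m puts 0 in the closed disk, about which the open disk is then
    starshaped. *)
Lemma disk_contains_segment (v : C) (b m t : R) : (Cmod (v - RtoC b) < m)%R -> (Rabs b <= m)%R -> (0 < t <= 1)%R ->
  (Cmod (RtoC t * v - RtoC b) < m)%R.
Proof.
intros Hv Hb Ht.
replace (RtoC t * v - RtoC b) with (RtoC t * (v - RtoC b) + RtoC (t - 1) * RtoC b) by (rewrite RtoC_minus; ring).
apply Rle_lt_trans with (1 := Cmod_triangle _ _). rewrite !Cmod_mult, !Cmod_R.
rewrite (Rabs_pos_eq t), (Rabs_left1 (t - 1)) by lra.
assert (0 <= Rabs b)%R by apply Rabs_pos. nra.
Qed.

(** The ray of argument [al] meets the boundary curve at modulus exp(cos p), where p + sin p = al.
    If [x] were at least that, the boundary point would lie on the segment from 0 to the target,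
    hence inside the disk, contradicting [bdry_far]. *)
Lemma zexpz_onto_upper (x al b m : R) : (0 <= al <= PI)%R -> (0 < x)%R ->
  (Rabs b <= m)%R -> (m <= b + exp (- (1)))%R -> (m <= exp 1 - b)%R ->
  (Cmod (RtoC x * cis al - RtoC b) < m)%R ->
  exists u, inD u /\ zexpz u = RtoC x * cis al.
Proof.
intros Hal Hx Hb H1 H2 Hd. assert (HP := PI_RGT_0).
assert (Hm0 : (0 <= m)%R) by (generalize (Rabs_pos b); lra).
(* On the real axis the parametrization by psi would divide by sin p = 0; the functions p e^p and p
   e^(-p) on [0, 1] replace it. *)
destruct (Req_dec al 0) as [->|Hal0]; [|destruct (Req_dec al PI) as [->|HalP]].
- assert (Hre := re_le_Cmod (RtoC x * cis 0 - RtoC b)).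
  replace (Re (RtoC x * cis 0 - RtoC b)) with (x - b)%R in Hre by (simpl; rewrite cos_0; ring).
  apply Rabs_le_between in Hre.
  destruct (IVT_interv (fun p => p * exp p - x)%R 0 1) as [p [Hp Ep]].
  + intros p Hp. apply continuity_pt_of_derive. auto_derive. trivial.
  + lra.
  + lra.
  + lra.
  + exists (RtoC p * cis 0). split.
    * unfold inD. rewrite Cmod_mult, Cmod_cis, Cmod_R, Rabs_pos_eq by lra.
      destruct (Req_dec p 1) as [->|]; lra.
    * rewrite zexpz_polar, cos_0, sin_0, !Rmult_1_r, Rmult_0_r, Rplus_0_r. do 2 f_equal. lra.
- assert (Hre := re_le_Cmod (RtoC x * cis PI - RtoC b)).
  replace (Re (RtoC x * cis PI - RtoC b)) with (- x - b)%R in Hre by (simpl; rewrite cos_PI; ring).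
  apply Rabs_le_between in Hre.
  destruct (IVT_interv (fun p => p * exp (- p) - x)%R 0 1) as [p [Hp Ep]].
  + intros p Hp. apply continuity_pt_of_derive. auto_derive. trivial.
  + lra.
  + lra.
  + lra.
  + exists (RtoC p * cis PI). split.
    * unfold inD. rewrite Cmod_mult, Cmod_cis, Cmod_R, Rabs_pos_eq by lra.
      destruct (Req_dec p 1) as [->|]; [|lra]. lra.
    * rewrite zexpz_polar, cos_PI, sin_PI, Rmult_0_r, Rplus_0_r. do 2 f_equal.
      replace (p * -1)%R with (- p)%R by ring. lra.
- destruct (IVT_interv (fun p => p + sin p - al)%R 0 PI) as [p [Hp Ep]].
  + intros p Hp. apply continuity_pt_of_derive. auto_derive. trivial.
  + lra.
  + rewrite sin_0. lra.
  + rewrite sin_PI. lra.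
  + assert (Hp0 : p <> 0%R) by (intros ->; rewrite sin_0 in Ep; lra).
    assert (HpP : p <> PI) by (intros ->; rewrite sin_PI in Ep; lra).
    apply (zexpz_onto_sector x al p); try lra.
    split; [exact Hx|]. apply Rnot_le_lt. intros Hle.
    assert (Hfar := bdry_far p b m ltac:(lra) Hm0 H1 H2).
    assert (Hpos := exp_pos (cos p)).
    assert (Hseg := disk_contains_segment _ b m (exp (cos p) / x) Hd Hb).
    apply (Rlt_irrefl m). apply Rle_lt_trans with (1 := Hfar).
    replace (bdry p) with (RtoC (exp (cos p) / x) * (RtoC x * cis al)).
    * apply Hseg. split; [apply Rdiv_lt_0_compat; lra|apply Rle_div_l; lra].
    * unfold bdry. replace (p + sin p)%R with al by lra.
      rewrite Cmult_assoc, <- RtoC_mult. do 2 f_equal. field. lra.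
Qed.

(** The disk has its centre on the real axis and u e^u commutes with conjugation, so targets in the
    lower half plane reduce to [zexpz_onto_upper]. *)
Theorem zexpz_onto_disk (v : C) (b m : R) :
  (Rabs b <= m)%R -> (m <= b + exp (- (1)))%R -> (m <= exp 1 - b)%R ->
  (Cmod (v - RtoC b) < m)%R -> exists u, inD u /\ zexpz u = v.
Proof.
intros Hb H1 H2 Hd.
destruct (Ceq_dec v 0) as [->|Hv].
{ exists 0. split; [unfold inD; rewrite Cmod_0; lra|]. unfold zexpz; ring. }
assert (Hx := proj1 (Cmod_gt_0 v) Hv).
destruct (polar v) as [th [Hth E]].
destruct (Rle_lt_dec 0 th) as [Hp|Hn].
- rewrite E. apply (zexpz_onto_upper _ th b m); try assumption; [lra|]. rewrite <- E; exact Hd.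
- assert (E2 : RtoC (Cmod v) * cis (- th) = Cconj v).
  { rewrite E at 2. rewrite Cmult_conj, Cconj_cis. f_equal. apply injective_projections; simpl; ring. }
  destruct (zexpz_onto_upper (Cmod v) (- th) b m) as [u [Hu Eu]]; try assumption; [lra| |].
  + rewrite E2. rewrite <- Cmod_conj, Cminus_conj, Cconj_conj.
    replace (Cconj (RtoC b)) with (RtoC b) by (apply injective_projections; simpl; ring). exact Hd.
  + exists (Cconj u). split; [unfold inD; rewrite Cmod_conj; exact Hu|].
    rewrite zexpz_conj, Eu, E2, Cconj_conj. reflexivity.
Qed.

(** * Subordination *)

Lemma choice_fun {X Y : Type} (P : X -> Y -> Prop) : (forall x, exists y, P x y) -> exists g, forall x, P x (g x).
Proof.
intros H. exists (fun x => proj1_sig (constructive_indefinite_description _ (H x))).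
intros x. apply (proj2_sig (constructive_indefinite_description _ (H x))).
Qed.

Lemma one_plus_neq_0 (u : C) : (Cmod u < 1)%R -> 1 + u <> 0.
Proof.
intros Hu E. replace u with (- (1)) in Hu.
- rewrite Cmod_opp, Cmod_1 in Hu. lra.
- replace u with ((1 + u) - 1) by ring. rewrite E. ring.
Qed.

(** Preimages are chosen point by point with no regularity. Continuity of [w] is forced by
    [zexpz_inverse_continuous], differentiability then by [cder_implicit], as the derivative e^u (1
    + u) is nonzero in the disk, and analyticity by [C1_analytic]. *)
Lemma lift_through_zexpz (q q' : C -> C) : C1_on_D q q' -> q 0 = 0 ->
  (forall z, inD z -> exists u, inD u /\ zexpz u = q z) ->
  exists w, schwarz w /\ forall z, inD z -> zexpz (w z) = q z.
Proof.
intros Hq Hq0 Honto.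
destruct (choice_fun (fun z u => inD z -> inD u /\ zexpz u = q z)) as [w Hw].
{ intros z. destruct (excluded_middle_informative (inD z)) as [Hz|Hz].
  - destruct (Honto z Hz) as [u Hu]. exists u; auto.
  - exists 0; tauto. }
exists w. split; [|intros z Hz; apply Hw, Hz].
assert (Hcont : forall z, inD z -> continuous w z).
{ intros z Hz. apply continuous_Cmod_iff. intros eps He.
  destruct (Hw z Hz) as [Hwz Ez].
  destruct (zexpz_inverse_continuous (w z) eps Hwz He) as [dl [Hdl H]].
  assert (Hqc := cder_continuous _ _ _ (proj1 (Hq z Hz))).
  generalize (filter_and _ _ (inD_locally z Hz) (proj1 (continuous_Cmod_iff _ _) Hqc dl Hdl)).
  apply filter_imp. intros y [Hy Hqy]. destruct (Hw y Hy) as [Hwy Ey].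
  apply H; [exact Hwy|]. rewrite Ey, Ez. exact Hqy. }
assert (Hne : forall z, inD z -> Cexp (w z) * (1 + w z) <> 0).
{ intros z Hz. apply Cmult_neq_0; [apply Cexp_neq_0|]. apply one_plus_neq_0, Hw, Hz. }
split; [|split].
- apply (C1_analytic w (fun z => q' z / (Cexp (w z) * (1 + w z)))).
  intros z Hz. destruct (Hq z Hz) as [H1 H2]. split.
  + apply (cder_implicit zexpz w q); [apply cder_zexpz|apply Hne, Hz|apply Hcont, Hz|exact H1|].
    generalize (inD_locally z Hz). apply filter_imp. intros y Hy. apply Hw, Hy.
  + apply continuous_Cmult; [exact H2|]. apply continuous_Cinv; [|apply Hne, Hz].
    apply continuous_Cmult.
    * apply (continuous_comp w Cexp); [apply Hcont, Hz|]. apply (cder_continuous _ _ _ (cder_Cexp _)).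
    * apply continuous_Cplus; [apply continuous_const|apply Hcont, Hz].
- assert (H0 : inD 0) by (unfold inD; rewrite Cmod_0; lra).
  destruct (Hw 0 H0) as [_ E]. rewrite Hq0 in E.
  destruct (Ceq_dec (w 0) 0) as [|Hn]; [assumption|].
  exfalso. apply (Cmult_neq_0 _ _ Hn (Cexp_neq_0 (w 0))). exact E.
- intros z Hz. apply Hw, Hz.
Qed.

(** Relative to the stated centre the map is (A - B) / D times (W + B rho^2) / (1 + B W), D = 1 -
    B^2 rho^2. That quotient has modulus below rho because rho^2 |1 + B W|^2 - |W + B rho^2|^2 =
    (rho^2 - |W|^2) D. *)
Lemma moebius_disk (A B rho : R) (W : C) : (B < A)%R -> (0 < rho)%R -> (Rabs B * rho < 1)%R -> (Cmod W < rho)%R ->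
  (Cmod (RtoC (A - B) * W / (1 + RtoC B * W) - RtoC ((B ^ 2 - A * B) * rho ^ 2 / (1 - B ^ 2 * rho ^ 2)))
    < (A - B) * rho / (1 - B ^ 2 * rho ^ 2))%R.
Proof.
intros HAB Hrho HB HW.
assert (HB2 : (B ^ 2 * rho ^ 2 < 1)%R).
{ rewrite <- Rpow_mult_distr, <- pow2_abs, Rabs_mult, (Rabs_pos_eq rho) by lra.
  assert (0 <= Rabs B * rho)%R by (apply Rmult_le_pos; [apply Rabs_pos|lra]). nra. }
set (D := (1 - B ^ 2 * rho ^ 2)%R). assert (HD : (0 < D)%R) by (unfold D; lra).
assert (HBW : (Cmod (RtoC B * W) < 1)%R).
{ rewrite Cmod_mult, Cmod_R. apply Rle_lt_trans with (2 := HB). apply Rmult_le_compat_l; [apply Rabs_pos|lra]. }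
assert (Hn := one_plus_neq_0 _ HBW). assert (Hm := proj1 (Cmod_gt_0 _) Hn).
assert (HDn : RtoC D <> 0) by (intros E; apply RtoC_inj in E; lra).
replace (RtoC (A - B) * W / (1 + RtoC B * W) - RtoC ((B ^ 2 - A * B) * rho ^ 2 / D))
  with (RtoC ((A - B) / D) * ((W + RtoC (B * rho ^ 2)) / (1 + RtoC B * W))).
2: { rewrite !RtoC_div by lra.
     replace (RtoC ((B ^ 2 - A * B) * rho ^ 2)) with (- (RtoC (A - B) * RtoC (B * rho ^ 2))).
     2: { rewrite <- RtoC_mult, <- RtoC_opp. f_equal. ring. }
     assert (ED : RtoC D = 1 - RtoC B * RtoC (B * rho ^ 2)).
     { rewrite <- RtoC_mult, <- RtoC_minus. f_equal. unfold D. ring. }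
     transitivity (RtoC (A - B) * (W * RtoC D + RtoC (B * rho ^ 2) * (1 + RtoC B * W)) / (RtoC D * (1 + RtoC B * W))).
     - rewrite ED at 2. field. split; assumption.
     - field. split; assumption. }
rewrite Cmod_mult, Cmod_R, Rabs_pos_eq by (apply Rdiv_le_0_compat; lra).
replace ((A - B) * rho / D)%R with ((A - B) / D * rho)%R by (field; lra).
apply Rmult_lt_compat_l; [apply Rdiv_lt_0_compat; lra|].
rewrite Cmod_div by exact Hn. apply Rlt_div_l; [exact Hm|].
apply Rsqr_incrst_0; [|apply Cmod_ge_0|apply Rmult_le_pos; lra].
rewrite !Rsqr_pow2, Rpow_mult_distr, !Cmod2_alt.
assert (HW2 : (Re W ^ 2 + Im W ^ 2 < rho ^ 2)%R).
{ rewrite <- Cmod2_alt. generalize (Cmod_ge_0 W). intros. nra. }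
assert (0 < (rho ^ 2 - (Re W ^ 2 + Im W ^ 2)) * D)%R by (apply Rmult_lt_0_compat; lra).
unfold D in *. destruct W as [x y]. simpl in *. nra.
Qed.

(** Here F = f / z and z F' = z^n H, so z f'/f - 1 = z^n H / F away from 0: the missing coefficients
    appear as the factor z^n. *)
Lemma classA_structure (n : nat) (f : C -> C) : (1 <= n)%nat -> classA n f ->
  exists F H : C -> C, F 0 = 1 /\ continuous F (RtoC 0 : C_UniformSpace) /\ continuous H (RtoC 0 : C_UniformSpace) /\
    forall z, inD z -> f z = z * F z /\ cder f z (F z + z ^ n * H z).
Proof.
intros Hn [a [Hf [Ha0 [Ha1 Ha]]]].
assert (H0D : (Cmod 0 < 1)%R) by (rewrite Cmod_0; lra).
destruct (pseries_shift 1 a f Hf Ha0) as [F [HF E]].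
destruct (pseries_C1 _ F HF) as [F' [HF' HC]].
destruct (pseries_factor (n - 1) 1 _ F' HF') as [H [HH EH]].
{ intros k Hk. unfold dcoef. rewrite Ha by lia. ring. }
exists F, H. split; [|split; [|split]].
- rewrite (pseries_at_0 _ _ (HF 0 H0D)). exact Ha1.
- apply (cder_continuous F 0 (F' 0)), HC, H0D.
- destruct (pseries_cder 1 _ H 0 HH H0D) as [d [_ Hd]]. apply (cder_continuous _ _ _ Hd).
- intros z Hz. split; [apply E, Hz|].
  apply (cder_ext_loc (fun y => y * F y)).
  { generalize (inD_locally z Hz). apply filter_imp. intros y Hy. symmetry. apply E, Hy. }
  replace (F z + z ^ n * H z) with (1 * F z + z * F' z).
  + apply (cder_mult (fun y => y)); [apply cder_id|apply HC, Hz].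
  + rewrite EH by exact Hz. destruct n as [|n]; [lia|]. replace (S n - 1)%nat with n by lia. rewrite Cpow_S. ring.
Qed.

(** Comparing (A - B) w / (1 + B w) with z^n H / F shows w = O(z^n) at 0. This kills the
    coefficients of w below n, and [schwarz_order] applies. *)
Lemma SAB_schwarz_order (n : nat) (A B : R) (f w : C -> C) : (1 <= n)%nat -> (-1 <= B < A)%R -> (A <= 1)%R ->
  classA n f -> schwarz w ->
  (forall z, inD z -> z <> 0 -> f z <> 0 /\ exists d, is_derive f z d /\ z * d / f z = Janowski A B (w z)) ->
  forall z, inD z -> (Cmod (w z) <= Cmod z ^ n)%R.
Proof.
intros Hn HB HA Hf [[c Hc] [Hw0 Hwb]] Heq.
assert (HBabs : (Rabs B <= 1)%R) by (apply Rabs_le; lra).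
destruct (classA_structure n f Hn Hf) as [F [H [HF0 [HFc [HHc HFH]]]]].
apply (schwarz_order n c w Hc).
2: { intros z Hz. apply Rlt_le, Hwb, Hz. }
assert (Hhalf : (0 < 1 / 2)%R) by lra.
destruct (proj1 (locally_Cmod _ _) (proj1 (continuous_Cmod_iff _ _) HFc _ Hhalf)) as [d1 [Hd1 K1]].
destruct (proj1 (locally_Cmod _ _) (proj1 (continuous_Cmod_iff _ _) HHc _ Rlt_0_1)) as [d2 [Hd2 K2]].
(* The constant comes from |F| >= 1/2, |1 + B w| <= 2 and |H| <= |H(0)| + 1 near 0. *)
apply (pseries_order n 1 c w (4 * (Cmod (H 0) + 1) / (A - B)) (Rmin 1 (Rmin d1 d2)) Rlt_0_1).
{ repeat apply Rmin_pos; lra. }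
{ exact Hc. }
intros z Hz Hlt.
assert (L1 : (Cmod z < 1)%R) by (apply Rlt_le_trans with (1 := Hlt), Rmin_l).
assert (L2 : (Cmod z < d1)%R).
{ apply Rlt_le_trans with (1 := Hlt). eapply Rle_trans; [apply Rmin_r|apply Rmin_l]. }
assert (L3 : (Cmod z < d2)%R).
{ apply Rlt_le_trans with (1 := Hlt). eapply Rle_trans; [apply Rmin_r|apply Rmin_r]. }
specialize (K1 z). specialize (K2 z). rewrite Cminus_0_r in K1, K2.
specialize (K1 L2). specialize (K2 L3). rewrite HF0 in K1.
destruct (Heq z L1 Hz) as [Hfz [d [Hd Ed]]]. destruct (HFH z L1) as [Efz Hder].
apply cder_is_derive in Hd. rewrite (cder_unique f z d _ Hd Hder) in Ed.
assert (HFz : F z <> 0) by (intros E; apply Hfz; rewrite Efz, E; ring).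
assert (HBw : (Cmod (RtoC B * w z) < 1)%R).
{ rewrite Cmod_mult, Cmod_R. generalize (Hwb z L1) (Cmod_ge_0 (w z)) (Rabs_pos B). unfold inD. intros. nra. }
assert (Hn1 := one_plus_neq_0 _ HBw).
assert (Key : RtoC (A - B) * w z * F z = z ^ n * H z * (1 + RtoC B * w z)).
{ unfold Janowski in Ed. rewrite Efz in Ed.
  assert (E1 : z ^ n * H z / F z = RtoC (A - B) * w z / (1 + RtoC B * w z)).
  { transitivity (z * (F z + z ^ n * H z) / (z * F z) - 1); [field; split; assumption|].
    rewrite Ed, RtoC_minus. field. exact Hn1. }
  transitivity (RtoC (A - B) * w z / (1 + RtoC B * w z) * F z * (1 + RtoC B * w z)); [field; exact Hn1|].
  rewrite <- E1. field. exact HFz. }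
assert (EM : ((A - B) * Cmod (w z) * Cmod (F z) = Cmod z ^ n * Cmod (H z) * Cmod (1 + RtoC B * w z))%R).
{ rewrite <- Cmod_pow, <- !Cmod_mult, <- Key, !Cmod_mult, Cmod_R, Rabs_pos_eq by lra. reflexivity. }
assert (B1 : (1 / 2 <= Cmod (F z))%R).
{ assert (Cmod 1 <= Cmod (F z) + Cmod (F z - 1))%R.
  { replace (RtoC 1) with (F z + - (F z - 1)) at 1 by ring. apply Rle_trans with (1 := Cmod_triangle _ _). rewrite Cmod_opp. lra. }
  rewrite Cmod_1 in *. lra. }
assert (B2 : (Cmod (H z) <= Cmod (H 0) + 1)%R).
{ replace (H z) with (H 0 + (H z - H 0)) by ring. apply Rle_trans with (1 := Cmod_triangle _ _). lra. }
assert (B3 : (Cmod (1 + RtoC B * w z) <= 2)%R).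
{ apply Rle_trans with (1 := Cmod_triangle _ _). rewrite Cmod_1. lra. }
assert (P0 : (0 <= Cmod z ^ n)%R) by (apply pow_le, Cmod_ge_0).
assert (P1 := Cmod_ge_0 (H z)). assert (P2 := Cmod_ge_0 (w z)).
replace (4 * (Cmod (H 0) + 1) / (A - B) * Cmod z ^ n)%R with (Cmod z ^ n * (4 * (Cmod (H 0) + 1)) / (A - B))%R by (field; lra).
apply Rle_div_r; [lra|].
assert (Q1 : ((A - B) * Cmod (w z) * (1 / 2) <= (A - B) * Cmod (w z) * Cmod (F z))%R).
{ apply Rmult_le_compat_l; [apply Rmult_le_pos; lra|exact B1]. }
assert (Q2 : (Cmod z ^ n * Cmod (H z) * Cmod (1 + RtoC B * w z) <= Cmod z ^ n * (Cmod (H 0) + 1) * 2)%R).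
{ apply Rmult_le_compat; [apply Rmult_le_pos; assumption|apply Cmod_ge_0| |exact B3].
  apply Rmult_le_compat_l; assumption. }
lra.
Qed.

(* With rho = r^n, the left end of the disk of values of q is at least -1/e, and the right end
   is at most e; the denominators 1 - B rho and 1 + B rho are cleared. *)
Definition condL (A B rho : R) : Prop := ((A - (1 - / e_) * B) * rho <= / e_)%R.
Definition condR (A B rho : R) : Prop := ((A - (e_ + 1) * B) * rho <= e_)%R.

Lemma inv_e : exp (- (1)) = (/ e_)%R.
Proof. unfold e_. rewrite exp_Ropp. reflexivity. Qed.

Lemma e_gt : (2.44 < e_)%R.
Proof. apply exp_1_gt. Qed.

Lemma inD_scale (r : R) (z : C) : (0 < r <= 1)%R -> inD z -> inD (RtoC r * z).
Proof.
unfold inD. intros Hr Hz. rewrite Cmod_mult, Cmod_R, Rabs_pos_eq by lra.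
generalize (Cmod_ge_0 z). nra.
Qed.

Lemma cder_scale (r : R) (f : C -> C) (z d : C) : cder f (RtoC r * z) d ->
  cder (fun y => f (RtoC r * y)) z (d * RtoC r).
Proof.
intros H. apply (cder_comp f (fun y => RtoC r * y)); [exact H|].
assert (E : RtoC r * 1 = RtoC r) by ring. pattern (RtoC r) at 2. rewrite <- E.
apply cder_scal, cder_id.
Qed.

Lemma cder_dilate (r : R) (f : C -> C) (z d : C) : (0 < r)%R ->
  cder f (RtoC r * z) d -> cder (dilate r f) z d.
Proof.
intros Hr H. assert (Hr0 : RtoC r <> 0) by (intros E; apply RtoC_inj in E; lra).
apply (cder_ext (fun y => / RtoC r * f (RtoC r * y))).
{ intros y. unfold dilate, Cdiv. ring. }
replace d with (/ RtoC r * (d * RtoC r)) by (field; exact Hr0).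
apply cder_scal, cder_scale, H.
Qed.

Lemma classA_dilate (n : nat) (r : R) (f : C -> C) : (0 < r <= 1)%R -> classA n f -> classA n (dilate r f).
Proof.
intros Hr [a [Hf [Ha0 [Ha1 Ha]]]].
assert (Hr0 : RtoC r <> 0) by (intros E; apply RtoC_inj in E; lra).
exists (fun k => a k * RtoC r ^ k / RtoC r). split; [|split; [|split]].
- intros z Hz. assert (Hm : (0 < r)%R) by lra.
  assert (E : forall N, psum (fun k => a k * RtoC r ^ k / RtoC r) z N = / RtoC r * psum a (RtoC r * z) N).
  { induction N as [|N IH]; [rewrite !psum_0; simpl; field; exact Hr0|].
    rewrite !psum_S, IH, Cpow_mult_l. field. exact Hr0. }
  apply is_pseries_psum. intros eps He.
  assert (He2 : (0 < eps * r)%R) by (apply Rmult_lt_0_compat; lra).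
  destruct (proj1 (is_pseries_psum _ _ _) (Hf _ (inD_scale r z Hr Hz)) _ He2) as [N HN].
  exists N. intros m Hm2. specialize (HN m Hm2). rewrite E. unfold dilate.
  replace (/ RtoC r * psum a (RtoC r * z) m - f (RtoC r * z) / RtoC r)
    with ((psum a (RtoC r * z) m - f (RtoC r * z)) / RtoC r) by (field; exact Hr0).
  rewrite Cmod_div, Cmod_R, Rabs_pos_eq by (lra || exact Hr0). apply Rlt_div_l; assumption.
- rewrite Ha0. field. exact Hr0.
- rewrite Ha1. simpl. field. exact Hr0.
- intros k Hk. rewrite Ha by exact Hk. field. exact Hr0.
Qed.

Lemma dilate_in_Swp (n : nat) (A B r : R) (f : C -> C) : (1 <= n)%nat -> (-1 <= B < A)%R -> (A <= 1)%R ->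
  (0 < r <= 1)%R -> condL A B (r ^ n) -> condR A B (r ^ n) -> SAB n A B f -> Swp n (dilate r f).
Proof.
intros Hn HB HA Hr HL HR [Hf [w [Hw Heq]]].
split; [apply classA_dilate; assumption|].
assert (Hord := SAB_schwarz_order n A B f w Hn HB HA Hf Hw Heq).
destruct Hw as [[c Hc] [Hw0 Hwb]].
destruct (pseries_C1 c w Hc) as [w' [_ HC]].
set (rho := (r ^ n)%R) in *.
assert (Hrho : (0 < rho <= 1)%R).
{ unfold rho. split; [apply pow_lt; lra|]. rewrite <- (pow1 n). apply pow_incr; lra. }
assert (He := e_gt).
assert (Hie : (0 < / e_)%R) by (apply Rinv_0_lt_compat; lra).
(* Only B = -1, rho = 1 could fail, where the disk of values of q becomes a half plane; [condR]
   would then read A + e + 1 <= e, which A > -1 excludes. *)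
assert (HBrho : (Rabs B * rho < 1)%R).
{ unfold condR in HR. unfold Rabs. destruct (Rcase_abs B); [|nra].
  destruct (Req_dec rho 1) as [E|E]; [|nra]. rewrite E in *. nra. }
assert (Habs : (- (1) < B * rho < 1)%R).
{ assert (Rabs (B * rho) < 1)%R by (rewrite Rabs_mult, (Rabs_pos_eq rho) by lra; exact HBrho).
  apply Rabs_def2 in H. lra. }
set (D := (1 - B ^ 2 * rho ^ 2)%R).
assert (ED : (D = (1 - B * rho) * (1 + B * rho))%R) by (unfold D; ring).
assert (HD : (0 < D)%R) by (rewrite ED; apply Rmult_lt_0_compat; lra).
set (b := ((B ^ 2 - A * B) * rho ^ 2 / D)%R). set (m := ((A - B) * rho / D)%R).
assert (Eb : (b = - (B * rho) * m)%R) by (unfold b, m; field; lra).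
assert (Hmpos : (0 < m)%R) by (unfold m; apply Rdiv_lt_0_compat; [apply Rmult_lt_0_compat|]; lra).
(* From b = - B rho m, the ends of the diameter satisfy m - b = m (1 + B rho) and m + b = m (1 - B
   rho). After cancelling a factor of D these are the quotients bounded by [condL] and [condR]. *)
assert (C1 : (Rabs b <= m)%R) by (rewrite Eb; apply Rabs_le; nra).
assert (C2 : (m <= b + exp (- (1)))%R).
{ rewrite inv_e, Eb. assert (m * (1 + B * rho) <= / e_)%R; [|lra].
  replace (m * (1 + B * rho))%R with ((A - B) * rho / (1 - B * rho))%R by (unfold m; rewrite ED; field; lra).
  apply Rle_div_l; [lra|]. unfold condL in HL. lra. }
assert (C3 : (m <= exp 1 - b)%R).
{ fold e_. rewrite Eb. assert (m * (1 - B * rho) <= e_)%R; [|lra].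
  replace (m * (1 - B * rho))%R with ((A - B) * rho / (1 + B * rho))%R by (unfold m; rewrite ED; field; lra).
  apply Rle_div_l; [lra|]. unfold condR in HR. lra. }
assert (HWr : forall z, inD z -> (Cmod (w (RtoC r * z)%C) < rho)%R).
{ intros z Hz. apply Rle_lt_trans with (1 := Hord _ (inD_scale r z Hr Hz)).
  rewrite Cmod_mult, Cmod_R, Rabs_pos_eq, Rpow_mult_distr by lra. fold rho.
  assert (Cmod z ^ n < 1)%R; [|nra].
  destruct n as [|n']; [lia|]. apply pow_lt_1_compat; [split; [apply Cmod_ge_0|exact Hz]|lia]. }
assert (Hne : forall z, inD z -> 1 + RtoC B * w (RtoC r * z) <> 0).
{ intros z Hz. apply one_plus_neq_0. rewrite Cmod_mult, Cmod_R.
  apply Rle_lt_trans with (2 := HBrho). apply Rmult_le_compat_l; [apply Rabs_pos|]. apply Rlt_le, HWr, Hz. }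
set (W := fun z : C => w (RtoC r * z)). set (W' := fun z : C => w' (RtoC r * z) * RtoC r).
assert (HWC : C1_on_D W W').
{ intros z Hz. destruct (HC _ (inD_scale r z Hr Hz)) as [H1 H2]. split.
  - apply cder_scale, H1.
  - apply continuous_Cmult; [|apply continuous_const].
    apply (continuous_comp (fun y => RtoC r * y) w'); [|exact H2].
    apply continuous_Cmult; [apply continuous_const|apply continuous_id]. }
destruct (lift_through_zexpz (fun z => (RtoC (A - B) * W z) * / (1 + RtoC B * W z))
  (fun z => (RtoC (A - B) * W' z) * / (1 + RtoC B * W z) + (RtoC (A - B) * W z) *
     (- (0 + RtoC B * W' z) / ((1 + RtoC B * W z) * (1 + RtoC B * W z))))) as [om [Hom Eom]].
- intros z Hz. destruct (HWC z Hz) as [H1 H2]. assert (H3 := cder_continuous _ _ _ H1). split.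
  + apply (cder_mult (fun z => RtoC (A - B) * W z) (fun z => / (1 + RtoC B * W z))); [apply cder_scal, H1|].
    apply (cder_inv (fun z => 1 + RtoC B * W z)); [|apply Hne, Hz].
    apply cder_plus; [apply cder_const|apply cder_scal, H1].
  + assert (H4 : continuous (fun z => 1 + RtoC B * W z) z).
    { apply continuous_Cplus; [apply continuous_const|]. apply continuous_Cmult; [apply continuous_const|exact H3]. }
    assert (H5 : continuous (fun z => RtoC B * W' z) z) by (apply continuous_Cmult; [apply continuous_const|exact H2]).
    apply continuous_Cplus; apply continuous_Cmult.
    * apply continuous_Cmult; [apply continuous_const|exact H2].
    * apply continuous_Cinv; [exact H4|apply Hne, Hz].
    * apply continuous_Cmult; [apply continuous_const|exact H3].
    * apply continuous_Cmult.
      -- apply continuous_Copp, continuous_Cplus; [apply continuous_const|exact H5].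
      -- apply continuous_Cinv; [apply continuous_Cmult; exact H4|]. apply Cmult_neq_0; apply Hne, Hz.
- unfold W. replace (RtoC r * 0) with (RtoC 0) by ring. rewrite Hw0. ring.
- intros z Hz. apply (zexpz_onto_disk _ b m C1 C2 C3).
  apply (moebius_disk A B rho (W z)); [lra|lra|exact HBrho|apply HWr, Hz].
- exists om. split; [exact Hom|].
  intros z Hz Hz0. assert (Hrz := inD_scale r z Hr Hz).
  assert (Hr0 : RtoC r <> 0) by (intros E; apply RtoC_inj in E; lra).
  destruct (Heq _ Hrz (Cmult_neq_0 _ _ Hr0 Hz0)) as [Hfz [d [Hd Ed]]]. split.
  + unfold dilate, Cdiv. apply Cmult_neq_0; [exact Hfz|].
    intros E. apply C1_nz. replace (RtoC 1) with (RtoC r * / RtoC r) by (field; exact Hr0). rewrite E; ring.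
  + exists d. split.
    * apply cder_is_derive, cder_dilate; [lra|]. apply cder_is_derive, Hd.
    * unfold wp. fold (zexpz (om z)). rewrite Eom by exact Hz.
      transitivity (RtoC r * z * d / f (RtoC r * z)).
      { unfold dilate. field. split; assumption. }
      rewrite Ed. unfold Janowski, W. rewrite RtoC_minus. field. apply Hne, Hz.
Qed.

(** * Extremal functions and radii *)

Lemma zexpz_neq_e (u : C) : inD u -> zexpz u <> RtoC e_.
Proof.
intros Hu E. unfold inD in Hu. assert (H := Cmod_zexpz u). assert (Hp := exp_pos 1).
rewrite E, Cmod_R, Rabs_pos_eq in H by (unfold e_; lra). unfold e_ in H.
assert (Hx := re_le_Cmod u). apply Rabs_le_between in Hx.
assert (exp (Re u) <= exp 1)%R by (apply exp_le; lra).
assert (H2 := exp_pos (Re u)). assert (H3 := Cmod_ge_0 u). nra.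
Qed.

(** Modulus alone does not decide this. Writing u = x + i y, the equation gives y = e^(-1-x) sin y
    with e^(-1-x) < 1, so |sin y| < |y| for y <> 0 forces y = 0. Then e^v = 1 + v for v = -1 - x,
    hence x = -1, which is not in the disk. *)
Lemma zexpz_neq_minus_inv_e (u : C) : inD u -> zexpz u <> RtoC (- / e_).
Proof.
intros Hu E. unfold inD in Hu.
assert (Hx := re_le_Cmod u). apply Rabs_le_between in Hx.
assert (Hy := im_le_Cmod u). apply Rabs_le_between in Hy.
destruct u as [x y]. simpl Re in Hx. simpl Im in Hy. set (M := Cmod (x, y)) in *.
assert (E1 := f_equal Re E). assert (E2 := f_equal Im E).
rewrite <- inv_e in E1. simpl in E1, E2.
assert (Hp := exp_pos x).
assert (Ei : (exp x * (x * cos y - y * sin y) = - exp (- (1)))%R) by lra.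
assert (E3 : (x * sin y + y * cos y = 0)%R).
{ apply (Rmult_eq_reg_l (exp x)); [lra|lra]. }
assert (HE : (exp (- (1)) = exp x * exp (- (1) - x))%R) by (rewrite <- exp_plus; f_equal; ring).
assert (E4 : (x * cos y - y * sin y = - exp (- (1) - x))%R).
{ apply (Rmult_eq_reg_l (exp x)); [|lra]. rewrite Ei, HE. ring. }
assert (Hlt : (exp (- (1) - x) < exp 0)%R) by (apply exp_increasing; lra). rewrite exp_0 in Hlt.
assert (Hp2 := exp_pos (- (1) - x)).
assert (Hs := sin2_cos2 y). unfold Rsqr in Hs.
assert (E5 : (y = exp (- (1) - x) * sin y)%R).
{ assert (x * sin y * cos y - y * (sin y * sin y) = - exp (- (1) - x) * sin y)%R.
  { rewrite <- E4. ring. }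
  assert (x * sin y * cos y = - y * (cos y * cos y))%R.
  { replace (x * sin y)%R with (- (y * cos y))%R by lra. ring. }
  replace y with (y * (sin y * sin y + cos y * cos y))%R at 1 by (rewrite Hs; ring). lra. }
destruct (Rtotal_order y 0) as [Hn|[H0|Hpos]].
- assert (HP := PI2_1). unfold PI2 in *.
  assert (K := sin_lt_x (- y) ltac:(lra)). rewrite sin_neg in K.
  assert (K2 : (0 < sin (- y))%R) by (apply sin_gt_0; lra). rewrite sin_neg in K2. nra.
- subst y. rewrite sin_0, cos_0 in E4.
  destruct (Req_dec (- (1) - x) 0) as [Hz|Hz]; [lra|].
  assert (K := exp_ineq1 _ Hz). lra.
- assert (HP := PI2_1).
  assert (K := sin_lt_x y ltac:(lra)).
  assert (K2 : (0 < sin y)%R) by (apply sin_gt_0; lra). nra.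
Qed.

(** K is (ka / B) log(1 + B z), or ka z when B = 0; defining it by its series treats both cases at
    once. *)
Lemma log_kernel_exists (ka B : R) : (-1 <= B <= 1)%R ->
  exists K : C -> C, K 0 = 0 /\ forall z, inD z -> cder K z (RtoC ka / (1 + RtoC B * z)).
Proof.
intros HB.
set (k := fun j => match j with O => RtoC 0 | S i => RtoC (ka * (- B) ^ i / INR (S i)) end).
assert (Hpow : forall i, (Rabs ((- B) ^ i) <= 1)%R).
{ intros i. rewrite <- RPow_abs, <- (pow1 i). apply pow_incr. split; [apply Rabs_pos|apply Rabs_le; lra]. }
assert (Hk : forall j, (Cmod (k j) <= Rabs ka)%R).
{ intros [|i].
  - change (k 0%nat) with (RtoC 0). rewrite Cmod_0. apply Rabs_pos.
  - change (k (S i)) with (RtoC (ka * (- B) ^ i / INR (S i))). rewrite Cmod_R. unfold Rdiv. rewrite !Rabs_mult.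
    assert (H1 : (1 <= INR (S i))%R) by (rewrite S_INR; generalize (pos_INR i); lra).
    assert (H2 : (0 < / INR (S i) <= 1)%R).
    { split; [apply Rinv_0_lt_compat; lra|]. rewrite <- Rinv_1. apply Rinv_le_contravar; lra. }
    rewrite (Rabs_pos_eq (/ INR (S i))) by lra. specialize (Hpow i).
    generalize (Rabs_pos ka) (Rabs_pos ((- B) ^ i)). intros.
    assert (Rabs ka * Rabs ((- B) ^ i) <= Rabs ka * 1)%R by (apply Rmult_le_compat_l; assumption).
    assert (0 <= Rabs ka * Rabs ((- B) ^ i))%R by (apply Rmult_le_pos; assumption). nra. }
destruct (choice_fun (fun (z : C) l => (Cmod z < 1)%R -> is_pseries k z l)) as [K HK].
{ intros z. destruct (Rlt_dec (Cmod z) 1) as [Hz|Hz]; [|exists (RtoC 0); tauto].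
  destruct (ex_pseries_geom k z (Rabs ka) (Cmod z)) as [l Hl].
  - split; [apply Cmod_ge_0|exact Hz].
  - intros j. rewrite Cmod_mult, Cmod_pow, Rmult_comm. apply Rmult_le_compat_r; [apply pow_le, Cmod_ge_0|apply Hk].
  - exists l; auto. }
exists K. split.
{ rewrite (pseries_at_0 _ _ (HK 0 ltac:(rewrite Cmod_0; lra))). reflexivity. }
intros z Hz. destruct (pseries_cder 1 k K z HK Hz) as [d [Hd Hder]].
replace (RtoC ka / (1 + RtoC B * z)) with d; [exact Hder|].
apply (is_pseries_C_unique (dcoef k) z); [exact Hd|].
unfold inD in Hz.
assert (HBz : (Cmod (RtoC B * z) <= Cmod z)%R).
{ rewrite Cmod_mult, Cmod_R. assert (Rabs B <= 1)%R by (apply Rabs_le; lra). generalize (Cmod_ge_0 z). intros. nra. }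
assert (Hne : 1 + RtoC B * z <> 0) by (apply one_plus_neq_0; lra).
assert (Hm := proj1 (Cmod_gt_0 _) Hne).
assert (Edk : forall i, dcoef k i = RtoC ka * RtoC (- B) ^ i).
{ intros i. unfold dcoef. change (k (S i)) with (RtoC (ka * (- B) ^ i / INR (S i))). rewrite <- RtoC_mult, <- RtoC_pow, <- RtoC_mult. f_equal. field. apply not_0_INR. lia. }
(* The differentiated series is geometric with ratio - B z, so its remainder is known in closed
   form. *)
assert (Eps : forall N, psum (dcoef k) z N - RtoC ka / (1 + RtoC B * z) =
   - (RtoC ka * (- (RtoC B * z)) ^ S N / (1 + RtoC B * z))).
{ induction N as [|N IH].
  - rewrite psum_0, Edk. simpl. field. exact Hne.
  - rewrite psum_S. 
    replace (psum (dcoef k) z N + z ^ S N * dcoef k (S N) - RtoC ka / (1 + RtoC B * z))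
     with ((psum (dcoef k) z N - RtoC ka / (1 + RtoC B * z)) + z ^ S N * dcoef k (S N)) by ring.
    rewrite IH, Edk, (Cpow_S _ (S N)).
    replace (z ^ S N * (RtoC ka * RtoC (- B) ^ S N)) with (RtoC ka * (- (RtoC B * z)) ^ S N).
    + field. exact Hne.
    + replace (- (RtoC B * z)) with (RtoC (- B) * z) by (rewrite RtoC_opp; ring). rewrite Cpow_mult_l. ring. }
apply (is_pseries_geom_intro _ _ _ ((Rabs ka + 1) / Cmod (1 + RtoC B * z)) (Cmod z)).
- split; [apply Cmod_ge_0|exact Hz].
- apply Rdiv_lt_0_compat; [generalize (Rabs_pos ka); lra|exact Hm].
- intros N. rewrite Eps, Cmod_opp, Cmod_div, Cmod_mult, Cmod_R, Cmod_pow, Cmod_opp by exact Hne.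
  unfold Rdiv. rewrite (Rmult_assoc _ (/ _)), (Rmult_comm (/ _)), <- Rmult_assoc.
  apply Rmult_le_compat_r; [apply Rlt_le, Rinv_0_lt_compat, Hm|].
  assert (H0 := Cmod_ge_0 (RtoC B * z)).
  apply Rmult_le_compat; [apply Rabs_pos|apply pow_le; lra|lra|].
  apply Rle_trans with (Cmod z ^ S N)%R; [apply pow_incr; lra|].
  simpl. rewrite <- (Rmult_1_l (Cmod z ^ N)) at 2. apply Rmult_le_compat_r; [apply pow_le, Cmod_ge_0|lra].
Qed.

Lemma is_pseries_id (z : C) : is_pseries (fun k => if Nat.eq_dec k 1 then RtoC 1 else RtoC 0) z z.
Proof.
apply is_pseries_psum. intros eps He. exists 1%nat. intros m Hm.
replace (psum _ z m) with z; [rewrite Cminus_self, Cmod_0; exact He|].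
induction m as [|m IH]; [lia|].
rewrite psum_S. destruct m as [|m].
- rewrite psum_0. simpl. ring.
- rewrite <- IH by lia. simpl. ring.
Qed.

(** For functions that are not given by a series, such as the extremal ones, the normalization is
    read off from the size of f(z) - z near 0. *)
Lemma classA_of_order (n : nat) (f : C -> C) (M dl : R) : analytic_D f -> (1 <= n)%nat -> (0 < dl)%R ->
  (forall z : C, (Cmod z < dl)%R -> (Cmod (f z - z) <= M * Cmod z ^ S n)%R) -> classA n f.
Proof.
intros [a Ha] Hn Hdl HM.
assert (K : forall k, (k < S n)%nat -> a k - (if Nat.eq_dec k 1 then RtoC 1 else RtoC 0) = 0).
{ apply (pseries_order (S n) 1 (fun k => a k - (if Nat.eq_dec k 1 then RtoC 1 else RtoC 0)) (fun z => f z - z) M dl Rlt_0_1 Hdl).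
  - intros z Hz. apply (is_pseries_minus (K:=C_AbsRing) (V:=C_NormedModule) a _ z (f z) z); [apply Ha, Hz|apply is_pseries_id].
  - intros z _ Hz. apply HM, Hz. }
exists a. split; [exact Ha|]. split; [|split].
- specialize (K 0%nat ltac:(lia)). simpl in K. rewrite Cminus_0_r in K. exact K.
- specialize (K 1%nat ltac:(lia)). simpl in K. apply Ceq_minus. exact K.
- intros k Hk. specialize (K k ltac:(lia)). destruct (Nat.eq_dec k 1) as [->|_]; [lia|].
  rewrite Cminus_0_r in K. exact K.
Qed.

Lemma cder_pow_gen (n : nat) (z : C) : (1 <= n)%nat -> cder (fun y => y ^ n) z (RtoC (INR n) * z ^ (n - 1)).
Proof. destruct n as [|n]; [lia|]. intros _. replace (S n - 1)%nat with n by lia. apply cder_pow. Qed.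

(** For B <> 0 the function is z (1 + B s z^n)^((A - B) / (n B)), written as z exp(K(s z^n)) to
    avoid complex powers. The logarithmic derivative of the second factor times z is n w K'(w) with
    w = s z^n, which explains ka = (A - B) / n. *)
Lemma extremal_exists (n : nat) (A B s : R) : (1 <= n)%nat -> (-1 <= B < A)%R -> (A <= 1)%R ->
  (Rabs s = 1)%R ->
  exists f, SAB n A B f /\ forall z, inD z -> z <> 0 -> f z <> 0 /\
    exists d, cder f z d /\ z * d / f z = Janowski A B (RtoC s * z ^ n).
Proof.
intros Hn HB HA Hs.
assert (HnR : (0 < INR n)%R) by (apply lt_0_INR; lia).
assert (HnC : RtoC (INR n) <> 0) by (intros E; apply RtoC_inj in E; lra).
destruct (log_kernel_exists ((A - B) / INR n) B ltac:(lra)) as [K [HK0 HK]].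
set (w := fun z : C => RtoC s * z ^ n).
assert (HwM : forall z, Cmod (w z) = (Cmod z ^ n)%R).
{ intros z. unfold w. rewrite Cmod_mult, Cmod_pow, Cmod_R, Hs. ring. }
assert (HwD : forall z, inD z -> inD (w z)).
{ intros z Hz. unfold inD. rewrite HwM. apply pow_lt_1_compat; [split; [apply Cmod_ge_0|exact Hz]|lia]. }
set (w' := fun z : C => RtoC s * (RtoC (INR n) * z ^ (n - 1))).
assert (Hw : forall z, cder w z (w' z)).
{ intros z. apply cder_scal, cder_pow_gen, Hn. }
assert (Hcid : forall z : C, continuous (fun y : C => y) (z : C_UniformSpace)) by (intros; apply continuous_id).
assert (Hcw' : forall z : C, continuous w' (z : C_UniformSpace)).
{ intros z. unfold w'. apply continuous_Cmult; [apply continuous_const|]. apply continuous_Cmult; [apply continuous_const|].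
  apply continuous_Cpow, Hcid. }
set (ka := RtoC ((A - B) / INR n)) in *.
set (g := fun z => Cexp (K (w z))).
set (L := fun z => ka / (1 + RtoC B * w z) * w' z).
assert (Hne : forall z, inD z -> 1 + RtoC B * w z <> 0).
{ intros z Hz. apply one_plus_neq_0. rewrite Cmod_mult, Cmod_R. specialize (HwD z Hz). unfold inD in HwD.
  assert (Rabs B <= 1)%R by (apply Rabs_le; lra). generalize (Cmod_ge_0 (w z)) (Rabs_pos B). intros. nra. }
assert (Hg : forall z, inD z -> cder g z (g z * L z)).
{ intros z Hz. apply (cder_comp Cexp (fun z => K (w z))); [apply cder_Cexp|].
  apply (cder_comp K w); [apply HK, HwD, Hz|apply Hw]. }
set (f := fun z => z * g z).
set (f' := fun z => 1 * g z + z * (g z * L z)).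
assert (HfC : C1_on_D f f').
{ intros z Hz. split.
  - apply (cder_mult (fun z => z)); [apply cder_id|apply Hg, Hz].
  - assert (Hcg := cder_continuous _ _ _ (Hg z Hz)).
    assert (Hcw := cder_continuous _ _ _ (Hw z)).
    apply continuous_Cplus; apply continuous_Cmult; try apply continuous_const; try apply Hcid; try exact Hcg.
    apply continuous_Cmult; [exact Hcg|]. apply continuous_Cmult; [|apply Hcw'].
    apply continuous_Cmult; [apply continuous_const|]. apply continuous_Cinv; [|apply Hne, Hz].
    apply continuous_Cplus; [apply continuous_const|]. apply continuous_Cmult; [apply continuous_const|exact Hcw]. }
assert (Hquot : forall z, inD z -> z <> 0 -> f z <> 0 /\
    exists d, cder f z d /\ z * d / f z = Janowski A B (RtoC s * z ^ n)).
{ intros z Hz Hz0. assert (Hgz : g z <> 0) by apply Cexp_neq_0. split; [apply Cmult_neq_0; assumption|].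
  exists (f' z). split; [apply HfC, Hz|].
  specialize (Hne z Hz). fold (w z).
  assert (EL : z * L z = RtoC (A - B) * w z / (1 + RtoC B * w z)).
  { unfold L, ka. rewrite RtoC_div by lra.
    replace (RtoC (A - B) * w z) with (RtoC (A - B) / RtoC (INR n) * (z * w' z)).
    - field. split; assumption.
    - unfold w', w. destruct n as [|n']; [lia|]. replace (S n' - 1)%nat with n' by lia. rewrite (Cpow_S z n'). field. exact HnC. }
  unfold f, f', Janowski.
  transitivity (1 + z * L z); [field; split; assumption|]. rewrite EL, RtoC_minus. field. exact Hne. }
exists f. split; [|exact Hquot]. split.
- assert (H0D : inD 0) by (unfold inD; rewrite Cmod_0; lra).
  assert (HcompD : cder (fun x => Cexp (K x)) 0 (Cexp (K 0) * (ka / (1 + RtoC B * 0)))).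
  { apply (cder_comp Cexp K); [apply cder_Cexp|apply HK, H0D]. }
  destruct (cder_bound _ _ _ HcompD) as [M [dl [Hdl [HM Hb]]]].
  apply (classA_of_order n f M (Rmin dl 1)); [apply (C1_analytic f f' HfC)|exact Hn|apply Rmin_pos; lra|].
  intros z Hz.
  assert (Hz1 : (Cmod z < dl)%R) by (apply Rlt_le_trans with (1 := Hz), Rmin_l).
  assert (Hz2 : (Cmod z < 1)%R) by (apply Rlt_le_trans with (1 := Hz), Rmin_r).
  specialize (Hb (w z)). rewrite HK0, Cexp_0, Cminus_0_r, HwM in Hb.
  replace (f z - z) with (z * (Cexp (K (w z)) - 1)) by (unfold f, g; ring).
  rewrite Cmod_mult. simpl. assert (H0 := Cmod_ge_0 z).
  replace (M * (Cmod z * Cmod z ^ n))%R with (Cmod z * (M * Cmod z ^ n))%R by ring.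
  apply Rmult_le_compat_l; [exact H0|]. apply Hb.
  apply Rle_lt_trans with (2 := Hz1). destruct n as [|n']; [lia|]. simpl.
  assert (Cmod z ^ n' <= 1)%R by (rewrite <- (pow1 n'); apply pow_incr; lra).
  apply Rle_trans with (Cmod z * 1)%R; [apply Rmult_le_compat_l; assumption|lra].
- exists w. split; [split; [|split]|].
  + apply (C1_analytic w w'). intros z Hz. split; [apply Hw|apply Hcw'].
  + unfold w. destruct n as [|n']; [lia|]. rewrite Cpow_S. ring.
  + exact HwD.
  + intros z Hz Hz0. destruct (Hquot z Hz Hz0) as [H1 [d [H2 H3]]]. split; [exact H1|].
    exists d. split; [apply cder_is_derive, H2|exact H3].
Qed.

(** * Good radii and their closed forms *)

Lemma Rpower_inv_pow (y : R) (n : nat) : (1 <= n)%nat -> (0 < y)%R -> (Rpower y (/ INR n) ^ n = y)%R.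
Proof.
intros Hn Hy. assert (HnR : (0 < INR n)%R) by (apply lt_0_INR; lia).
rewrite <- Rpower_pow by (unfold Rpower; apply exp_pos).
rewrite Rpower_mult, Rinv_l by lra. apply Rpower_1, Hy.
Qed.

Lemma pow_lt_reg (x y : R) (n : nat) : (0 <= y)%R -> (x ^ n < y ^ n)%R -> (x < y)%R.
Proof.
intros Hy H. apply Rnot_le_lt. intros Hle. apply (Rlt_irrefl (x ^ n)).
apply Rlt_le_trans with (1 := H), pow_incr. lra.
Qed.

Lemma pow_le_Rpower (r X : R) (n : nat) : (1 <= n)%nat -> (0 < X)%R -> (0 <= r)%R ->
  ((r ^ n <= X)%R <-> (r <= Rpower X (/ INR n))%R).
Proof.
intros Hn HX Hr. assert (HP : (0 < Rpower X (/ INR n))%R) by apply exp_pos. split; intros H.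
- apply Rnot_lt_le. intros Hlt. apply (Rlt_irrefl X). apply Rlt_le_trans with (2 := H).
  rewrite <- (Rpower_inv_pow X n Hn HX) at 1.
  apply Rnot_le_lt. intros Hle.
  destruct n as [|n]; [lia|].
  assert (Rpower X (/ INR (S n)) ^ n <= r ^ n)%R by (apply pow_incr; lra).
  assert (0 < Rpower X (/ INR (S n)) ^ n)%R by (apply pow_lt, HP).
  rewrite <- !tech_pow_Rmult in Hle. set (p := Rpower X (/ INR (S n))) in *.
  assert (r * p ^ n <= r * r ^ n)%R by (apply Rmult_le_compat_l; assumption).
  assert (p * p ^ n < r * p ^ n)%R by (apply Rmult_lt_compat_r; assumption). lra.
- rewrite <- (Rpower_inv_pow X n Hn HX). apply pow_incr. lra.
Qed.

(* If x < r^n, then the extremal function of sign s, dilated by r, makes q take the value v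
   at the real point t with (r t)^n = x. *)
Lemma good_radius_excludes (n : nat) (A B s r v x : R) : (1 <= n)%nat -> (-1 <= B < A)%R -> (A <= 1)%R ->
  (Rabs s = 1)%R -> (forall u, inD u -> zexpz u <> RtoC v) ->
  good_radius (Swp n) (SAB n A B) r -> (0 < x)%R -> (1 + B * (s * x) <> 0)%R ->
  ((A - B) * (s * x) = v * (1 + B * (s * x)))%R -> (r ^ n <= x)%R.
Proof.
intros Hn HB HA Hs Hv [Hr Hgood] Hx Hd Ex.
apply Rnot_lt_le. intros Hlt.
destruct (extremal_exists n A B s Hn HB HA Hs) as [f [Hf Hq]].
destruct (Hgood r ltac:(lra) f Hf) as [_ [om [[_ [_ Hom]] Heq]]].
assert (Hrn : (0 < r ^ n)%R) by (apply pow_lt; lra).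
set (y := (x / r ^ n)%R).
assert (Hy : (0 < y < 1)%R) by (unfold y; split; [apply Rdiv_lt_0_compat; lra|apply Rlt_div_l; lra]).
set (t := Rpower y (/ INR n)).
assert (Ht0 : (0 < t)%R) by apply exp_pos.
assert (Htn : (t ^ n = y)%R) by (apply Rpower_inv_pow; [exact Hn|lra]).
assert (Ht1 : (t < 1)%R) by (apply (pow_lt_reg t 1 n); [lra|]; rewrite Htn, pow1; lra).
assert (HtD : inD (RtoC t)) by (unfold inD; rewrite Cmod_R, Rabs_pos_eq; lra).
assert (HtN : RtoC t <> 0) by (intros E; apply RtoC_inj in E; lra).
assert (HrN : RtoC r <> 0) by (intros E; apply RtoC_inj in E; lra).
destruct (Heq (RtoC t) HtD HtN) as [_ [d [Hder Ed]]].
destruct (Hq (RtoC r * RtoC t) (inD_scale r _ Hr HtD) (Cmult_neq_0 _ _ HrN HtN)) as [Hfne [d2 [Hd2 Ed2]]].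
apply cder_is_derive in Hder.
assert (Edd := cder_unique _ _ _ _ Hder (cder_dilate r f (RtoC t) d2 ltac:(lra) Hd2)). subst d2.
assert (EE : wp (om (RtoC t)) = Janowski A B (RtoC (s * x))).
{ rewrite <- Ed. replace (RtoC (s * x)) with (RtoC s * (RtoC r * RtoC t) ^ n).
  - rewrite <- Ed2. unfold dilate. field. split; assumption.
  - rewrite <- RtoC_mult, <- RtoC_pow, <- RtoC_mult. f_equal. rewrite Rpow_mult_distr, Htn. unfold y. field. lra. }
assert (HdC : 1 + RtoC B * RtoC (s * x) <> 0).
{ rewrite <- RtoC_mult, <- RtoC_plus. intros E; apply RtoC_inj in E; lra. }
apply (Hv (om (RtoC t)) (Hom _ HtD)).
replace (zexpz (om (RtoC t))) with (wp (om (RtoC t)) - 1) by (unfold wp, zexpz; ring).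
rewrite EE. unfold Janowski.
transitivity (RtoC (A - B) * RtoC (s * x) / (1 + RtoC B * RtoC (s * x))).
{ rewrite RtoC_minus. field. exact HdC. }
assert (E2 : RtoC (A - B) * RtoC (s * x) = RtoC v * (1 + RtoC B * RtoC (s * x))).
{ rewrite <- !RtoC_mult, <- RtoC_plus, <- RtoC_mult. f_equal. exact Ex. }
rewrite E2. field. exact HdC.
Qed.

Lemma denL_pos (A B : R) : (-1 <= B < A)%R -> (0 <= A)%R -> (0 < A - (1 - / e_) * B)%R.
Proof.
intros HB HA. assert (He := e_gt).
assert (H1 : (0 < / e_)%R) by (apply Rinv_0_lt_compat; lra).
assert (H2 : (/ e_ < 1)%R) by (rewrite <- Rinv_1; apply Rinv_lt_contravar; lra).
destruct (Rle_lt_dec 0 B); nra.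
Qed.

(** Necessity tests the extremal functions of sign -1 and +1, which reach -1/e and e respectively.
    Sufficiency uses that both conditions pass to smaller powers r'^n. All three claims of the final
    theorem are read off from this equivalence. *)
Theorem good_radius_iff (n : nat) (A B r : R) : (1 <= n)%nat -> (-1 <= B < A)%R -> (0 <= A <= 1)%R ->
  (good_radius (Swp n) (SAB n A B) r <-> (0 < r <= 1)%R /\ condL A B (r ^ n) /\ condR A B (r ^ n)).
Proof.
intros Hn HB HA. assert (He := e_gt).
assert (Hie : (0 < / e_)%R) by (apply Rinv_0_lt_compat; lra).
assert (HL := denL_pos A B HB (proj1 HA)).
split.
- intros H. assert (Hr := proj1 H). split; [exact Hr|].
  assert (Hrn : (0 < r ^ n)%R) by (apply pow_lt; lra).
  split.
  + unfold condL. rewrite Rmult_comm. apply Rle_div_r; [exact HL|].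
    apply (good_radius_excludes n A B (-1) r (- / e_)); try assumption; try lra.
    * rewrite Rabs_left; lra.
    * apply zexpz_neq_minus_inv_e.
    * apply Rdiv_lt_0_compat; assumption.
    (* The inverse of e is generalized to an atom, so that [field] works with the denominator in the
       form whose sign is known. *)
    * revert HL Hie. generalize (/ e_)%R. intros i HL Hie.
      replace (1 + B * (-1 * (i / (A - (1 - i) * B))))%R with ((A - B) / (A - (1 - i) * B))%R by (field; lra).
      apply Rgt_not_eq. apply Rdiv_lt_0_compat; lra.
    * revert HL. generalize (/ e_)%R. intros i HL. field. lra.
  (* For a nonpositive coefficient the right end never reaches e and the bound holds trivially; an
     extremal function is needed only in the other case. *)
  + unfold condR. destruct (Rle_lt_dec (A - (e_ + 1) * B) 0) as [Hneg|Hpos]; [nra|].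
    rewrite Rmult_comm. apply Rle_div_r; [exact Hpos|].
    apply (good_radius_excludes n A B 1 r e_); try assumption; try lra.
    * apply Rabs_pos_eq; lra.
    * apply zexpz_neq_e.
    * apply Rdiv_lt_0_compat; lra.
    * replace (1 + B * (1 * (e_ / (A - (e_ + 1) * B))))%R with ((A - B) / (A - (e_ + 1) * B))%R by (field; lra).
      apply Rgt_not_eq. apply Rdiv_lt_0_compat; lra.
    * field. lra.
- intros [Hr [H1 H2]]. split; [exact Hr|].
  intros r' Hr' f Hf.
  assert (Hp : (0 < r' ^ n <= r ^ n)%R) by (split; [apply pow_lt; lra|apply pow_incr; lra]).
  apply (dilate_in_Swp n A B r' f); try assumption; try lra.
  + unfold condL in *. nra.
  + unfold condR in *. destruct (Rle_lt_dec (A - (e_ + 1) * B) 0); nra.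
Qed.

Lemma Rmin_1_le (r X : R) (n : nat) : (1 <= n)%nat -> (0 < X)%R -> (0 < r)%R ->
  ((r <= Rmin 1 (Rpower X (/ INR n)))%R <-> (r <= 1)%R /\ (r ^ n <= X)%R).
Proof.
intros Hn HX Hr. rewrite (pow_le_Rpower r X n Hn HX) by lra. split.
- intros H. split; apply Rle_trans with (1 := H); [apply Rmin_l|apply Rmin_r].
- intros [H1 H2]. apply Rmin_glb; assumption.
Qed.

Lemma Rmin_1_pos (X y : R) : (0 < Rmin 1 (Rpower X y))%R.
Proof. apply Rmin_pos; [lra|apply exp_pos]. Qed.

Lemma le_Rad1_iff (n : nat) (A B r : R) : (1 <= n)%nat -> (-1 <= B < A)%R -> (0 <= A)%R -> (0 < r)%R ->
  ((r <= Rad1 n A B)%R <-> (r <= 1)%R /\ condL A B (r ^ n)).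
Proof.
intros Hn HB HA Hr. assert (HL := denL_pos A B HB HA). assert (He := e_gt).
assert (Hie : (0 < / e_)%R) by (apply Rinv_0_lt_compat; lra).
unfold Rad1. rewrite Rmin_1_le by (try assumption; apply Rdiv_lt_0_compat; assumption).
unfold condL. rewrite (Rmult_comm (A - _)), <- Rle_div_r by exact HL. tauto.
Qed.

Lemma le_Rad2_iff (n : nat) (A B r : R) : (1 <= n)%nat -> (-1 <= B < 0)%R -> (0 <= A)%R -> (0 < r)%R ->
  ((r <= Rad2 n A B)%R <-> (r <= 1)%R /\ condR A B (r ^ n)).
Proof.
intros Hn HB HA Hr. assert (He := e_gt).
assert (HR : (0 < A - (e_ + 1) * B)%R) by nra.
unfold Rad2. rewrite Rmin_1_le by (try assumption; apply Rdiv_lt_0_compat; lra).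
unfold condR. rewrite (Rmult_comm (A - _)), <- Rle_div_r by exact HR. tauto.
Qed.

(* The centre of the disk is at most sinh 1. *)
Definition condT (A B rho : R) : Prop :=
  ((B ^ 2 - A * B) * rho ^ 2 <= (e_ - / e_) / 2 * (1 - B ^ 2 * rho ^ 2))%R.

(** With k = sinh 1, [condT] solved for rho^2 reads rho^2 ((1 + k) B^2 - A B) <= k; the square
    explains the exponent 1/(2n). *)
Lemma le_rad1_iff (n : nat) (A B r : R) : (1 <= n)%nat -> (-1 <= B < 0)%R -> (0 <= A)%R -> (0 < r)%R ->
  ((r <= rad1 n A B)%R <-> condT A B (r ^ n)).
Proof.
intros Hn HB HA Hr. assert (He := e_gt).
assert (Hie : (e_ * / e_ = 1)%R) by (apply Rinv_r; lra).
assert (Hi2 : (0 < / e_)%R) by (apply Rinv_0_lt_compat; lra).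
set (k := ((e_ - / e_) / 2)%R).
assert (Hk : (0 < k)%R) by (unfold k; nra).
assert (E1 : ((e_ ^ 2 - 1) / (2 * e_) = k)%R) by (unfold k; field; lra).
assert (E2 : ((e_ ^ 2 + 2 * e_ - 1) / (2 * e_) = 1 + k)%R) by (unfold k; field; lra).
unfold rad1, condT. rewrite E1, E2. fold k.
assert (Hden : (0 < (1 + k) * B ^ 2 - A * B)%R) by (assert (0 < B ^ 2)%R by nra; nra).
replace (2 * INR n)%R with (INR (2 * n)) by (rewrite mult_INR; simpl; ring).
rewrite <- pow_le_Rpower; [|lia|apply Rdiv_lt_0_compat; assumption|lra].
rewrite <- Rle_div_r by exact Hden.
replace (r ^ (2 * n))%R with ((r ^ n) ^ 2)%R by (rewrite Nat.mul_comm, pow_mult; reflexivity).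
split; intros; lra.
Qed.

(** For centre b and radius m of the disk, m + b = (m - b) + 2 b <= 1/e + (e - 1/e) = e. The proof
    is this sum multiplied by 1 - B^2 rho^2; only the positive factor 1 - B rho is cancelled. *)
Lemma condL_condT_condR (A B rho : R) : (B < 0)%R -> (0 < rho)%R -> (0 <= 1 + B * rho)%R ->
  condL A B rho -> condT A B rho -> condR A B rho.
Proof.
intros HB Hrho Hs HL HT. unfold condL, condR, condT in *. assert (He := e_gt).
assert (H1 : ((A - B) * rho * (1 + B * rho) <= / e_ * (1 - B * rho) * (1 + B * rho))%R).
{ apply Rmult_le_compat_r; lra. }
assert (Ht : (0 < 1 - B * rho)%R) by nra.
apply (Rmult_le_reg_r (1 - B * rho)); [exact Ht|].
assert ((A - B) * rho * (1 - B * rho) <= e_ * (1 + B * rho) * (1 - B * rho))%R; [|lra].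
lra.
Qed.

(** When the left end is exactly -1/e, the same identity runs backwards: 2 b = (m + b) - (m - b) <=
    e - 1/e. *)
Lemma condL_eq_condR_condT (A B rho : R) : (B < 0)%R -> (0 < rho)%R -> (0 <= 1 + B * rho)%R ->
  ((A - (1 - / e_) * B) * rho = / e_)%R -> condR A B rho -> condT A B rho.
Proof.
intros HB Hrho Hs HL HR. unfold condR, condT in *. assert (He := e_gt).
assert (Ht : (0 < 1 - B * rho)%R) by nra.
assert (H1 : ((A - B) * rho * (1 + B * rho) = / e_ * (1 - B * rho) * (1 + B * rho))%R).
{ f_equal. lra. }
assert (H2 : ((A - B) * rho * (1 - B * rho) <= e_ * (1 + B * rho) * (1 - B * rho))%R).
{ apply Rmult_le_compat_r; lra. }
lra.
Qed.

Theorem mainTheorem9 :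
  (forall (n : nat) (A B : R), (1 <= n)%nat ->
     (0 <= B < A /\ A <= 1)%R ->
     is_radius (Swp n) (SAB n A B) (Rad1 n A B)) /\
  (forall (n : nat) (A B : R), (1 <= n)%nat ->
     (-1 <= B /\ B < 0 /\ 0 <= A /\ A <= 1)%R ->
     ((Rad1 n A B <= rad1 n A B)%R -> is_radius (Swp n) (SAB n A B) (Rad1 n A B)) /\
     ((rad1 n A B < Rad1 n A B)%R -> is_radius (Swp n) (SAB n A B) (Rad2 n A B))) /\
  is_radius (Swp 1) Sstar (/ (2 * e_ - 1)).
Proof.
assert (He := e_gt).
assert (Hie : (e_ * / e_ = 1)%R) by (apply Rinv_r; lra).
assert (Hi2 : (0 < / e_)%R) by (apply Rinv_0_lt_compat; lra).
assert (Hpow : forall r n, (0 < r <= 1)%R -> (0 < r ^ n <= 1)%R).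
{ intros r n Hr. split; [apply pow_lt; lra|]. rewrite <- (pow1 n). apply pow_incr; lra. }
split; [|split].
- intros n A B Hn [HB HA].
  assert (HP : (0 < Rad1 n A B)%R) by apply Rmin_1_pos.
  split.
  + apply good_radius_iff; [exact Hn|lra|lra|].
    destruct (proj1 (le_Rad1_iff n A B _ Hn ltac:(lra) ltac:(lra) HP) (Rle_refl _)) as [H1 H2].
    split; [lra|split; [exact H2|]].
    destruct (Hpow (Rad1 n A B) n ltac:(lra)) as [Hp1 Hp2].
    unfold condL, condR in *.
    (* For B >= 0 the left condition implies the right one: the two left-hand sides differ by (e +
       1/e) B rho >= 0, and 1/e <= e. *)
    assert (0 <= (e_ + / e_) * (B * Rad1 n A B ^ n))%R by (apply Rmult_le_pos; [lra|apply Rmult_le_pos; lra]).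
    assert (/ e_ <= 1)%R by (rewrite <- Rinv_1; apply Rinv_le_contravar; lra). lra.
  + intros r H. apply good_radius_iff in H; [|exact Hn|lra|lra].
    apply le_Rad1_iff; try tauto; lra.
- intros n A B Hn [HB [HB0 [HA0 HA]]].
  assert (HP : (0 < Rad1 n A B)%R) by apply Rmin_1_pos.
  destruct (proj1 (le_Rad1_iff n A B _ Hn ltac:(lra) HA0 HP) (Rle_refl _)) as [H1 H2].
  destruct (Hpow (Rad1 n A B) n ltac:(lra)) as [Hp1 Hp2].
  split; intros Hcase.
  + split.
    * apply good_radius_iff; [exact Hn|lra|lra|]. split; [lra|split; [exact H2|]].
      apply condL_condT_condR; try assumption; [nra|].
      apply le_rad1_iff; try assumption; lra.
    * intros r H. apply good_radius_iff in H; [|exact Hn|lra|lra].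
      apply le_Rad1_iff; try tauto; lra.
  + assert (HP2 : (0 < Rad2 n A B)%R) by apply Rmin_1_pos.
    destruct (proj1 (le_Rad2_iff n A B _ Hn ltac:(lra) HA0 HP2) (Rle_refl _)) as [H3 H4].
    split.
    * apply good_radius_iff; [exact Hn|lra|lra|]. split; [lra|split; [|exact H4]].
      destruct (Rle_lt_dec (Rad2 n A B) (Rad1 n A B)) as [Hle|Hlt].
      { apply (proj1 (le_Rad1_iff n A B _ Hn ltac:(lra) HA0 HP2) Hle). }
      (* Suppose [Rad1] < [Rad2]. As [Rad2] is at most 1, the minimum in [Rad1] is not 1, so the
         left end sits exactly at -1/e there. The right condition also holds there, so
         [condL_eq_condR_condT] gives [Rad1] <= [rad1], against the case assumption. *)
      exfalso.
      assert (Hlt2 := Hcase). apply Rlt_not_le in Hlt2. apply Hlt2.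
      apply le_rad1_iff; try assumption; [lra|].
      apply condL_eq_condR_condT; try assumption; [nra| |].
      -- assert (HL := denL_pos A B ltac:(lra) HA0).
         assert (HX : (0 < / e_ / (A - (1 - / e_) * B))%R) by (apply Rdiv_lt_0_compat; assumption).
         assert (ER : Rad1 n A B = Rpower (/ e_ / (A - (1 - / e_) * B)) (/ INR n)).
         { unfold Rad1 in *. revert Hlt. unfold Rmin. destruct (Rle_dec 1 _); intros; lra. }
         rewrite ER, Rpower_inv_pow by assumption.
         revert HL. generalize (/ e_)%R. intros i HL. field. lra.
      -- apply (proj1 (le_Rad2_iff n A B _ Hn ltac:(lra) HA0 HP)). lra.
    * intros r H. apply good_radius_iff in H; [|exact Hn|lra|lra].
      apply le_Rad2_iff; try tauto; lra.
- assert (Hd : (0 < 2 * e_ - 1)%R) by lra.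
  assert (HP : (0 < / (2 * e_ - 1))%R) by (apply Rinv_0_lt_compat; exact Hd).
  assert (Hi : (/ (2 * e_ - 1) * (2 * e_ - 1) = 1)%R) by (apply Rinv_l; lra).
  split.
  + apply (good_radius_iff 1 1 (-1)); [lia|lra|lra|]. unfold condL, condR. rewrite pow_1.
    (* For starlike functions the left condition is an equality at 1 / (2 e - 1). The right one has
       slack: 2 e - 1 >= 3 reduces it to (e + 2) / 3 <= e. *)
    assert (Hd3 : (/ (2 * e_ - 1) <= / 3)%R) by (apply Rinv_le_contravar; lra).
    split; [split; [exact HP|lra]|]. split; [right; field; lra|].
    apply Rle_trans with ((1 - (e_ + 1) * -1) * / 3)%R; [apply Rmult_le_compat_l; lra|lra].
  + intros r H. apply (good_radius_iff 1 1 (-1)) in H; [|lia|lra|lra].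
    destruct H as [Hr [HL _]]. unfold condL in HL. rewrite pow_1 in HL.
    apply (Rmult_le_reg_r (2 * e_ - 1)); [exact Hd|]. rewrite Hi.
    apply (Rmult_le_compat_l e_) in HL; [|lra]. rewrite Hie in HL.
    replace (e_ * ((1 - (1 - / e_) * -1) * r))%R with (r * (2 * e_ - e_ * / e_))%R in HL by ring.
    rewrite Hie in HL. exact HL.
Qed.
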